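(* Let $N\ge2$, $1\le k\le N-1$, and let $V,K,f,\Lambda$ satisfy all the assumptions listed in the context. For $\varepsilon>0$ small, let $u_\varepsilon$ be the positive solution of $$-\varepsilon^2\Delta u+V(x)u=K(x)f(u)\quad\text{in }\mathbb R^N$$ obtained by the penalization method, i.e. the positive least-energy solution of the penalized problem described in the context (which solves the equation $-\varepsilon^2\Delta u+V(x)u=K(x)f(u)$ in $\mathbb R^N$ for all small $\varepsilon$). If $N\ge5$ or $\liminf_{|x|\to\infty}|x|^2V(x)>0$, then, for $\varepsilon$ small enough, $u_\varepsilon\in L^2(\mathbb R^N)$.
   Context: $\mathbb R^+=[0,\infty)$. $\mathcal H\subset\mathbb R^N$ is a fixed linear subspace of dimension $N-k-1$; $x=(x',x'')$ with $x'\in\mathcal H$, $x''\in\mathcal H^\perp$. Assumptions. $V,K\in C(\mathbb R^N\setminus\{0\},\mathbb R^+)$, $K\not\equiv0$, $V\circ R=V$, $K\circ R=K$ for all $R\in\mathbf O(N)$ with $R(\mathcal H)=\mathcal H$. $f:\mathbb R^+\to\mathbb R^+$ is continuous with: $(f_1)$ $f(s)=O(s^q)$ as $s\to0^+$ for some $q>1$; $(f_2)$ $f(s)=O(s^p)$ as $s\to\infty$ for some $p>1$ with $\frac1{p+1}>\frac12-\frac1{N-k}$; $(f_3)$ $0<\theta F(s)\le f(s)s$ for $s>0$, for some $2<\theta\le p+1$, $F(s)=\int_0^sf$; $(f_4)$ $s\mapsto f(s)/s$ nondecreasing. One of the following holds at infinity: $(\mathcal G_\infty^1)$ $\limsup_{|x|\to\infty}K(x)/|x|^\sigma<\infty$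 for some $\sigma<(N-2)q-N$; $(\mathcal G_\infty^2)$ $\liminf_{|x|\to\infty}V(x)|x|^2>0$ and $\limsup_{|x|\to\infty}K(x)/|x|^\sigma<\infty$ for some $\sigma\in\mathbb R$; $(\mathcal G_\infty^3)$ $\liminf_{|x|\to\infty}V(x)|x|^\alpha>0$ and $\limsup_{|x|\to\infty}K(x)/\exp(\sigma|x|^{\frac{2-\alpha}2})<\infty$ for some $\alpha<2$, $\sigma\in\mathbb R$. One of the following holds at the origin: $(\mathcal G_0^1)$ $\limsup_{|x|\to0}K(x)/|x|^\tau<\infty$ for some $\tau>-2$; $(\mathcal G_0^2)$ $\liminf_{|x|\to0}V(x)|x|^2>0$ and $\limsup_{|x|\to0}K(x)/|x|^\tau<\infty$ for some $\tau\in\mathbb R$; $(\mathcal G_0^3)$ $\liminf_{|x|\to0}V(x)|x|^\gamma>0$ and $\limsup_{|x|\to0}K(x)/\exp(\tau|x|^{-\frac{\gamma-2}2})<\infty$ for some $\gamma>2$, $\tau\in\mathbb R$. For $a,b>0$, $\mathcal I_{a,b}(u)=\frac12\int_{\mathbb R^{N-k}}(|\nabla u|^2+au^2)-b\int_{\mathbb R^{N-k}}F(u)$ on $H^1(\mathbb R^{N-k})$ ($F=0$ on negatives), $\mathcal N_{a,b}=\{u\not\equiv0:\langle\mathcal I'_{a,b}(u),u\rangle=0\}$, $\mathcal E(a,b)=\inf_{\mathcal N_{a,b}}\mathcal I_{a,b}$; $\mathcal M(x)=|x''|^k\mathcal E(V(x),K(x))$ if $K(x)>0$, $\mathcal M(x)=+\infty$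 if $K(x)=0$. $\Lambda\subset\mathbb R^N$ is a smooth bounded open set with $\overline\Lambda\cap\mathcal H=\emptyset$, $\Lambda\cap\mathcal H^\perp\neq\emptyset$, $R(\Lambda)=\Lambda$ for all $R\in\mathbf O(N)$ with $R(\mathcal H)=\mathcal H$, $0<\inf_{\Lambda\cap\mathcal H^\perp}\mathcal M<\inf_{\partial\Lambda\cap\mathcal H^\perp}\mathcal M$, and, if $k=N-2$, $\inf_{\Lambda\cap\mathcal H^\perp}\mathcal M<2\inf_\Lambda\mathcal M$; moreover $V>0$ and $\mathcal M$ is continuous on $\overline\Lambda$. Penalized problem. Fix $\mu\in(0,1)$, $\beta>0$. For $N\ge3$: $H(x)=\kappa|x|^{-2}\big((\log|x|)^2+1\big)^{-\frac{1+\beta}2}$ with $0<\kappa<(\frac{N-2}2)^2$. For $N=2$: $H(x)=\kappa|x|^{-2}\big(1+(\log|x|)^2\big)^{-\frac{2+\beta}2}$ with $0<\kappa<\kappa_0$, where $\kappa_0>0$ is such that $\varepsilon^2\kappa_0\int_{\mathbb R^2}\frac{u^2}{|x|^2(1+(\log|x|)^2)}\le\int_{\mathbb R^2}\varepsilon^2|\nabla u|^2+Vu^2$ for all $u\in C_c^\infty(\mathbb R^2)$ and all small $\varepsilon>0$. For $s\ge0$, $$g_\varepsilon(x,s)=\chi_\Lambda(x)K(x)f(s)+(1-\chi_\Lambda(x))\min\{(\varepsilon^2H(x)+\mu V(x))s,\ K(x)f(s)\},$$ $g_\varepsilon(x,s)=0$ for $s<0$, $G_\varepsilon(x,s)=\int_0^sg_\varepsilon(x,\sigma)d\sigma$.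 $H^1_V(\mathbb R^N)=\{u\in\mathcal D^{1,2}(\mathbb R^N):\int Vu^2<\infty\}$ if $N\ge3$, and is the closure of $C_c^\infty(\mathbb R^2)$ for the norm $\|u\|_\varepsilon=(\int\varepsilon^2|\nabla u|^2+Vu^2)^{1/2}$ if $N=2$; $H^1_{V,\mathcal H}(\mathbb R^N)$ is the subspace of $u$ with $u\circ R=u$ for all $R\in\mathbf O(N)$ with $R(\mathcal H)=\mathcal H$. $J_\varepsilon(u)=\frac12\|u\|_\varepsilon^2-\int G_\varepsilon(x,u(x))dx$ on $H^1_{V,\mathcal H}(\mathbb R^N)$. A least-energy solution is a critical point $u_\varepsilon\in H^1_{V,\mathcal H}(\mathbb R^N)$ of $J_\varepsilon$ with $J_\varepsilon(u_\varepsilon)=c_\varepsilon:=\inf_{u\ne0}\sup_{t>0}J_\varepsilon(tu)$. *)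

(* Defs.v *)
From HB Require Import structures.
From mathcomp Require Import all_boot all_order all_algebra.
From mathcomp Require Import all_classical all_reals all_analysis.

Set Implicit Arguments.
Unset Strict Implicit.
Unset Printing Implicit Defensive.

Import Order.TTheory GRing.Theory Num.Theory.
Import numFieldNormedType.Exports.

Local Open Scope classical_set_scope.
Local Open Scope ring_scope.

(* The Borel sigma-algebra of ['M[R]_(m, n)], generated by the coordinates. *)
Definition rV_cylinders (R : realType) m n : set (set 'M[R]_(m, n)) :=
  [set A | exists i j (B : set R),
     measurable B /\ A = (fun v : 'M[R]_(m, n) => v i j) @^-1` B].

Definition rV_sigma (R : realType) m n : set (set 'M[R]_(m, n)) :=
  <<s @rV_cylinders R m n >>.

Section rV_measurable.
Context (R : realType) (m n : nat).

Let sigma0 : @rV_sigma R m n set0.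
Proof. exact: sigma_algebra0. Qed.

Let sigmaC A : @rV_sigma R m n A -> @rV_sigma R m n (~` A).
Proof. exact: sigma_algebraC. Qed.

Let sigma_bigcup (F : _^nat) : (forall i, @rV_sigma R m n (F i)) ->
  @rV_sigma R m n (\bigcup_i F i).
Proof. exact: sigma_algebra_bigcup. Qed.

HB.instance Definition _ := @isMeasurable.Build default_measure_display
  'M[R]_(m, n) (@rV_sigma R m n) sigma0 sigmaC sigma_bigcup.

Lemma measurable_coord i j :
  measurable_fun setT (fun v : 'M[R]_(m, n) => v i j).
Proof.
by move=> _ B mB; rewrite setTI; apply: sub_sigma_algebra; exists i, j, B.
Qed.

Lemma measurable_fun_coordP d (T : measurableType d) (f : T -> 'M[R]_(m, n)) :
  (forall i j, measurable_fun setT (fun x => f x i j)) -> measurable_fun setT f.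
Proof.
move=> mf; apply: (@measurability _ _ _ _ setT f (@rV_cylinders R m n)) => //.
move=> _ [_ [i [j [B [mB ->]]]] <-].
exact: (mf i j measurableT B mB).
Qed.

End rV_measurable.

Section rV_cons.
Context (R : realType) (n : nat).

Definition rV_cons (p : R * 'rV[R]_n) : 'rV[R]_n.+1 :=
  row_mx (const_mx p.1 : 'rV_1) p.2.

Definition rV_uncons (v : 'rV[R]_n.+1) : R * 'rV[R]_n :=
  (v ord0 ord0, rsubmx (v : 'rV_(1 + n))).

Lemma rV_consK : cancel rV_cons rV_uncons.
Proof.
move=> [x v]; rewrite /rV_uncons /rV_cons row_mxKr; congr pair.
by rewrite mxE; case: splitP => [j _|j /= /eqP//]; rewrite mxE.
Qed.

Lemma rV_unconsK : cancel rV_uncons rV_cons.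
Proof.
move=> v; apply/rowP => i; rewrite /rV_cons mxE.
case: splitP => j /= ij; rewrite !mxE; congr (v _ _); apply: val_inj => //=.
by rewrite ij ord1.
Qed.

Lemma measurable_rV_cons : measurable_fun setT rV_cons.
Proof.
apply: measurable_fun_coordP => i j; rewrite /rV_cons.
under eq_fun do rewrite mxE.
case: splitP => k _.
  by under eq_fun do rewrite mxE; exact: measurable_fst.
apply: (measurableT_comp (@measurable_coord R 1 n i k)).
exact: measurable_snd.
Qed.

Lemma measurable_rV_uncons : measurable_fun setT rV_uncons.
Proof.
apply: measurable_fun_pair; first exact: measurable_coord.
apply: measurable_fun_coordP => i j.
under eq_fun do rewrite mxE.
exact: measurable_coord.
Qed.

Variable mu : {sigma_finite_measure set 'rV[R]_n -> \bar R}.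

Definition rV_cons_measure : set 'rV[R]_n.+1 -> \bar R :=
  pushforward (@lebesgue_measure R \x mu)%E rV_cons.

Let cons_preimage A : measurable A -> measurable (rV_cons @^-1` A).
Proof. by move=> mA; rewrite -[X in measurable X]setTI; exact: measurable_rV_cons. Qed.

Let cons0 : rV_cons_measure set0 = 0%E.
Proof. by rewrite /rV_cons_measure /pushforward preimage_set0 measure0. Qed.

Let cons_ge0 A : (0 <= rV_cons_measure A)%E.
Proof. by rewrite /rV_cons_measure /pushforward measure_ge0. Qed.

Let cons_sigma_additive : semi_sigma_additive rV_cons_measure.
Proof.
move=> F mF tF mUF; rewrite /rV_cons_measure /pushforward preimage_bigcup.
apply: measure_semi_sigma_additive.
- by move=> i; exact: cons_preimage.
- apply/trivIsetP => /= i j _ _ ij; rewrite -preimage_setI.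
  by move/trivIsetP : tF => /(_ _ _ _ _ ij) ->//; rewrite preimage_set0.
- by rewrite -preimage_bigcup; exact: cons_preimage.
Qed.

HB.instance Definition _ := isMeasure.Build _ _ _
  rV_cons_measure cons0 cons_ge0 cons_sigma_additive.

Let cons_sigma_finite : sigma_finite setT rV_cons_measure.
Proof.
have /sigma_finiteP[F [TF ndF Foo]] := sigma_finiteT (@lebesgue_measure R).
have /sigma_finiteP[G [TG ndG Goo]] := sigma_finiteT mu.
exists (fun i => rV_uncons @^-1` (F i `*` G i)).
  rewrite -preimage_bigcup -(preimage_setT rV_uncons); congr (_ @^-1` _).
  rewrite -setXTT TF TG; apply/seteqP; split=> -[x v] /=.
    move=> [[i _ Fix] [j _ Gjv]]; exists (maxn i j) => //; split=> /=.
    - by move: x Fix; exact/subsetPset/ndF/leq_maxl.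
    - by move: v Gjv; exact/subsetPset/ndG/leq_maxr.
  by move=> [i _ []/= ? ?]; split; exists i.
move=> i; have [mF Fioo] := Foo i; have [mG Gioo] := Goo i; split.
  rewrite -[X in measurable X]setTI; apply: measurable_rV_uncons => //.
  exact: measurableX.
rewrite /rV_cons_measure /pushforward -comp_preimage.
rewrite (_ : rV_uncons \o rV_cons = id); last first.
  by apply/funext => p /=; rewrite rV_consK.
by rewrite preimage_id product_measure1E// lte_mul_pinfty// ge0_fin_numE.
Qed.

HB.instance Definition _ := Measure_isSigmaFinite.Build _ _ _
  rV_cons_measure cons_sigma_finite.

End rV_cons.

(* Lebesgue measure, as the product measure under R^(n+1) = R x R^n; on boxes
   it is the product of the lengths, see [lebesgue_rV_box]. *)
Fixpoint lebesgue_rV (R : realType) (n : nat) :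
    {sigma_finite_measure set 'rV[R]_n -> \bar R} :=
  match n with
  | 0 => \d_(0 : 'rV[R]_0)
  | n.+1 => rV_cons_measure (lebesgue_rV R n)
  end.

Lemma lebesgue_rV_box (R : realType) n (B : 'I_n -> set R) :
  (forall i, measurable (B i)) ->
  lebesgue_rV R n [set v | forall i, B i (v ord0 i)] =
  (\prod_(i < n) lebesgue_measure (B i))%E.
Proof.
elim: n B => [|n IH] B mB.
  by rewrite big_ord0 /= diracE mem_set// => -[].
have mG : measurable [set v : 'rV[R]_n | forall i, B (lift ord0 i) (v ord0 i)].
  rewrite (_ : mkset _ = \big[setI/setT]_(i < n)
      (fun v : 'rV[R]_n => v ord0 i) @^-1` B (lift ord0 i)).
    apply: bigsetI_measurable => i _.
    by rewrite -[X in measurable X]setTI; exact: measurable_coord.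
  apply/seteqP; split=> [v Bv|v].
    by elim/big_ind: _ => // i _; exact: Bv.
  by move=> + i; rewrite (bigD1 i)//= => -[].
rewrite big_ord_recl -IH//= -product_measure1E//; last exact: mB.
rewrite /rV_cons_measure /pushforward.
congr (_ _); apply/seteqP; split=> -[x v] /=; rewrite /rV_cons /=.
  move=> Bv; split=> [|i].
    by have := Bv ord0; rewrite mxE; case: splitP => // j _; rewrite mxE.
  have := Bv (lift ord0 i); rewrite mxE; case: splitP => [j|j].
    by rewrite ord1.
  by rewrite lift0 => /= -[ij]; congr (B _ (v _ _)); apply: val_inj.
move=> [Bx Bv] i; rewrite mxE; case: splitP => j ij.
  by rewrite mxE (_ : i = ord0)//; apply: val_inj; rewrite /= ij ord1.
by rewrite (_ : i = lift ord0 j)//; apply: val_inj.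
Qed.

Section euclidean.
Context (R : realType) (n : nat).
Implicit Types (x : 'rV[R]_n) (H : 'M[R]_n).

(* The library norm on ['rV[R]_n] is the sup norm. *)
Definition enorm x : R := Num.sqrt (\sum_(i < n) x ord0 i ^+ 2).

(* The filter |x| -> oo. *)
Definition rV_infty : set_system 'rV[R]_n :=
  [set A | exists r : R, forall x, r < enorm x -> A x].

(* A linear subspace is the row space of a matrix [H]; an element of O(n) is a
   matrix acting by right multiplication. *)
Definition subspace H : set 'rV[R]_n := [set x | (x <= H)%MS].

Definition orthogonal_subspace H : set 'rV[R]_n := [set x | x *m H^T = 0].

(* The component x'' of x in the decomposition x = x' + x''. *)
Definition orthogonal_part H x : 'rV[R]_n := x *m proj_mx (kermx H^T) H.

Definition isometry_preserving H : set 'M[R]_n :=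
  [set Q | Q *m Q^T = 1%:M /\ (H *m Q :=: H)%MS].

End euclidean.

Section sobolev.
Context (R : realType) (n : nat).
Implicit Types (u v g phi : 'rV[R]_n -> R) (s : seq 'I_n).

Local Notation leb := (lebesgue_rV R n).

Fixpoint partial s phi : 'rV[R]_n -> R :=
  if s is i :: s' then fun x => 'D_(delta_mx ord0 i) (partial s' phi) x else phi.

Definition smooth phi : Prop := forall s,
  continuous (partial s phi) /\
  forall i x, derivable (partial s phi) x (delta_mx ord0 i).

Definition test_function phi : Prop :=
  smooth phi /\ exists r : R, forall x, r < enorm x -> phi x = 0.

Definition locally_L1 u : Prop :=
  forall r : R, leb.-integrable [set x | enorm x <= r] (EFin \o u).

Definition weak_partial u i g : Prop :=
  locally_L1 g /\ forall phi, test_function phi ->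
    \int[leb]_x (u x * partial [:: i] phi x) = - \int[leb]_x (g x * phi x).

Definition weakly_differentiable u : Prop :=
  locally_L1 u /\ forall i, exists g, weak_partial u i g.

(* Some representative of the weak derivative, unique up to null sets; the zero
   function if there is none. *)
Definition weak_grad u (i : 'I_n) : 'rV[R]_n -> R :=
  xget (cst 0) [set g | weak_partial u i g].

Definition weak_grad_sq u (x : 'rV[R]_n) : R :=
  \sum_(i < n) weak_grad u i x ^+ 2.

Definition ae_zero u : Prop := {ae leb, forall x, u x = 0}.

Definition sobolev_H1 : set ('rV[R]_n -> R) :=
  [set u | [/\ weakly_differentiable u, u \in Lfun leb 2%:E &
    forall i, weak_grad u i \in Lfun leb 2%:E]].

(* D^{1,2}(R^n) for n >= 3, as a space of functions: u in L^{2n/(n-2)} with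
   square integrable weak gradient. *)
Definition sobolev_D12 : set ('rV[R]_n -> R) :=
  [set u | [/\ weakly_differentiable u,
    u \in Lfun leb ((2 * n%:R) / (n%:R - 2))%:E &
    forall i, weak_grad u i \in Lfun leb 2%:E]].

(* <J'(u), v> = l, for a functional [J] that is differentiable on the space at hand. *)
Definition directional_derivative (J : ('rV[R]_n -> R) -> R) u v (l : R) : Prop :=
  is_derive (0 : R) (1 : R) (fun t : R => J (fun x => u x + t * v x)) l.

End sobolev.

(* For s < 0 the interval is empty, so this primitive is 0 there, whatever the
   values of [f] on negative numbers. *)
Definition primitive (R : realType) (f : R -> R) (s : R) : R :=
  \int[@lebesgue_measure R]_(t in `[0, s]) f t.

Record nonlinearity (R : realType) (m : nat) (p q theta : R) (f : R -> R) : Prop := {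
  nonlinearity_continuous : {within `[0, +oo[, continuous f};
  nonlinearity_ge0 : forall s, 0 <= s -> 0 <= f s;
  nonlinearity_q : 1 < q;
  nonlinearity_at0 : exists C : R, \forall s \near 0^'+, f s <= C * s `^ q;
  nonlinearity_p : 1 < p;
  nonlinearity_subcritical : 2^-1 - m%:R^-1 < (p + 1)^-1;
  nonlinearity_at_infty : exists C : R, \forall s \near +oo, f s <= C * s `^ p;
  nonlinearity_theta : 2 < theta <= p + 1;
  nonlinearity_AR : forall s, 0 < s ->
    0 < theta * primitive f s /\ theta * primitive f s <= f s * s;
  nonlinearity_monotone : forall s t, 0 < s -> s <= t -> f s / s <= f t / t
}.

Section limit_problem.
Context (R : realType) (n : nat).
Implicit Types (f : R -> R) (a b : R).

Definition limit_functional f a b (u : 'rV[R]_n -> R) : R :=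
  2^-1 * (\int[lebesgue_rV R n]_x (weak_grad_sq u x + a * u x ^+ 2))
  - b * \int[lebesgue_rV R n]_x primitive f (u x).

Definition nehari f a b : set ('rV[R]_n -> R) :=
  [set u | [/\ sobolev_H1 u, ~ ae_zero u &
    directional_derivative (limit_functional f a b) u u 0]].

Definition ground_energy f a b : \bar R :=
  ereal_inf [set (limit_functional f a b u)%:E | u in nehari f a b].

End limit_problem.

Definition concentration (R : realType) (N k : nat) (H : 'M[R]_N)
    (V K : 'rV[R]_N -> R) (f : R -> R) (x : 'rV[R]_N) : \bar R :=
  if 0 < K x then
    ((enorm (orthogonal_part H x) ^+ k)%:E *
      @ground_energy R (N - k) f (V x) (K x))%E
  else +oo%E.

Section assumptions.
Context (R : realType) (N : nat).
Implicit Types (V K : 'rV[R]_N -> R) (H : 'M[R]_N) (Lam : set 'rV[R]_N).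

Record potentials H V K : Prop := {
  potentials_continuousV : {within [set~ 0], continuous V};
  potentials_continuousK : {within [set~ 0], continuous K};
  potentials_ge0V : forall x, x != 0 -> 0 <= V x;
  potentials_ge0K : forall x, x != 0 -> 0 <= K x;
  potentials_neq0K : exists2 x, x != 0 & K x != 0;
  potentials_symmetryV : forall Q x,
    isometry_preserving H Q -> V (x *m Q) = V x;
  potentials_symmetryK : forall Q x,
    isometry_preserving H Q -> K (x *m Q) = K x
}.

Definition growth_infty V K (q : R) : Prop :=
  [\/ exists2 sigma : R, sigma < (N%:R - 2) * q - N%:R &
        (limf_esup (fun x => (K x / enorm x `^ sigma)%:E) (@rV_infty R N)
          < +oo)%E,
      (0 < limf_einf (fun x => (V x * enorm x ^+ 2)%:E) (@rV_infty R N))%E /\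
        exists sigma : R,
        (limf_esup (fun x => (K x / enorm x `^ sigma)%:E) (@rV_infty R N)
          < +oo)%E
    | exists alpha sigma : R, [/\ alpha < 2,
        (0 < limf_einf (fun x => (V x * enorm x `^ alpha)%:E)
               (@rV_infty R N))%E &
        (limf_esup (fun x =>
             (K x / expR (sigma * enorm x `^ ((2 - alpha) / 2)))%:E)
           (@rV_infty R N) < +oo)%E]].

Definition growth_origin V K : Prop :=
  [\/ exists2 tau : R, - 2 < tau &
        (limf_esup (fun x => (K x / enorm x `^ tau)%:E) (0%R : 'rV[R]_N)^'
          < +oo)%E,
      (0 < limf_einf (fun x => (V x * enorm x ^+ 2)%:E) (0%R : 'rV[R]_N)^')%E /\
        exists tau : R,
        (limf_esup (fun x => (K x / enorm x `^ tau)%:E) (0%R : 'rV[R]_N)^'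
          < +oo)%E
    | exists gamma tau : R, [/\ 2 < gamma,
        (0 < limf_einf (fun x => (V x * enorm x `^ gamma)%:E)
               (0%R : 'rV[R]_N)^')%E &
        (limf_esup (fun x =>
             (K x / expR (tau * enorm x `^ (- ((gamma - 2) / 2))))%:E)
           (0%R : 'rV[R]_N)^' < +oo)%E]].

(* Near each of its boundary points, [Lam] is a strict sublevel set of a smooth
   function with nonvanishing gradient. *)
Definition smooth_domain Lam : Prop :=
  open Lam /\ forall x, (closure Lam `\` Lam) x ->
    exists rho : 'rV[R]_N -> R, [/\ smooth rho,
      exists i, partial [:: i] rho x != 0 &
      \forall y \near x, Lam y <-> rho y < 0].

Record concentration_region (k : nat) H V K (f : R -> R) Lam : Prop := {
  region_smooth : smooth_domain Lam;
  region_bounded : bounded_set Lam;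
  region_away : closure Lam `&` subspace H = set0;
  region_meets : Lam `&` orthogonal_subspace H !=set0;
  region_symmetry : forall Q, isometry_preserving H Q ->
    (fun x => x *m Q) @` Lam = Lam;
  region_inf_gt0 : (0 < ereal_inf
    (concentration k H V K f @` (Lam `&` orthogonal_subspace H)))%E;
  region_inf_boundary :
    (ereal_inf (concentration k H V K f @` (Lam `&` orthogonal_subspace H)) <
     ereal_inf (concentration k H V K f @`
       ((closure Lam `\` Lam) `&` orthogonal_subspace H)))%E;
  region_inf_double : k = (N - 2)%N ->
    (ereal_inf (concentration k H V K f @` (Lam `&` orthogonal_subspace H)) <
     2%:E * ereal_inf (concentration k H V K f @` Lam))%E;
  region_V_gt0 : forall x, closure Lam x -> 0 < V x;
  region_continuous :
    {within closure Lam, continuous (concentration k H V K f)}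
}.

End assumptions.

Section penalization.
Context (R : realType) (N : nat).
Implicit Types (V K h u : 'rV[R]_N -> R) (H : 'M[R]_N) (Lam : set 'rV[R]_N).
Implicit Types (f : R -> R) (eps mu beta kappa : R).

Local Notation leb := (lebesgue_rV R N).

Definition norm_sq eps V u : \bar R :=
  \int[leb]_x (eps ^+ 2 * weak_grad_sq u x + V x * u x ^+ 2)%:E.

(* Meaningful for N >= 2; the second branch is the case N = 2. *)
Definition penalty_potential kappa beta (x : 'rV[R]_N) : R :=
  if (2 < N)%N then
    kappa * enorm x ^- 2 * (ln (enorm x) ^+ 2 + 1) `^ (- ((1 + beta) / 2))
  else
    kappa * enorm x ^- 2 * (1 + ln (enorm x) ^+ 2) `^ (- ((2 + beta) / 2)).

Definition hardy_constant V (kappa0 : R) : Prop :=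
  \forall eps \near (0 : R)^'+, forall u, test_function u ->
    ((eps ^+ 2 * kappa0)%:E *
       \int[leb]_x (u x ^+ 2 / (enorm x ^+ 2 * (1 + ln (enorm x) ^+ 2)))%:E
     <= norm_sq eps V u)%E.

Definition admissible_kappa V kappa : Prop :=
  if (2 < N)%N then (0 < kappa < ((N%:R - 2) / 2) ^+ 2 : Prop)
  else exists kappa0 : R,
    [/\ 0 < kappa0, hardy_constant V kappa0 & 0 < kappa < kappa0].

Definition penalized_nonlinearity V K f Lam h mu eps (x : 'rV[R]_N) (s : R) : R :=
  if s < 0 then 0 else
    \1_Lam x * (K x * f s)
    + (1 - \1_Lam x)
      * Num.min ((eps ^+ 2 * h x + mu * V x) * s) (K x * f s).

Definition penalized_primitive V K f Lam h mu eps (x : 'rV[R]_N) (s : R) : R :=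
  primitive (penalized_nonlinearity V K f Lam h mu eps x) s.

(* For N = 2, test functions need not have finite norm, since V may be singular
   at the origin: the closure is that of the test functions of finite norm. *)
Definition weighted_H1 eps V : set ('rV[R]_N -> R) :=
  if (2 < N)%N then
    [set u | sobolev_D12 u /\ (\int[leb]_x (V x * u x ^+ 2)%:E < +oo)%E]
  else
    [set u | weakly_differentiable u /\
      exists phi : nat -> 'rV[R]_N -> R,
        (forall j, test_function (phi j) /\ (norm_sq eps V (phi j) < +oo)%E) /\
        norm_sq eps V (fun x => u x - phi j x) @[j --> \oo] --> 0%E].

Definition symmetric_H1 eps V H : set ('rV[R]_N -> R) :=
  [set u | weighted_H1 eps V u /\ forall Q, isometry_preserving H Q ->
    {ae leb, forall x, u (x *m Q) = u x}].

Definition penalized_functional V K f Lam h mu eps u : R :=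
  2^-1 * fine (norm_sq eps V u)
  - \int[leb]_x penalized_primitive V K f Lam h mu eps x (u x).

Definition minimax_level H V K f Lam h mu eps : \bar R :=
  ereal_inf [set ereal_sup
      [set (penalized_functional V K f Lam h mu eps (fun x => t * u x))%:E
        | t in [set t : R | 0 < t]]
    | u in [set u | symmetric_H1 eps V H u /\ ~ ae_zero u]].

Record positive_least_energy_solution H V K f Lam h mu eps u : Prop := {
  least_energy_space : symmetric_H1 eps V H u;
  least_energy_critical : forall v, symmetric_H1 eps V H v ->
    directional_derivative (penalized_functional V K f Lam h mu eps) u v 0;
  least_energy_level : (penalized_functional V K f Lam h mu eps u)%:E =
    minimax_level H V K f Lam h mu eps;
  least_energy_gt0 : {ae leb, forall x, 0 < u x}
}.

End penalization.

(* Main.v *)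
Require Import Defs.
From HB Require Import structures.
From mathcomp Require Import all_boot all_order all_algebra.
From mathcomp Require Import all_classical all_reals all_analysis.
From mathcomp Require Import measurable_realfun ring lra.

Set Implicit Arguments.
Unset Strict Implicit.
Unset Printing Implicit Defensive.

Import Order.TTheory GRing.Theory Num.Theory.
Import numFieldNormedType.Exports.

Local Open Scope classical_set_scope.
Local Open Scope ring_scope.

(** The proof is a weighted energy estimate in the manner of Agmon. Outside of a
    large ball, which contains [Lam], the penalized nonlinearity is
    at most [(eps ^ 2 h + mu V) u], where [h] is the penalty potential. Testing
    the equation with [q ^ 2 u], for a radial cutoff [q] supported there, gives

      int |grad (q u)| ^ 2 + W (q u) ^ 2 <= int u ^ 2 |grad q| ^ 2,
      W = (1 - mu) V / eps ^ 2 - h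

    ([weighted_energy], from [first_variation]). The left-hand side controls
    twice [int (q u) ^ 2 / (1 + |x| ^ 2)]. If [N >= 5] this is Hardy's inequality
    ([hardy_inequality]), whose constant is at least 9/4, because [h] is small
    compared with [|x| ^ -2] at infinity ([penalty_small]). If [V >= c |x| ^ -2]
    at infinity it holds for small [eps], since then [W >= 2 |x| ^ -2].

    Now let [q] behave like [|x|]. Then [|grad q| ^ 2] is close to
    [q ^ 2 / (1 + |x| ^ 2)], with constant 1 < 2, so the right-hand side is
    absorbed up to an integral over a fixed annulus and the error of the outer
    cutoff ([weight_grad_sq]). That error stays bounded because the mass of [u ^ 2]
    in the ball of radius [r] is [O(r ^ 2)], by Young's inequality from the
    critical Sobolev integrability or from the potential term
    ([annulus_mass_sobolev], [annulus_mass_potential]). Since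
    [q ^ 2 / (1 + |x| ^ 2)] is bounded below, [u] is square integrable at
    infinity ([L1_tail]). Inside the ball, [u] differs from a far translate by a
    square integrable function ([L1_inner]), which also covers the dimension 2.

    Three points need care. The test function [q ^ 2 u] must belong to the energy
    space ([weighted_H1_mul]). The functional is a real-valued integral which is 0
    when the nonlinear term diverges, so the first variation is computed from
    one-sided bounds on its increments ([Rintegral_increment_le]). And all
    properties of weak derivatives are derived from the fundamental lemma of the
    calculus of variations and from the bound [difference_quotient_le] on
    difference quotients, which also gives Hardy's inequality. *)

(** * Borel sets and the Euclidean norm *)

Section borel.
Context (R : realType) (n : nat).
Implicit Types (x y : 'rV[R]_n) (A : set 'rV[R]_n).

Lemma rV_ballE x (e : R) : 0 < e ->
  ball x e = [set y | forall i, ball (x ord0 i) e (y ord0 i)].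
Proof.
move=> e0; apply/seteqP; split=> y /=; first by case=> _ + i; exact.
by move=> xy; split=> // i j; rewrite (ord1 i); exact: xy.
Qed.

Lemma measurable_rV_ball x (e : R) : measurable (ball x e).
Proof.
have [e0|e0] := ltP 0 e; last first.
  rewrite (_ : ball _ _ = set0)//; apply/seteqP; split=> // y [].
  by rewrite ltNge e0.
rewrite rV_ballE//.
set B := (X in measurable X).
rewrite (_ : B = \big[setI/setT]_(i < n)
      (fun v : 'rV[R]_n => v ord0 i) @^-1` ball (x ord0 i) e); last first.
  apply/seteqP; split=> [v Bv|v].
    by elim/big_ind: _ => // i _; exact: Bv.
  by move=> + i; rewrite (bigD1 i)//= => -[].
apply: bigsetI_measurable => i _.
by rewrite -[X in measurable X]setTI; apply: measurable_coord => //;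
   exact: measurable_ball.
Qed.

(** An open set is a countable union of balls with rational centers, and a ball
    of the sup norm is a box. *)
Lemma open_measurable_rV A : open A -> measurable A.
Proof.
move=> oA.
pose c (v : 'rV[rat]_n) : 'rV[R]_n := map_mx (ratr : rat -> R) v.
pose F (p : 'rV[rat]_n * nat) := if `[< ball (c p.1) p.2.+1%:R^-1 `<=` A >]
  then ball (c p.1) p.2.+1%:R^-1 else set0.
rewrite (_ : A = \bigcup_p F p).
  apply: countable_bigcupT_measurable => // -[v k]; rewrite /F/=.
  by case: ifPn => // _; exact: measurable_rV_ball.
apply/seteqP; split=> [x Ax|x [[v k] _]]; last first.
  by rewrite /F/=; case: ifPn => // /asboolP; apply.
have /nbhs_ballP[e /= e0 xeA] : nbhs x A by exact: open_nbhs_nbhs.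
have [k ke] : exists k : nat, k.+1%:R^-1 < e / 2.
  have e20 : 0 < e / 2 by rewrite divr_gt0.
  move: (near_infty_natSinv_lt (PosNum e20)) => [k _ /(_ k (leqnn _))] /=.
  by exists k.
have k0 : 0 < k.+1%:R^-1 :> R by rewrite invr_gt0.
have /(_ _)/cid Hq (i : 'I_n) : exists q : rat, ball (x ord0 i) k.+1%:R^-1 (ratr q).
  have ne : ball (x ord0 i) k.+1%:R^-1 !=set0 by exists (x ord0 i); exact: ballxx.
  have [q] := dense_rat ne (ball_open (x ord0 i) (k.+1%:R^-1)).
  by case=> + [r _ rq] => /=; rewrite -rq => ?; exists r.
pose v : 'rV[rat]_n := \row_i (sval (Hq i)).
have xv : ball (c v) k.+1%:R^-1 x.
  rewrite rV_ballE// => i /=; rewrite !mxE; apply: ball_sym.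
  exact: (svalP (Hq i)).
exists (v, k) => //; rewrite /F/= asboolT// => y vy; apply: xeA.
rewrite (splitr e); apply: (@ball_triangle _ _ (c v)).
  by apply/(le_ball (ltW ke))/ball_sym.
by apply/(le_ball (ltW ke)).
Qed.

Lemma closed_measurable_rV A : closed A -> measurable A.
Proof.
by move=> /closed_openC/open_measurable_rV/measurableC; rewrite setCK.
Qed.

Lemma open_continuous_measurable_rV (f : 'rV[R]_n -> R) A :
  open A -> {in A, continuous f} -> measurable_fun A f.
Proof.
move=> oA cf; apply: (measurability _ (RGenOpens.measurableE R)).
move=> _ [_ [a [b ->] <-]].
apply: open_measurable_rV; rewrite openE => x [Ax abx] /=.
apply: filterI; first exact: open_nbhs_nbhs.
apply: (cf x); first by rewrite inE.
by apply: open_nbhs_nbhs; split=> //; exact: interval_open.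
Qed.

Lemma continuous_measurable_rV (f : 'rV[R]_n -> R) :
  continuous f -> measurable_fun setT f.
Proof.
by move=> cf; apply: open_continuous_measurable_rV => [|x _]; [exact: openT|].
Qed.

(** The potentials are continuous only off the origin; one point does not matter
    for measurability. *)
Lemma measurable_fun_punctured (f : 'rV[R]_n -> R) (a : 'rV[R]_n) :
  {within [set~ a], continuous f} -> measurable_fun setT f.
Proof.
have oa : open [set~ a].
  by apply: closed_openC; exact: (accessible_closed_set1 (hausdorff_accessible (@norm_hausdorff _ _))).
move=> cf; rewrite -(setUv [set a]); apply/measurable_funU.
- by apply: closed_measurable_rV; exact: (accessible_closed_set1 (hausdorff_accessible (@norm_hausdorff _ _))).
- by apply: open_measurable_rV.
split; last first.
  apply: open_continuous_measurable_rV => //.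
  by rewrite -continuous_open_subspace.
apply: (eq_measurable_fun (cst (f a))) => //.
by move=> x; rewrite inE => ->.
Qed.

End borel.

Section euclidean_norm.
Context (R : realType) (n : nat).
Implicit Types (x y : 'rV[R]_n).

Definition sqn x : R := \sum_(i < n) x ord0 i ^+ 2.

Lemma sqn_ge0 x : 0 <= sqn x.
Proof. by apply: sumr_ge0 => i _; exact: sqr_ge0. Qed.

Lemma enorm_ge0 x : 0 <= enorm x.
Proof. exact: sqrtr_ge0. Qed.

Lemma enorm_sq x : enorm x ^+ 2 = sqn x.
Proof. by rewrite sqr_sqrtr// sqn_ge0. Qed.

Lemma coord_sq_le x i : x ord0 i ^+ 2 <= sqn x.
Proof.
rewrite /sqn (bigD1 i)//= lerDl; apply: sumr_ge0 => j _; exact: sqr_ge0.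
Qed.

Lemma coord_le_enorm x i : `|x ord0 i| <= enorm x.
Proof. by rewrite -sqrtr_sqr ler_wsqrtr// coord_sq_le. Qed.

Lemma continuous_sqn : continuous sqn.
Proof.
rewrite (_ : sqn = \sum_(i < n) (fun x => x ord0 i ^+ 2)); last first.
  by apply/funext => x; rewrite /sqn fct_sumE.
elim/big_ind: _ => [|f g cf cg|i _] x; first exact: (@cvg_cst _ _ _ (nbhs x)).
- by apply: continuousD; [exact: cf|exact: cg].
- have -> : (fun x : 'rV[R]_n => x ord0 i ^+ 2) =
    (fun x => x ord0 i) \* (fun x => x ord0 i) by apply/funext.
  by apply: continuousM; exact: coord_continuous.
Qed.

Lemma continuous_enorm : continuous (@enorm R n).
Proof.
move=> x; apply: (@continuous_comp _ _ _ sqn (@Num.sqrt R)).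
  exact: continuous_sqn.
exact: sqrt_continuous.
Qed.

Lemma measurable_sqn : measurable_fun setT sqn.
Proof. exact: continuous_measurable_rV continuous_sqn. Qed.

Lemma measurable_enorm : measurable_fun setT (@enorm R n).
Proof. exact: continuous_measurable_rV continuous_enorm. Qed.

Lemma measurable_enorm_le (r : R) : measurable [set x : 'rV[R]_n | enorm x <= r].
Proof.
rewrite (_ : mkset _ = setT `&` (@enorm R n) @^-1` `]-oo, r]%classic).
  by apply: measurable_enorm.
by rewrite setTI; apply/seteqP; split=> x /=; rewrite in_itv.
Qed.

Lemma le_enorm_sqn x (r : R) : 0 <= r -> (enorm x <= r) = (sqn x <= r ^+ 2).
Proof.
by move=> r0; rewrite -enorm_sq ler_sqr ?nnegrE// enorm_ge0.
Qed.

Lemma enorm_sum_coord x : enorm x <= \sum_(i < n) `|x ord0 i|.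
Proof.
have s0 : 0 <= \sum_(i < n) `|x ord0 i| by apply: sumr_ge0.
rewrite le_enorm_sqn// /sqn.
have: forall i, x ord0 i ^+ 2 <= `|x ord0 i| * \sum_(i < n) `|x ord0 i|.
  move=> i; rewrite -real_normK ?num_real// expr2 ler_wpM2l//.
  by rewrite (bigD1 i)//= lerDl; apply: sumr_ge0.
by move=> h; rewrite [leRHS]expr2 [leRHS]mulr_suml; apply: ler_sum => i _.
Qed.

Lemma bounded_enorm (A : set 'rV[R]_n) : bounded_set A ->
  exists2 r : R, 0 < r & forall x, A x -> enorm x <= r.
Proof.
move=> [M [_ HM]]; pose M1 := `|M| + 1.
have M10 : 0 < M1 by rewrite /M1 ltr_wpDl.
have MM : M < M1 by rewrite /M1 (le_lt_trans (ler_norm _))// ltrDl.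
exists (M1 * n%:R + 1) => [|x Ax].
  by rewrite ltr_wpDl// mulr_ge0// ltW.
rewrite (le_trans (enorm_sum_coord x))//.
rewrite (@le_trans _ _ (\sum_(i < n) M1))//.
  apply: ler_sum => i _; apply: le_trans (HM _ MM _ Ax).
  rewrite [leRHS]/Num.Def.normr /= mx_normrE; apply/bigmax_geP; right => /=.
  by exists (ord0, i).
by rewrite sumr_const card_ord mulr_natr lerDl.
Qed.

Lemma compact_enorm_le (r : R) : compact [set x : 'rV[R]_n | enorm x <= r].
Proof.
apply: bounded_closed_compact.
  exists (`|r| + 1); split; first exact: num_real.
  move=> M rM x /= xr; rewrite [leLHS]/Num.Def.normr /= mx_normrE.
  apply/bigmax_leP; split => [|[i j] _ /=].
    by rewrite ltW// (le_lt_trans _ rM)// addr_ge0.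
  rewrite (ord1 i) (le_trans (coord_le_enorm _ _))// (le_trans xr)//.
  by rewrite ltW// (le_lt_trans _ rM)// (le_trans (ler_norm _))// lerDl.
rewrite (_ : mkset _ = (@enorm R n) @^-1` `]-oo, r]%classic).
  by apply: preimage_closed => [x _|]; [exact: continuous_enorm|exact: interval_closed].
by apply/seteqP; split=> x /=; rewrite in_itv.
Qed.

Lemma continuous_bounded_on (f : 'rV[R]_n -> R) (r : R) : continuous f ->
  exists2 C : R, 0 < C & forall x, enorm x <= r -> `|f x| <= C.
Proof.
move=> cf.
have := continuous_compact (continuous_subspaceT cf) (compact_enorm_le (r := r)).
move=> /compact_bounded[M [_ HM]].
exists (`|M| + 1) => [|x xr]; first by rewrite ltr_wpDl.
apply: HM; last by exists x.
by rewrite (le_lt_trans (ler_norm _))// ltrDl.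
Qed.

End euclidean_norm.

(** * Translation invariance of Lebesgue measure *)

Section boxes.
Context (R : realType) (n : nat).
Implicit Types (a b : 'I_n -> R) (x c : 'rV[R]_n).
Local Notation leb := (lebesgue_rV R n).

Definition open_box a b : set 'rV[R]_n :=
  [set v | forall i, `]a i, b i[%classic (v ord0 i)].

Definition open_boxes : set (set 'rV[R]_n) :=
  [set A | exists a b, A = open_box a b].

Lemma measurable_box (B : 'I_n -> set R) : (forall i, measurable (B i)) ->
  measurable [set v : 'rV[R]_n | forall i, B i (v ord0 i)].
Proof.
move=> mB; set A := (X in measurable X).
rewrite (_ : A = \big[setI/setT]_(i < n)
      (fun v : 'rV[R]_n => v ord0 i) @^-1` B i); last first.
  apply/seteqP; split=> [v Bv|v].
    by elim/big_ind: _ => // i _; exact: Bv.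
  by move=> + i; rewrite (bigD1 i)//= => -[].
apply: bigsetI_measurable => i _.
by rewrite -[X in measurable X]setTI; apply: measurable_coord.
Qed.

Lemma measurable_open_box a b : measurable (open_box a b).
Proof.
by apply: (measurable_box (B := fun i => `]a i, b i[%classic)) => i.
Qed.

Lemma open_boxes_setI : setI_closed open_boxes.
Proof.
move=> _ _ [a [b ->]] [c [d ->]].
exists (fun i => Num.max (a i) (c i)), (fun i => Num.min (b i) (d i)).
apply/seteqP; split=> v /=.
  move=> [h1 h2] i; move: (h1 i) (h2 i); rewrite /= !in_itv/=.
  by rewrite gt_max lt_min => /andP[-> ->] /andP[-> ->].
move=> h; split=> i; move: (h i); rewrite /= !in_itv/= gt_max lt_min.
  by move=> /andP[/andP[-> _] /andP[-> _]].
by move=> /andP[/andP[_ ->] /andP[_ ->]].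
Qed.

Lemma open_box_cover :
  \bigcup_k open_box (fun=> - (k%:R : R)) (fun=> k%:R) = setT.
Proof.
apply/seteqP; split=> // x _.
exists (Num.truncn (enorm x)).+1 => // i /=; rewrite in_itv/= -ltr_norml.
rewrite (le_lt_trans (coord_le_enorm _ _))//.
by rewrite truncnS_gt.
Qed.

(** Generation by boxes, needed for the uniqueness of measures: a strip
    bounded in one coordinate is a countable union of boxes. *)
Lemma measurable_open_boxesE : @measurable _ 'rV[R]_n = <<s open_boxes>>.
Proof.
apply/seteqP; split; last first.
  apply: smallest_sub; first exact: sigma_algebra_measurable.
  by move=> _ [a [b ->]]; exact: measurable_open_box.
apply: smallest_sub; first exact: smallest_sigma_algebra.
move=> _ [i0 [i [B [mB ->]]]]; rewrite (ord1 i0).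
pose P (B : set R) := <<s open_boxes>> ((fun v : 'rV[R]_n => v ord0 i) @^-1` B).
suff: <<s @RGenOpens.G R >> `<=` P.
  have mE : @measurable _ R = <<s @RGenOpens.G R >> := RGenOpens.measurableE R.
  by apply; rewrite -mE.
apply: smallest_sub.
  split.
  - by rewrite /P preimage_set0; exact: sigma_algebra0.
  - by move=> A PA; rewrite /P setTD preimage_setC -setTD; exact: sigma_algebraCD.
  - by move=> F PF; rewrite /P preimage_bigcup; exact: sigma_algebra_bigcup.
move=> _ [u [w ->]]; rewrite /P.
rewrite (_ : _ @^-1` _ = \bigcup_k open_box
    (fun j => if j == i then u else - (k%:R : R))
    (fun j => if j == i then w else k%:R)).
  apply: sigma_algebra_bigcup => k; apply: sub_sigma_algebra.
  by eexists; eexists.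
apply/seteqP; split=> [v /= uvw|v [k _]]; last first.
  by move=> /(_ i); rewrite /= eqxx.
exists (Num.truncn (enorm v)).+1 => // j /=; case: eqVneq => [->//|_].
rewrite in_itv/= -ltr_norml (le_lt_trans (coord_le_enorm _ _))//.
by rewrite truncnS_gt.
Qed.

Lemma lebesgue_rV_open_boxE a b :
  leb (open_box a b) = (\prod_(i < n) lebesgue_measure `]a i, b i[%classic)%E.
Proof.
by apply: (lebesgue_rV_box (B := fun i => `]a i, b i[%classic)) => i.
Qed.

Lemma lebesgue_rV_open_box a b : (forall i, a i <= b i) ->
  leb (open_box a b) = (\prod_(i < n) (b i - a i))%:E.
Proof.
move=> ab; rewrite lebesgue_rV_open_boxE -prodEFin; apply: eq_bigr => i _.
rewrite lebesgue_measure_itv/= lte_fin.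
by case: ltP => // ba; congr (_%:E); apply/esym/eqP; rewrite subr_eq0 eq_le ba ab.
Qed.

Lemma lebesgue_rV_enorm_le (r : R) : 0 <= r ->
  (leb [set x | (enorm x <= r)%R] <= ((2 * r) ^+ n)%:E)%E.
Proof.
move=> r0.
apply: (@le_trans _ _ (leb [set v | forall i, `[- r, r]%classic (v ord0 i)])).
  apply: le_measure; rewrite ?inE.
  - exact: measurable_enorm_le.
  - by apply: (measurable_box (B := fun=> `[- r, r]%classic)) => i.
  - move=> x /= xr i; rewrite in_itv/= -ler_norml.
    by rewrite (le_trans (coord_le_enorm _ _)).
rewrite (lebesgue_rV_box (B := fun i => `[- r, r]%classic)); last first.
  by move=> i; exact: measurable_itv.
rewrite -[in leRHS](card_ord n) -prodr_const -prodEFin.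
rewrite le_eqVlt; apply/orP; left; apply/eqP; apply: eq_bigr => i _.
rewrite lebesgue_measure_itv/= lte_fin; case: ltP => [_|rr].
  by rewrite -EFinD opprK mulr_natl mulr2n.
by congr EFin; lra.
Qed.

Lemma lebesgue_rV_enorm_lty (r : R) : (leb [set x | (enorm x <= r)%R] < +oo)%E.
Proof.
apply: (@le_lt_trans _ _ (leb [set x | (enorm x <= `|r|)%R])).
  apply: le_measure; rewrite ?inE; try exact: measurable_enorm_le.
  by move=> x /= xr; rewrite (le_trans xr)// ler_norm.
by rewrite (le_lt_trans (lebesgue_rV_enorm_le (normr_ge0 r)))// ltry.
Qed.

Lemma lebesgue_rV_set1 x : (0 < n)%N -> leb [set x] = 0%E.
Proof.
case: n x => // m x _.
have -> : [set x] = [set v : 'rV[R]_m.+1 | forall i, [set x ord0 i] (v ord0 i)].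
  apply/seteqP; split=> [v -> //|v /= vx]; apply/rowP => i; exact: vx.
rewrite (lebesgue_rV_box (B := fun i => [set x ord0 i])) => [|i].
  by rewrite big_ord_recl lebesgue_measure_set1 mul0e.
exact: measurable_set1.
Qed.

Lemma measurable_add c : measurable_fun setT (fun x : 'rV[R]_n => x + c).
Proof.
apply: measurable_fun_coordP => i j; under eq_fun do rewrite mxE.
by apply: measurable_funD => //; exact: measurable_coord.
Qed.

(** The pushforward under a translation as a measure, so that the uniqueness
    theorem for measures and the change of variables apply to it. *)
Lemma lebesgue_pushforward_measure c :
  exists m : {measure set 'rV[R]_n -> \bar R},
    (forall A, m A = leb ((fun x => x + c) @^-1` A)) /\
    forall f : 'rV[R]_n -> \bar R, measurable_fun setT f ->
      (forall x, 0 <= f x)%E -> (\int[m]_x f x = \int[leb]_x f (x + c)%R)%E.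
Proof.
unshelve (eexists (pushforward leb (fun x : 'rV[R]_n => x + c) :
  {measure set 'rV[R]_n -> \bar R})); first exact: measurable_add.
split=> // f mf f0.
have := ge0_integral_pushforward (measurable_add c) leb measurableT mf
  (in1W f0).
by rewrite preimage_setT.
Qed.

(** Both sides are measures that give an open box the product of its side
    lengths, and open boxes determine a Borel measure. *)
Lemma lebesgue_rV_add c (A : set 'rV[R]_n) : measurable A ->
  leb ((fun x => x + c) @^-1` A) = leb A.
Proof.
have [m [mE _]] := lebesgue_pushforward_measure c.
have cE a b : (fun x : 'rV[R]_n => x + c) @^-1` open_box a b =
    open_box (fun i => a i - c ord0 i) (fun i => b i - c ord0 i).
  by apply/seteqP; split=> x /= h i; have := h i;
    rewrite /= !mxE !in_itv/= ltrBlDr ltrBrDr.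
move=> mA; rewrite -mE.
apply: (measure_unique open_boxes
  (fun k : nat => open_box (fun=> - (k%:R : R)) (fun=> k%:R))
  measurable_open_boxesE open_boxes_setI _ open_box_cover m leb) => //.
- by move=> k; eexists; eexists.
- move=> _ [a [b ->]]; rewrite mE cE.
  rewrite lebesgue_rV_open_boxE.
  apply: etrans (esym (lebesgue_rV_open_boxE a b)).
  apply: eq_bigr => i _; rewrite !lebesgue_measure_itv/= !lte_fin ltrD2r.
  by case: ifP => // _; rewrite -!EFinD; congr EFin; ring.
- move=> k; rewrite mE cE lebesgue_rV_open_box ?ltry// => i.
  by rewrite lerD2r// (@le_trans _ _ 0)// oppr_le0.
Qed.

End boxes.

Section shift_integrals.
Context (R : realType) (n : nat).
Local Notation leb := (lebesgue_rV R n).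
Local Open Scope ereal_scope.

Lemma ge0_integral_rV_add (c : 'rV[R]_n) (f : 'rV[R]_n -> \bar R) :
  measurable_fun setT f -> (forall x, 0 <= f x) ->
  \int[leb]_x f (x + c)%R = \int[leb]_x f x.
Proof.
move=> mf f0.
have [m [mE mI]] := lebesgue_pushforward_measure c.
rewrite -mI//; apply: eq_measure_integral => A mA _.
by rewrite mE; exact: lebesgue_rV_add.
Qed.

Lemma integral_rV_add (c : 'rV[R]_n) (f : 'rV[R]_n -> \bar R) :
  measurable_fun setT f ->
  \int[leb]_x f (x + c)%R = \int[leb]_x f x.
Proof.
move=> mf; rewrite integralE [RHS]integralE; congr (_ - _).
- rewrite -(@ge0_integral_rV_add c f^\+)//; last exact: measurable_funepos.
  by apply: eq_integral => x _; rewrite !unlock.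
- rewrite -(@ge0_integral_rV_add c f^\-)//; last exact: measurable_funeneg.
  by apply: eq_integral => x _; rewrite !unlock.
Qed.

Lemma integrable_rV_add (c : 'rV[R]_n) (f : 'rV[R]_n -> \bar R) :
  leb.-integrable setT f -> leb.-integrable setT (fun x => f (x + c)%R).
Proof.
move=> /integrableP[mf fi]; apply/integrableP; split.
  by apply: (measurableT_comp mf); exact: measurable_add.
rewrite (@ge0_integral_rV_add c (abse \o f))// => [|x].
  exact: measurableT_comp.
exact: abse_ge0.
Qed.

End shift_integrals.

(** * Explicit smooth functions *)

(** [is_deriveM] with its conclusion in terms of ring products. *)
Lemma is_derive_mulr (R : realType) (V : normedModType R) (f g : V -> R)
    (x v : V) (a b : R) : is_derive x v f a -> is_derive x v g b ->
  is_derive x v (fun y => f y * g y) (f x * b + g x * a).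
Proof. by move=> df dg; exact: is_deriveM. Qed.

Section one_variable.
Context (R : realType).
Implicit Types (I : set R) (Theta : R -> R).

(** An infinite chain of derivatives. It avoids iterated derivative operators,
    whose values outside of [I] would be meaningless. *)
Definition smooth_on I Theta : Prop := exists D : nat -> R -> R,
  D 0%N = Theta /\ forall k x, I x -> is_derive x 1 (D k) (D k.+1 x).

Lemma smooth_on_continuous I Theta x : smooth_on I Theta -> I x ->
  {for x, continuous Theta}.
Proof.
move=> [D [<- dD]] Ix; apply/differentiable_continuous/derivable1_diffP.
by case: (dD 0%N x Ix).
Qed.

Lemma smooth_on_derive I Theta : smooth_on I Theta -> exists Theta',
  smooth_on I Theta' /\ forall x, I x -> is_derive x 1 Theta (Theta' x).
Proof.
move=> [D [<- dD]]; exists (D 1%N); split; last exact: dD.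
by exists (fun k => D k.+1); split => // k x; exact: dD.
Qed.

Lemma smooth_on_expR : smooth_on setT (@expR R).
Proof. by exists (fun=> expR); split => // k x _; exact: is_derive_expR. Qed.

Lemma smooth_on_powR (a : R) : smooth_on [set x | 0 < x] (fun x => x `^ a).
Proof.
exists (fun k x => (\prod_(j < k) (a - j%:R)) * x `^ (a - k%:R)); split.
  by apply/funext => x; rewrite big_ord0 mul1r subr0.
move=> k x /= x0; rewrite big_ord_recr/=.
have h := is_derive1_powR (a - k%:R) x0.
have := @is_deriveZ _ _ _ _ (\prod_(j < k) (a - j%:R)) _ _ _ h.
move=> d; apply: is_derive_eq d _; rewrite [LHS]mulrA; congr (_ * _).
by congr (_ `^ _); rewrite -natr1; ring.
Qed.

(** Smooth, vanishing with all its derivatives at 0; every cutoff below is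
    built from it. *)
Definition flat (t : R) : R := if 0 < t then expR (- t^-1) else 0.

Lemma flat_ge0 t : 0 <= flat t.
Proof. by rewrite /flat; case: ifP => // _; exact: expR_ge0. Qed.

Lemma flat_le1 t : flat t <= 1.
Proof.
rewrite /flat; case: ifP => // t0; rewrite -expR0 ler_expR oppr_le0.
by rewrite invr_ge0 ltW.
Qed.

Lemma flat_gt0 t : (0 < flat t) = (0 < t).
Proof. by rewrite /flat; case: ifP => // t0; rewrite ?expR_gt0 ?ltxx. Qed.

Lemma flat_eq0 t : t <= 0 -> flat t = 0.
Proof. by rewrite /flat leNgt => /negbTE ->. Qed.

(** Each derivative of [flat] is a polynomial in [1 / t] times [exp (- 1 / t)];
    the family [flat_derivative] below is closed under differentiation, and this
    bound gives its decay at 0. *)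
Lemma poly_expRN_bounded (p : {poly R}) :
  exists2 C : R, 0 <= C & forall x, 0 <= x -> `|p.[x]| * expR (- x) <= C.
Proof.
exists (\sum_(i < size p) `|p`_i| * (i.+1)`!%:R).
  by apply: sumr_ge0 => i _; rewrite mulr_ge0.
move=> x x0; rewrite horner_coef.
rewrite (le_trans (ler_wpM2r (expR_ge0 _) (ler_norm_sum _ _ _)))//.
rewrite mulr_suml; apply: ler_sum => i _.
rewrite normrM -mulrA ler_wpM2l// normrX ger0_norm//.
rewrite expRN ler_pdivrMr ?expR_gt0//.
case: (nat_of_ord i) => [|m].
  by rewrite expr0 (_ : (1`!)%N = 1%N)// mul1r (le_trans _ (expR_ge1Dx x))// lerDl.
apply: (@le_trans _ _ (m.+1`!%:R * expR x)); last first.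
  by rewrite ler_wpM2r ?expR_ge0// ler_nat factS leq_pmull.
rewrite mulrC -ler_pdivrMr ?ltr0n ?fact_gt0//.
by rewrite (le_trans _ (expR_ge1Dxn m x0))// lerDr.
Qed.

Definition flat_derivative (p : {poly R}) (t : R) : R :=
  if 0 < t then p.[t^-1] * expR (- t^-1) else 0.

(** Decay of order 2 at 0 gives a zero derivative there, where the formula
    changes. *)
Lemma flat_derivative_sq (p : {poly R}) : exists2 C : R, 0 <= C &
  forall t, `|flat_derivative p t| <= C * t ^+ 2.
Proof.
have [C C0 HC] := poly_expRN_bounded (p * 'X^2).
exists C => // t; rewrite /flat_derivative; case: ifPn => t0; last first.
  by rewrite normr0 mulr_ge0// sqr_ge0.
have := HC t^-1; rewrite invr_ge0 (ltW t0) => /(_ isT).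
rewrite hornerM hornerXn normrM normrX (ger0_norm (x := t^-1)) ?invr_ge0 ?(ltW t0)//.
rewrite normrM (ger0_norm (expR_ge0 _)) exprVn mulrAC ler_pdivrMr//.
by rewrite exprn_gt0.
Qed.

Lemma is_derive_squeeze (f : R -> R) (C x : R) : f x = 0 ->
  (forall t, `|f t| <= C * (t - x) ^+ 2) -> is_derive x 1 f 0.
Proof.
move=> fx0 fC.
have h : (fun h : R => h^-1 *: ((f \o shift x) (h *: 1) - f x)) @ 0^' --> (0 : R).
  apply/cvgr0Pnorm_le => e e0.
  have C1 : 0 < `|C| + 1 by rewrite ltr_wpDl.
  near=> h.
  have h0 : h != 0 by near: h; exact: nbhs_dnbhs_neq.
  rewrite /= fx0 subr0 normrZ normfV /shift/= [_ *: _]mulr1.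
  rewrite ler_pdivrMl ?normr_gt0//.
  rewrite (le_trans (fC _))// addrK.
  rewrite -real_normK ?num_real// expr2 mulrA mulrC ler_wpM2l//.
  apply: (@le_trans _ _ ((`|C| + 1) * `|h|)).
    by rewrite ler_wpM2r// (le_trans (ler_norm _))// lerDl.
  rewrite -ler_pdivlMl// mulrC.
  near: h; apply: dnbhs0_le; first exact: divr_gt0.
by split; [apply/cvg_ex; exists 0|apply/cvg_lim].
Unshelve. all: by end_near. Qed.

Lemma is_derive_poly_expRN_inv (p : {poly R}) (t : R) : 0 < t ->
  is_derive t 1 (fun s => p.[s^-1] * expR (- s^-1))
    (((p - p^`()) * 'X^2).[t^-1] * expR (- t^-1)).
Proof.
move=> t0.
have dp (y : R) : is_derive y 1 (horner p) (p^`()).[y].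
  apply: DeriveDef; first exact: derivable_horner.
  by rewrite -derive1E -derivE.
have dq (y : R) : is_derive y 1 (fun y => p.[y] * expR (- y))
    (p^`().[y] * expR (- y) - p.[y] * expR (- y)).
  have dE : is_derive y 1 (fun y => expR (- y)) (- expR (- y)).
    have dN : is_derive y 1 (@GRing.opp R) (- 1).
      by apply: (@is_deriveN _ _ _ id); exact: is_derive_id.
    have := is_derive1_comp (is_derive_expR (- y)) dN.
    by move=> h; apply: is_derive_eq h _; rewrite mulrN1.
  by apply: is_derive_eq (is_derive_mulr (dp y) dE) _; ring.
have dV : is_derive t 1 (fun s : R => s^-1) (- t ^- 2).
  apply: DeriveDef; first exact: (derivableV (f := id)) (lt0r_neq0 t0) _.
  by rewrite (deriveV (f := id)) ?lt0r_neq0// derive_id [_ *: _]mulr1.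
have h := is_derive1_comp (dq t^-1) dV; apply: is_derive_eq h _.
by rewrite hornerM hornerXn hornerD hornerN -exprVn; ring.
Qed.

Lemma is_derive_flat (p : {poly R}) (t : R) :
  is_derive t 1 (flat_derivative p) (flat_derivative ((p - p^`()) * 'X^2) t).
Proof.
have [t0|t0|t0] := ltgtP t 0.
- rewrite {2}/flat_derivative ltNge (ltW t0)/=.
  apply: (near_eq_is_derive (f := cst 0)).
  near=> s; rewrite /flat_derivative ltNge ifF//; apply/negbF.
  by apply/ltW; near: s; exact: lt_nbhsl.
- rewrite {2}/flat_derivative t0.
  pose g (s : R) := p.[s^-1] * expR (- s^-1).
  apply: (near_eq_is_derive (f := g)).
  + near=> s; rewrite /flat_derivative ifT//.
    by near: s; exact: lt_nbhsr.
  + exact: is_derive_poly_expRN_inv.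
- rewrite t0.
  have [C C0 HC] := flat_derivative_sq p.
  have -> : flat_derivative ((p - p^`()) * 'X^2) 0 = 0.
    by rewrite /flat_derivative ltxx.
  apply: (@is_derive_squeeze _ C) => [|s]; first by rewrite /flat_derivative ltxx.
  by rewrite subr0.
Unshelve. all: by end_near. Qed.

Lemma smooth_on_flat : smooth_on setT flat.
Proof.
exists (fun k => flat_derivative (iter k (fun p : {poly R} => (p - p^`()) * 'X^2) 1)).
split=> [|k x _]; last exact: is_derive_flat.
by apply/funext => t; rewrite /flat_derivative /flat /= hornerC mul1r.
Qed.

End one_variable.

Section directional.
Context (R : realType) (n : nat).
Implicit Types (x v : 'rV[R]_n) (f g : 'rV[R]_n -> R).

(** Directional derivatives are derivatives along a line, which gives access to
    the chain rule in one variable. *)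
Lemma is_derive_line f x v (d : R) :
  is_derive x v f d <-> is_derive (0 : R) 1 (fun t : R => f (t *: v + x)) d.
Proof.
have E : (fun h : R => h^-1 *: ((f \o shift x) (h *: v) - f x)) =
   (fun h : R => h^-1 *: (((fun t : R => f (t *: v + x)) \o shift 0) (h *: 1) -
      (fun t : R => f (t *: v + x)) 0)).
  by apply/funext => h /=; rewrite addr0 scale0r add0r [_%:A]mulr1.
by split=> -[h1 h2]; split; [move: h1|move: h2|move: h1|move: h2];
  rewrite /derivable /derive E.
Qed.

Lemma is_derive_rV_comp (Theta : R -> R) g x v (a b : R) :
  is_derive (g x) 1 Theta a -> is_derive x v g b ->
  is_derive x v (fun y => Theta (g y)) (a * b).
Proof.
move=> dT /is_derive_line dg; apply/is_derive_line.
apply: (@is_derive1_comp _ Theta (fun t : R => g (t *: v + x))) dg.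
by rewrite scale0r add0r.
Qed.

Lemma is_derive_coord i j x :
  is_derive x (delta_mx ord0 i) (fun y : 'rV[R]_n => y ord0 j) (i == j)%:R.
Proof.
apply/is_derive_line.
have -> : (fun t : R => (t *: delta_mx ord0 i + x) ord0 j) =
   (fun t : R => (i == j)%:R * t + x ord0 j).
  by apply/funext => t; rewrite !mxE eqxx/= eq_sym mulrC.
apply: is_derive_eq; rewrite addr0 [_ *: _]mulr1//.
Qed.

(** A class of functions with partial derivatives in the same class: smoothness
    of an explicit function, which speaks of all iterated partial derivatives,
    follows from membership alone. *)
Inductive elementary : ('rV[R]_n -> R) -> Prop :=
| elementary_smooth f of smooth f : elementary f
| elementary_cst c : elementary (fun=> c)
| elementary_coord i : elementary (fun x => x ord0 i)
| elementary_add f g of elementary f & elementary g : elementary (fun x => f x + g x)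
| elementary_mul f g of elementary f & elementary g : elementary (fun x => f x * g x)
| elementary_comp I Theta g of smooth_on I Theta & elementary g &
    (forall x, I (g x)) : elementary (fun x => Theta (g x)).

Lemma partial_cat (s t : seq 'I_n) f : partial (s ++ t) f = partial s (partial t f).
Proof. by elim: s => //= i s ->. Qed.

Lemma elementary_continuous f : elementary f -> continuous f.
Proof.
elim=> {f} [f sf|c|i|f g _ cf _ cg|f g _ cf _ cg|I T g sT _ cg Ig].
- by have [] := sf [::].
- by move=> x; exact: cst_continuous.
- by move=> x; exact: coord_continuous.
- by move=> x; apply: (@continuousD _ _ _ f g); [exact: cf|exact: cg].
- by move=> x; apply: (@continuousM _ _ f g); [exact: cf|exact: cg].
- move=> x; apply: (@continuous_comp _ _ _ g T); first exact: cg.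
  exact: smooth_on_continuous (Ig x).
Qed.

Lemma elementary_derive f i : elementary f -> exists g, elementary g /\
  forall x, is_derive x (delta_mx ord0 i) f (g x).
Proof.
elim=> {f}.
- move=> f sf; exists (partial [:: i] f); split.
    apply: elementary_smooth => s.
    by rewrite -partial_cat; exact: sf.
  by move=> x; apply: derivableP; have [_] := sf [::]; exact.
- by move=> c; exists (fun=> 0); split; [exact: elementary_cst|move=> x; exact: is_derive_cst].
- move=> j; exists (fun=> (i == j)%:R); split; first exact: elementary_cst.
  exact: is_derive_coord.
- move=> f g _ [df [ef Hf]] _ [dg [eg Hg]]; exists (fun x => df x + dg x); split.
    exact: elementary_add.
  by move=> x; apply: (@is_deriveD _ _ _ f g).
- move=> f g ef0 [df [ef Hf]] eg0 [dg [eg Hg]].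
  exists (fun x => f x * dg x + g x * df x); split.
    by apply: elementary_add; apply: elementary_mul.
  by move=> x; exact: is_derive_mulr.
- move=> I T g sT eg0 [dg [eg Hg]] Ig.
  have [T' [sT' dT]] := smooth_on_derive sT.
  exists (fun x => T' (g x) * dg x); split.
    by apply: elementary_mul => //; exact: elementary_comp Ig.
  by move=> x; apply: is_derive_rV_comp => //; exact: dT.
Qed.

Lemma elementaryP f : elementary f -> smooth f.
Proof.
move=> ef s.
suff es : elementary (partial s f).
  split; first exact: elementary_continuous.
  by move=> i x; have [g [_ /(_ x)[]]] := elementary_derive i es.
elim: s => //= i s es; have [g [eg dg]] := elementary_derive i es.
rewrite (_ : (fun x => _) = g)//; apply/funext => x.
by have [_ ->] := dg x.
Qed.

Lemma smoothM f g : smooth f -> smooth g -> smooth (fun x => f x * g x).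
Proof.
by move=> sf sg; apply/elementaryP/elementary_mul; exact: elementary_smooth.
Qed.

Lemma smooth_continuous f : smooth f -> continuous f.
Proof. by move=> /(_ [::])[]. Qed.

Lemma smooth_partial i f : smooth f -> smooth (partial [:: i] f).
Proof. by move=> sf s; rewrite -partial_cat; exact: sf. Qed.

Lemma smooth_is_derive i f x : smooth f ->
  is_derive x (delta_mx ord0 i) f (partial [:: i] f x).
Proof. by move=> /(_ [::])[_ df]; exact: derivableP. Qed.

Lemma elementary_sum (I : Type) (r : seq I) (F : I -> 'rV[R]_n -> R) :
  (forall i, elementary (F i)) -> elementary (fun x => \sum_(i <- r) F i x).
Proof.
move=> eF; elim: r => [|i r IH].
  by under eq_fun do rewrite big_nil; exact: elementary_cst.
by under eq_fun do rewrite big_cons; exact: elementary_add.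
Qed.

Lemma elementary_prod (I : Type) (r : seq I) (F : I -> 'rV[R]_n -> R) :
  (forall i, elementary (F i)) -> elementary (fun x => \prod_(i <- r) F i x).
Proof.
move=> eF; elim: r => [|i r IH].
  by under eq_fun do rewrite big_nil; exact: elementary_cst.
by under eq_fun do rewrite big_cons; exact: elementary_mul.
Qed.

Lemma elementary_sqn : elementary (@sqn R n).
Proof.
rewrite (_ : @sqn R n = fun x => \sum_i (x ord0 i * x ord0 i)).
  by apply: elementary_sum => i; apply: elementary_mul; exact: elementary_coord.
by apply/funext => x; apply: eq_bigr => i _; rewrite expr2.
Qed.

Lemma is_derive_sqn i x : is_derive x (delta_mx ord0 i) (@sqn R n) (2 * x ord0 i).
Proof.
apply/is_derive_line.
have -> : (fun t : R => sqn (t *: delta_mx ord0 i + x)) =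
   (fun t : R => t * t + (2 * x ord0 i) * t + sqn x).
  apply/funext => t; rewrite /sqn (bigD1 i)//= [in RHS](bigD1 i)//= !mxE !eqxx/=.
  rewrite (eq_bigr (fun j => x ord0 j ^+ 2)); first by ring.
  by move=> j ji; rewrite !mxE (negbTE ji) andbF mulr0 add0r.
apply: is_derive_eq.
by rewrite !scale0r !add0r addr0 [_ *: _]mulr1.
Qed.

End directional.

(** * Real integrals and the fundamental lemma of the calculus of variations *)

Section real_integrals.
Context d (T : measurableType d) (R : realType).
Variable mu : {measure set T -> \bar R}.
Implicit Types f g : T -> R.

(** Integrability of real functions on the whole space, with real integrals,
    avoids extended-real arithmetic in the estimates. *)
Definition L1 f : Prop := mu.-integrable setT (EFin \o f).

Lemma L1_measurable f : L1 f -> measurable_fun setT f.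
Proof. by case/integrableP => /measurable_EFinP. Qed.

Lemma L1_le f g : measurable_fun setT f -> (forall x, `|f x| <= g x) ->
  L1 g -> L1 f.
Proof.
move=> mf fg; apply: le_integrable => //; first exact/measurable_EFinP.
by move=> x _ /=; rewrite lee_fin (le_trans (fg x))// ler_norm.
Qed.

Lemma L1_norm f : L1 f -> L1 (fun x => `|f x|).
Proof.
move=> Lf; apply: (le_integrable _ _ _ Lf) => //.
  by apply/measurable_EFinP; apply: measurableT_comp => //; exact: L1_measurable.
by move=> x _ /=; rewrite normr_id.
Qed.

Lemma L1D f g : L1 f -> L1 g -> L1 (fun x => f x + g x).
Proof. by move=> Lf Lg; exact: (integrableD _ Lf Lg). Qed.

Lemma L1B f g : L1 f -> L1 g -> L1 (fun x => f x - g x).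
Proof. by move=> Lf Lg; exact: (integrableB _ Lf Lg). Qed.

Lemma L1Z (c : R) f : L1 f -> L1 (fun x => c * f x).
Proof. by move=> Lf; exact: (integrableZl _ c Lf). Qed.

Lemma L1_sum (I : Type) (r : seq I) (F : I -> T -> R) :
  (forall i, L1 (F i)) -> L1 (fun x => \sum_(i <- r) F i x).
Proof.
move=> LF; elim: r => [|i r IH].
  by under eq_fun do rewrite big_nil; exact: integrable0.
by under eq_fun do rewrite big_cons; exact: L1D.
Qed.

Lemma L1_ge0P f : (forall x, 0 <= f x) -> measurable_fun setT f ->
  L1 f <-> (\int[mu]_x (f x)%:E < +oo)%E.
Proof.
move=> f0 mf; split=> [/integrableP[_]|h].
  by under eq_integral do rewrite /= ger0_norm//.
apply/integrableP; split; first exact/measurable_EFinP.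
by under eq_integral do rewrite /= ger0_norm//.
Qed.

Lemma L1_fin_num f : L1 f -> (\int[mu]_x (f x)%:E \is a fin_num)%E.
Proof. exact: integrable_fin_num. Qed.

Lemma RintegralE f : L1 f -> (\int[mu]_x (f x)%:E = (\int[mu]_x f x)%:E)%E.
Proof. by move=> Lf; rewrite fineK// L1_fin_num. Qed.

Lemma Rintegral_sum (I : Type) (r : seq I) (F : I -> T -> R) :
  (forall i, L1 (F i)) ->
  \int[mu]_x (\sum_(i <- r) F i x) = \sum_(i <- r) \int[mu]_x F i x.
Proof.
move=> LF; elim: r => [|i r IH].
  rewrite big_nil; under eq_Rintegral do rewrite big_nil.
  by rewrite /Rintegral integral0.
rewrite big_cons -IH -RintegralD//; [|exact: LF|exact: L1_sum].
by apply: eq_Rintegral => x _; rewrite big_cons.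
Qed.

Lemma ae_eq_Rintegral f g : measurable_fun setT f -> measurable_fun setT g ->
  {ae mu, forall x, f x = g x} -> \int[mu]_x f x = \int[mu]_x g x.
Proof.
move=> mf mg fg; rewrite /Rintegral; congr fine.
apply: ae_eq_integral => //; [exact/measurable_EFinP|exact/measurable_EFinP|].
by apply: filterS fg => x /= -> _.
Qed.

Lemma Rintegral_dominated (F : nat -> T -> R) f g :
  (forall k, measurable_fun setT (F k)) -> measurable_fun setT f ->
  (forall x, F ^~ x @ \oo --> f x) -> L1 g ->
  (forall k x, `|F k x| <= g x) ->
  (fun k => \int[mu]_x F k x) @ \oo --> \int[mu]_x f x.
Proof.
move=> mF mf Ff Lg Fg.
have [] := @dominated_convergence _ _ _ mu setT measurableT
  (fun k => EFin \o F k) (EFin \o f) (EFin \o g).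
- by move=> k; exact/measurable_EFinP.
- exact/measurable_EFinP.
- by apply: aeW => x _; apply: cvg_EFin; [exact: nearW|exact: Ff].
- exact: Lg.
- by apply: aeW => x k _; rewrite lee_fin.
move=> Lf _ h; rewrite /Rintegral.
apply: fine_cvg; rewrite fineK ?integrable_fin_num//; exact: h.
Qed.

End real_integrals.

Section local_integrability.
Context (R : realType) (n : nat).
Implicit Types (u g phi : 'rV[R]_n -> R).
Local Notation leb := (lebesgue_rV R n).
Local Notation L1 := (L1 (lebesgue_rV R n)).

Lemma locally_L1_measurable u : locally_L1 u -> measurable_fun setT u.
Proof.
move=> Lu.
have -> : [set: 'rV[R]_n] = \bigcup_k [set x | enorm x <= k%:R].
  apply/seteqP; split=> // x _; exists (Num.truncn (enorm x)).+1 => //=.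
  by rewrite ltW// truncnS_gt.
apply/measurable_fun_bigcup => [k|k]; first exact: measurable_enorm_le.
by apply/measurable_EFinP; case/integrableP: (Lu k%:R).
Qed.

Lemma L1_locally u : L1 u -> locally_L1 u.
Proof.
move=> Lu r; apply: integrableS Lu => //; exact: measurable_enorm_le.
Qed.

(** Local integrability enters every computation through this lemma: the
    product with a bounded function of bounded support is integrable. *)
Lemma locally_L1_mul u phi (r C : R) : locally_L1 u -> measurable_fun setT phi ->
  (forall x, `|phi x| <= C) -> (forall x, r < enorm x -> phi x = 0) ->
  L1 (fun x => u x * phi x).
Proof.
move=> Lu mphi phiC phi0.
have mD := @measurable_enorm_le R n r.
have LuD := (integrable_mkcond (EFin \o u) mD).1 (Lu r).
apply: (@L1_le _ _ _ _ _ (fun x => `|C * (u \_ [set x | enorm x <= r]) x|)).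
- by apply: measurable_funM => //; exact: locally_L1_measurable.
- move=> x; rewrite !normrM; have [xr|xr] := leP (enorm x) r.
    rewrite patchE mem_set// mulrC ler_wpM2r//.
    by rewrite (le_trans (phiC x))// ler_norm.
  by rewrite phi0// normr0 mulr0 mulr_ge0.
- apply: L1_norm; apply: L1Z; rewrite /L1.
  by rewrite (_ : EFin \o _ = (EFin \o u) \_ [set x | enorm x <= r])// restrict_EFin.
Qed.

Lemma test_bounded phi : test_function phi -> exists r C : R,
  (forall x, `|phi x| <= C) /\ (forall x, r < enorm x -> phi x = 0).
Proof.
move=> [sphi [r phi0]].
have [C C0 HC] := continuous_bounded_on r (smooth_continuous sphi).
exists r, C; split => // x; have [|xr] := leP (enorm x) r; first exact: HC.
by rewrite phi0// normr0 ltW.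
Qed.

Lemma test_measurable phi : test_function phi -> measurable_fun setT phi.
Proof. by move=> [/smooth_continuous/continuous_measurable_rV]. Qed.

Lemma locally_L1_test u phi : locally_L1 u -> test_function phi ->
  L1 (fun x => u x * phi x).
Proof.
move=> Lu tphi; have [r [C [phiC phi0]]] := test_bounded tphi.
by apply: (locally_L1_mul (r := r) (C := C)) => //; exact: test_measurable.
Qed.

Lemma continuous_locally_L1 u : continuous u -> locally_L1 u.
Proof.
move=> cu r; have [C C0 HC] := continuous_bounded_on r cu.
apply: measurable_bounded_integrable.
- exact: measurable_enorm_le.
- exact: lebesgue_rV_enorm_lty.
- by apply: measurable_funTS; exact: continuous_measurable_rV.
- exists C; split; first exact: num_real.
  by move=> y Cy x /= xr; rewrite (le_trans (HC _ xr))// ltW.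
Qed.

Lemma locally_L1_continuousM u phi : locally_L1 u -> continuous phi ->
  locally_L1 (fun x => phi x * u x).
Proof.
move=> Lu cphi r; have [C C0 HC] := continuous_bounded_on r cphi.
have mD := @measurable_enorm_le R n r.
apply: (@le_integrable _ _ _ leb _ mD _ (fun x => C%:E * (u x)%:E)%E).
- apply/measurable_EFinP/measurable_funTS; apply: measurable_funM.
    exact: continuous_measurable_rV.
  exact: locally_L1_measurable.
- move=> x /= xr; rewrite lee_fin !normrM ler_wpM2r// (gtr0_norm C0).
  exact: HC.
- by apply: integrableZl => //; exact: Lu.
Qed.

Lemma locally_L1D u g : locally_L1 u -> locally_L1 g ->
  locally_L1 (fun x => u x + g x).
Proof.
move=> Lu Lg r; apply: (integrableD _ (Lu r) (Lg r)).
exact: measurable_enorm_le.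
Qed.

Lemma locally_L1Z u (c : R) : locally_L1 u -> locally_L1 (fun x => c * u x).
Proof.
by move=> Lu; apply: locally_L1_continuousM => // x; exact: cst_continuous.
Qed.

Lemma test_partial phi i : test_function phi -> test_function (partial [:: i] phi).
Proof.
move=> [sphi [r phi0]]; split; first exact: smooth_partial.
exists r => x xr /=.
rewrite -(@derive_cst R _ _ (0 : R) x (delta_mx ord0 i)).
apply: near_eq_derive.
have : open [set y : 'rV[R]_n | r < enorm y].
  rewrite (_ : mkset _ = @enorm R n @^-1` `]r, +oo[%classic).
    by apply: open_comp => [y _|]; [exact: continuous_enorm|exact: interval_open].
  by apply/seteqP; split=> y /=; rewrite in_itv/= andbT.
by move=> /(_ x xr); apply: filterS => y; exact: phi0.
Qed.

Lemma test_smoothM phi psi : test_function phi -> smooth psi ->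
  test_function (fun x => phi x * psi x).
Proof.
move=> [sphi [r phi0]] spsi; split; first exact: smoothM.
by exists r => x xr; rewrite phi0// mul0r.
Qed.

End local_integrability.

Section fundamental_lemma.
Context (R : realType) (n : nat).
Implicit Types (u g phi : 'rV[R]_n -> R) (a b : 'I_n -> R).
Local Notation leb := (lebesgue_rV R n).
Local Notation L1 := (L1 (lebesgue_rV R n)).

(** Smooth, and positive exactly on the open box. *)
Definition box_bump a b (x : 'rV[R]_n) : R :=
  \prod_(i < n) (flat (x ord0 i - a i) * flat (b i - x ord0 i)).

Lemma box_bump_ge0 a b x : 0 <= box_bump a b x.
Proof. by apply: prodr_ge0 => i _; rewrite mulr_ge0// flat_ge0. Qed.

Lemma box_bump_gt0 a b x : open_box a b x -> 0 < box_bump a b x.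
Proof.
move=> abx; apply: prodr_gt0 => i _; have := abx i; rewrite /= in_itv/=.
by move=> /andP[ax xb]; rewrite mulr_gt0// flat_gt0 subr_gt0.
Qed.

Lemma box_bump_eq0 a b x : ~ open_box a b x -> box_bump a b x = 0.
Proof.
move=> /existsNP[i /negP]; rewrite in_itv/= negb_and -!leNgt => abx.
rewrite /box_bump (bigD1 i)//=; case/orP: abx => abx.
  by rewrite (@flat_eq0 _ (x ord0 i - a i)) ?mul0r// subr_le0.
by rewrite (@flat_eq0 _ (b i - x ord0 i)) ?mulr0 ?mul0r// subr_le0.
Qed.

(** For [k] to infinity these increase to the indicator of the open box. *)
Definition box_cutoff a b (k : nat) (x : 'rV[R]_n) : R :=
  1 - expR (- (k%:R * box_bump a b x)).

Lemma box_cutoff_eq0 a b k x : ~ open_box a b x -> box_cutoff a b k x = 0.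
Proof.
by move=> abx; rewrite /box_cutoff box_bump_eq0// mulr0 oppr0 expR0 subrr.
Qed.

Lemma box_cutoff_norm a b k x : `|box_cutoff a b k x| <= 1.
Proof.
have kb : 0 <= k%:R * box_bump a b x by rewrite mulr_ge0// box_bump_ge0.
have e1 : expR (- (k%:R * box_bump a b x)) <= 1.
  by rewrite -[leRHS]expR0 ler_expR oppr_le0.
rewrite ger0_norm /box_cutoff ?subr_ge0// lerBlDr lerDl expR_ge0//.
Qed.

Lemma open_box_enorm a b x : open_box a b x ->
  enorm x <= \sum_(i < n) (`|a i| + `|b i|).
Proof.
move=> abx; rewrite (le_trans (enorm_sum_coord x))//; apply: ler_sum => i _.
have := abx i; rewrite /= in_itv/= => /andP[ax xb].
rewrite ler_norml; apply/andP; split.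
  rewrite lerNl (le_trans (y := - a i)) ?lerN2 ?(ltW ax)//.
  by rewrite (le_trans (ler_norm _))// normrN lerDl.
by rewrite (le_trans (ltW xb))// (le_trans (ler_norm _))// lerDr.
Qed.

Lemma test_box_cutoff a b k : test_function (box_cutoff a b k).
Proof.
split; last first.
  exists (\sum_(i < n) (`|a i| + `|b i|)) => x xr; apply: box_cutoff_eq0.
  by move=> /open_box_enorm; rewrite leNgt xr.
apply: elementaryP.
have ee : elementary (fun x => expR (- 1 * (k%:R * box_bump a b x))).
  apply: (elementary_comp (I := setT)) => //; first exact: smooth_on_expR.
  apply: elementary_mul; first exact: elementary_cst.
  apply: elementary_mul; first exact: elementary_cst.
  apply: elementary_prod => i; apply: elementary_mul.
    apply: (elementary_comp (I := setT)) => //; first exact: smooth_on_flat.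
    by apply: elementary_add; [exact: elementary_coord|exact: elementary_cst].
  apply: (elementary_comp (I := setT)) => //; first exact: smooth_on_flat.
  rewrite (_ : (fun x => _) = (fun x : 'rV[R]_n => b i + - 1 * x ord0 i)).
    apply: elementary_add; first exact: elementary_cst.
    by apply: elementary_mul; [exact: elementary_cst|exact: elementary_coord].
  by apply/funext => x; rewrite mulN1r.
rewrite (_ : box_cutoff a b k = fun x => 1 + - 1 * expR (- 1 * (k%:R * box_bump a b x))).
  apply: elementary_add; first exact: elementary_cst.
  by apply: elementary_mul => //; exact: elementary_cst.
by apply/funext => x; rewrite !mulN1r.
Qed.

Lemma box_cutoff_cvg a b x :
  box_cutoff a b ^~ x @ \oo --> (\1_(open_box a b) x : R).
Proof.
rewrite indicE; case: (boolP (x \in _)) => [/set_mem abx|/negP abx] /=; last first.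
  rewrite (_ : (fun k => _) = cst 0); first exact: cvg_cst.
  apply/funext => k; rewrite box_cutoff_eq0// => h.
  by apply: abx; rewrite inE.
rewrite -[X in _ --> X]subr0; apply: cvgB; first exact: cvg_cst.
rewrite (_ : (fun k => _) = (fun k => expR (- box_bump a b x) ^+ k)).
  apply: cvg_expr; rewrite ger0_norm ?expR_ge0//.
  by rewrite -expR0 ltr_expR oppr_lt0 box_bump_gt0.
by apply/funext => k; rewrite -expRM_natl mulrN.
Qed.

Lemma integral_open_box_eq0 g a b : locally_L1 g ->
  (forall phi, test_function phi -> \int[leb]_x (g x * phi x) = 0) ->
  \int[leb]_x (g x * \1_(open_box a b) x) = 0.
Proof.
move=> Lg g0; pose r := \sum_(i < n) (`|a i| + `|b i|).
have mg := locally_L1_measurable Lg.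
have mB : measurable (open_box a b) by exact: measurable_open_box.
have h : (fun k => \int[leb]_x (g x * box_cutoff a b k x)) @ \oo -->
    \int[leb]_x (g x * \1_(open_box a b) x).
  apply: (@Rintegral_dominated _ _ _ _ _ _ (fun x => `|g x * \1_(open_box a b) x|)).
  - move=> k; apply: measurable_funM => //.
    by apply: test_measurable; exact: test_box_cutoff.
  - by apply: measurable_funM.
  - by move=> x; apply: cvgM; [exact: cvg_cst|exact: box_cutoff_cvg].
  - apply: L1_norm; apply: (locally_L1_mul (r := r) (C := 1)) => //.
      by move=> x; rewrite indicE ger0_norm// lern1 leq_b1.
    move=> x rx; rewrite indicE memNset//= => /open_box_enorm.
    by rewrite leNgt rx.
  - move=> k x; rewrite !normrM ler_wpM2l// indicE.
    case: (boolP (x \in _)) => [_|/negP abx]; first by rewrite normr1 box_cutoff_norm.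
    by rewrite box_cutoff_eq0 ?normr0// => ?; apply: abx; rewrite inE.
apply: (cvg_unique _ h) => //.
rewrite (_ : (fun k => _) = cst 0); first exact: cvg_cst.
by apply/funext => k; rewrite g0//; exact: test_box_cutoff.
Qed.

(** The sets on which the integral vanishes form a Dynkin class that contains
    the boxes, hence all Borel sets; apply this to [0 <= g] and [g < 0]. *)
Lemma integral_box_ae_zero g (m : nat) : locally_L1 g ->
  (forall a b, \int[leb]_x (g x * \1_(open_box a b) x) = 0) ->
  {ae leb, forall x, open_box (fun=> - (m%:R : R)) (fun=> m%:R) x -> g x = 0}.
Proof.
move=> Lg g0; set B := open_box _ _.
have mg := locally_L1_measurable Lg.
have mB : measurable B by exact: measurable_open_box.
have mgE : measurable_fun setT (EFin \o g) by exact/measurable_EFinP.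
have LgB : leb.-integrable B (EFin \o g).
  apply: (integrableS _ _ _ (Lg (\sum_(i < n) (`|- (m%:R : R)| + `|m%:R|)))) => //.
    exact: measurable_enorm_le.
  by move=> x Bx; apply: (open_box_enorm Bx).
have LgS A : measurable A -> leb.-integrable (A `&` B) (EFin \o g).
  by move=> mA; apply: integrableS LgB => //; exact: measurableI.
have gbox a b : (\int[leb]_(x in open_box a b) (g x)%:E = 0)%E.
  rewrite integral_mkcond.
  have LB : L1 (fun x => g x * \1_(open_box a b) x).
    apply: (locally_L1_mul (r := \sum_(i < n) (`|a i| + `|b i|)) (C := 1)) => //.
    - by apply: measurable_indic; exact: measurable_open_box.
    - by move=> x; rewrite indicE ger0_norm// lern1 leq_b1.
    - move=> x rx; rewrite indicE memNset//= => /open_box_enorm.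
      by rewrite leNgt rx.
  have LB0 := RintegralE LB; rewrite g0 in LB0.
  apply: (etrans _ LB0); apply: eq_integral => x _.
  rewrite patchE indicE; case: ifP => _; first by rewrite mulr1.
  by rewrite mulr0.
have key A : measurable A -> (\int[leb]_(x in A `&` B) (g x)%:E = 0)%E.
  move=> mA.
  have := @dynkin_induction _ 'rV[R]_n (@open_boxes R n)
    (fun A => \int[leb]_(x in A `&` B) (g x)%:E = 0)%E
    (@measurable_open_boxesE R n) (@open_boxes_setI R n).
  apply; last by rewrite -measurable_open_boxesE.
  - by rewrite setTI; exact: gbox.
  - move=> C bC; have [|a [b ->]] := @open_boxes_setI R n C B bC; last exact: gbox.
    by eexists; eexists.
  - move=> S mS S0.
    have : (\int[leb]_(x in B) (g x)%:E = 0)%E by exact: gbox.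
    rewrite -[X in (\int[leb]_(x in X) _)%E](setUIDK B S) setUC.
    rewrite integral_setU//; last 4 first.
      exact: measurableD.
      exact: measurableI.
      exact: measurable_funTS.
      by rewrite disj_set2E setIC setDE; apply/eqP; rewrite setIACA setICr setI0.
    by rewrite setDE [B `&` ~` S]setIC [B `&` S]setIC S0 adde0.
  - move=> F mF tF F0; rewrite setI_bigcupl integral_bigcup.
    + by apply: eseries0 => i _ _; exact: F0.
    + exact: trivIset_setIr.
    + by move=> k; exact: measurableI.
    + rewrite -setI_bigcupl; apply: LgS; exact: bigcupT_measurable.
pose P := [set x | 0 <= g x].
have mP : measurable P.
  rewrite (_ : P = setT `&` g @^-1` `[0, +oo[%classic); first exact: mg.
  by rewrite setTI; apply/seteqP; split=> x /=; rewrite /P/= in_itv/= andbT.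
have h1 : {ae leb, forall x, (P `&` B) x -> g x = 0}.
  have [+ _] := @ae_eq_integral_abs _ _ _ leb (P `&` B) (measurableI _ _ mP mB) (EFin \o g)
    (measurable_funTS mgE).
  rewrite (_ : (\int[leb]_(x in _) _)%E = 0%E).
    by move=> /(_ erefl); apply: filterS => x /= + PBx => /(_ PBx)[].
  rewrite -[RHS](key P mP); apply: eq_integral => x /set_mem[Px _] /=.
  by rewrite ger0_norm.
have h2 : {ae leb, forall x, (~` P `&` B) x -> g x = 0}.
  have mNP := measurableC mP.
  have [+ _] := @ae_eq_integral_abs _ _ _ leb (~` P `&` B) (measurableI _ _ mNP mB)
    (EFin \o g) (measurable_funTS mgE).
  rewrite (_ : (\int[leb]_(x in _) _)%E = 0%E).
    by move=> /(_ erefl); apply: filterS => x /= + PBx => /(_ PBx)[].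
  rewrite -[RHS]oppe0 -(key _ mNP) -integralN; last first.
    by apply: integrable_add_def; [exact: measurableI|exact: LgS].
  apply: eq_integral => x /set_mem[/= /negP Px _] /=.
  by rewrite ler0_norm// ltW// ltNge.
apply: filterS2 h1 h2 => x h1 h2 Bx; have [Px|Px] := pselect (P x).
  exact: h1.
exact: h2.
Qed.

(** Testing with [box_cutoff] and dominated convergence give vanishing integrals
    over boxes. *)
Lemma fundamental_lemma g : locally_L1 g ->
  (forall phi, test_function phi -> \int[leb]_x (g x * phi x) = 0) ->
  ae_zero g.
Proof.
move=> Lg g0.
have h (m : nat) := integral_box_ae_zero m Lg
  (fun a b => integral_open_box_eq0 a b Lg g0).
have := (ae_foralln h); apply: filterS => x hx.
have : setT x by []; rewrite -open_box_cover => -[m _ xm].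
exact: hx xm.
Qed.

End fundamental_lemma.

(** * Integration along coordinate lines *)

Section real_fubini.
Context d1 d2 (T1 : measurableType d1) (T2 : measurableType d2) (R : realType).
Variable m1 : {sigma_finite_measure set T1 -> \bar R}.
Variable m2 : {sigma_finite_measure set T2 -> \bar R}.
Implicit Types f : T1 * T2 -> R.
Local Notation L1p f := ((m1 \x m2)%E.-integrable setT (EFin \o f)).

(** The inner integrals of Fubini's theorem may be infinite on a null set; this
    passes from them to their real parts. *)
Lemma L1_fine d (T : measurableType d) (mu : {measure set T -> \bar R})
    (F : T -> \bar R) : mu.-integrable setT F ->
  L1 mu (fun x => fine (F x)) /\
  (\int[mu]_x (fine (F x))%:E = \int[mu]_x F x)%E.
Proof.
move=> LF; have /integrableP[mF _] := LF.
have mfF : measurable_fun setT (EFin \o (fine \o F)).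
  by apply/measurable_EFinP; apply: measurableT_comp.
have aeF : {ae mu, forall x, EFin (fine (F x)) = F x}.
  by have := integrable_ae measurableT LF; apply: filterS => x /= /(_ I) /fineK.
have E : ae_eq mu setT (EFin \o (fine \o F)) F.
  by apply: filterS aeF => x /= + _.
split; last by apply: ae_eq_integral.
apply/integrableP; split => //; have /integrableP[_] := LF.
apply: le_lt_trans; rewrite le_eqVlt; apply/orP; left; apply/eqP.
apply: ae_eq_integral => //; [exact: measurableT_comp|exact: measurableT_comp|].
by apply: filterS E => x /= h _; rewrite -[in RHS]h.
Qed.

Lemma Rintegral_Fubini1 f : L1p f ->
  L1 m1 (fun x => \int[m2]_y f (x, y)) /\
  (\int[m1]_x \int[m2]_y f (x, y) = fine (\int[m1 \x m2]_z (f z)%:E)%E).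
Proof.
move=> Lf; have := L1_fine (integrable_fubini_F Lf).
move=> [h1 h2]; split; first exact: h1.
by rewrite /Rintegral h2 (integral12_prod_meas1 Lf).
Qed.

Lemma Rintegral_Fubini2 f : L1p f ->
  L1 m2 (fun y => \int[m1]_x f (x, y)) /\
  (\int[m2]_y \int[m1]_x f (x, y) = fine (\int[m1 \x m2]_z (f z)%:E)%E).
Proof.
move=> Lf; have mf := measurable_int _ Lf.
have LG : m2.-integrable setT (fun y => \int[m1]_x (f (x, y))%:E)%E.
  have mG := measurable_fubini_G Lf.
  apply/integrableP; split; first exact: mG.
  apply: (@le_lt_trans _ _ (\int[m2]_y \int[m1]_x `|(f (x, y))%:E|)%E); last first.
    exact: ((integrable21ltyP _ _ mf).1 Lf).
  apply: ge0_le_integral => //.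
  - exact: measurableT_comp.
  - by apply: (measurable_fun_fubini_tonelli_G (abse \o (EFin \o f))) => [|p];
      [exact: measurableT_comp|exact: abse_ge0].
  - move=> y _; apply: le_abse_integral => //.
    exact: (measurableT_comp mf).
have [h1 h2] := L1_fine LG; split; first exact: h1.
by rewrite /Rintegral h2 (integral21_prod_meas1 Lf).
Qed.

End real_fubini.

Section shifts.
Context (R : realType) (n : nat).
Implicit Types (u v g phi : 'rV[R]_n -> R) (i : 'I_n) (h s t : R).
Local Notation leb := (lebesgue_rV R n).
Local Notation leb1 := (@lebesgue_measure R).
Local Notation L1 := (L1 (lebesgue_rV R n)).
Local Notation e i := (delta_mx ord0 i : 'rV[R]_n).

Definition segment h (s : R) : R := \1_(`[0, h]%classic) s.

Lemma measurable_segment h : measurable_fun setT (segment h).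
Proof. exact: measurable_indic. Qed.

Lemma segment_ge0 h s : 0 <= segment h s.
Proof. by rewrite /segment indicE. Qed.

Lemma segment_out h s : ~~ (0 <= s <= h) -> segment h s = 0.
Proof. by move=> sh; rewrite /segment indicE memNset//= in_itv/=; exact/negP. Qed.

Lemma segment_in h s : 0 <= s <= h -> segment h s = 1.
Proof. by move=> sh; rewrite /segment indicE mem_set//= in_itv/=. Qed.

Lemma integral_segment h : 0 <= h -> (\int[leb1]_s (segment h s)%:E = h%:E)%E.
Proof.
move=> h0; rewrite integral_indic// setIT.
transitivity (lebesgue_measure `[0, h]%classic) => //.
rewrite lebesgue_measure_itv/= lte_fin; case: ltP => [_|h0'].
  by rewrite sube0.
by congr EFin; apply/eqP; rewrite eq_le h0 h0'.
Qed.

Lemma measurable_shift2 v i : measurable_fun setT v ->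
  measurable_fun setT (fun p : R * 'rV[R]_n => v (p.2 + p.1 *: e i)).
Proof.
move=> mv; apply: (measurableT_comp mv).
apply: measurable_fun_coordP => a b; under eq_fun do rewrite !mxE.
apply: measurable_funD.
  exact: (measurableT_comp (measurable_coord a b)).
by apply: measurable_funM.
Qed.

Lemma measurable_shift2N v i : measurable_fun setT v ->
  measurable_fun setT (fun p : R * 'rV[R]_n => v (p.2 + (- p.1) *: e i)).
Proof.
move=> mv; apply: (measurableT_comp mv).
apply: measurable_fun_coordP => a b; under eq_fun do rewrite !mxE.
apply: measurable_funD.
  exact: (measurableT_comp (measurable_coord a b)).
by apply: measurable_funM => //; apply: measurableT_comp.
Qed.

(** Tonelli on the slab [0, h] x R^n: the indicator of the segment makes the
    slab a product over the whole space. *)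
Lemma slab_integrable h (f : R * 'rV[R]_n -> R) (M : R) : 0 <= h ->
  measurable_fun setT f ->
  (forall s, 0 <= s <= h -> (\int[leb]_x `|f (s, x)|%:E <= M%:E)%E) ->
  (leb1 \x leb)%E.-integrable setT (EFin \o (fun p => segment h p.1 * f p)).
Proof.
move=> h0 mf fM.
have mF : measurable_fun setT (fun p : R * 'rV[R]_n => segment h p.1 * f p).
  by apply: measurable_funM => //; apply: (measurableT_comp (measurable_segment h)).
apply/integrable12ltyP; first exact/measurable_EFinP.
have M0 : 0 <= M.
  rewrite -lee_fin (le_trans _ (fM 0 _)) ?lexx ?h0//.
  exact: integral_ge0.
apply: (@le_lt_trans _ _ (\int[leb1]_s (M%:E * (segment h s)%:E))%E).
  apply: ge0_le_integral => //.
  - by move=> s _; exact: integral_ge0.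
  - apply: (measurable_fun_fubini_tonelli_F (abse \o (EFin \o _))) => //.
      by apply: measurableT_comp => //; exact/measurable_EFinP.
    by move=> p; exact: abse_ge0.
  - apply: measurable_funeM; apply/measurable_EFinP; exact: measurable_segment.
  - move=> s _; have [sh|sh] := boolP (0 <= s <= h).
      rewrite (segment_in sh) mule1 (le_trans _ (fM s sh))//.
      rewrite le_eqVlt; apply/orP; left; apply/eqP; apply: eq_integral => x _.
      by rewrite /= segment_in// mul1r.
    rewrite (segment_out sh) mule0 (eq_integral (cst 0%E)) ?integral0// => x _.
    by rewrite /= segment_out// mul0r normr0.
rewrite ge0_integralZl//; last 2 first.
- by apply/measurable_EFinP; exact: measurable_segment.
- by move=> s _; rewrite lee_fin segment_ge0.
by rewrite integral_segment// -EFinM ltry.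
Qed.

Lemma Rintegral_shift v i t : measurable_fun setT v ->
  \int[leb]_x v (x + t *: e i) = \int[leb]_x v x.
Proof.
move=> mv; rewrite /Rintegral (@integral_rV_add _ _ (t *: e i) (EFin \o v))//.
exact/measurable_EFinP.
Qed.

Lemma L1_shift v i t : L1 v -> L1 (fun x => v (x + t *: e i)).
Proof. by move=> Lv; exact: (integrable_rV_add (t *: e i) Lv). Qed.

Lemma enorm_delta i t : enorm (t *: e i) = `|t|.
Proof.
rewrite -sqrtr_sqr /enorm (bigD1 i)//= !mxE !eqxx/= mulr1 big1 ?addr0// => j ji.
by rewrite !mxE (negbTE ji) andbF mulr0 expr0n.
Qed.

Lemma enormD_sum (x y : 'rV[R]_n) :
  enorm (x + y) <= \sum_(j < n) (`|x ord0 j| + `|y ord0 j|).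
Proof.
rewrite (le_trans (enorm_sum_coord _))//; apply: ler_sum => j _.
by rewrite mxE ler_normD.
Qed.

(** A crude substitute for the triangle inequality, from the comparison with
    the sum of the coordinates; it suffices to keep supports bounded. *)
Lemma enormD_le (x y : 'rV[R]_n) : enorm (x + y) <= n%:R * (enorm x + enorm y).
Proof.
have <- : \sum_(j < n) (enorm x + enorm y) = n%:R * (enorm x + enorm y).
  by rewrite sumr_const card_ord mulr_natl.
rewrite (le_trans (enormD_sum x y))//; apply: ler_sum => j _.
by rewrite lerD ?coord_le_enorm.
Qed.

Lemma shift_far i x t (r h : R) : n%:R * (r + h) < enorm x -> `|t| <= h ->
  r < enorm (x + t *: e i).
Proof.
move=> rx th; rewrite ltNge; apply/negP => xr.
move: rx; rewrite ltNge => /negP; apply.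
have -> : x = (x + t *: e i) + (- t) *: e i by rewrite scaleNr addrK.
rewrite (le_trans (enormD_le _ _))// ler_wpM2l// lerD//.
by rewrite enorm_delta normrN.
Qed.

Lemma locally_L1_shift v i t : locally_L1 v -> locally_L1 (fun x => v (x + t *: e i)).
Proof.
move=> Lv r.
have mD := @measurable_enorm_le R n r.
have mv := locally_L1_measurable Lv.
pose D := [set x : 'rV[R]_n | enorm x <= n%:R * (r + `|t|)].
have mD' : measurable D by exact: measurable_enorm_le.
have := (integrable_mkcond (EFin \o v) mD').1 (Lv _).
move=> /(integrable_rV_add (t *: e i)) L.
apply: (@le_integrable _ _ _ leb _ mD _
   (fun x => ((EFin \o v) \_ D) (x + t *: e i)%R)).
- apply/measurable_EFinP/measurable_funTS; apply: (measurableT_comp mv).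
  exact: measurable_add.
- move=> x /= xr; rewrite patchE mem_set//= /D/=.
  rewrite (le_trans (enormD_le _ _))// ler_wpM2l// lerD//.
  by rewrite enorm_delta.
- by apply: integrableS L.
Qed.

Lemma continuous_translation (c : 'rV[R]_n) : continuous (fun x : 'rV[R]_n => x + c).
Proof.
move=> x; apply: (@continuousD _ _ _ id (cst c)) => //; exact: cst_continuous.
Qed.

Lemma continuous_line (x : 'rV[R]_n) i : continuous (fun s : R => x + (- s) *: e i).
Proof.
move=> s; apply: cvgD; first exact: cvg_cst.
by apply: cvgZr_tmp; apply: cvgN; exact: cvg_id.
Qed.

Lemma test_shift phi i t : test_function phi ->
  test_function (fun x => phi (x + t *: e i)) /\
  partial [:: i] (fun x => phi (x + t *: e i)) =
  (fun x => partial [:: i] phi (x + t *: e i)).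
Proof.
move=> [sphi [r phi0]].
have dE (psi : 'rV[R]_n -> R) j x : derivable psi (x + t *: e i) (e j) ->
    is_derive x (e j) (fun x => psi (x + t *: e i)) ('D_(e j) psi (x + t *: e i)).
  move=> /derivableP /is_derive_line dpsi; apply/is_derive_line.
  rewrite (_ : (fun h : R => _) = (fun h : R => psi (h *: e j + (x + t *: e i))))//.
  by apply/funext => h; rewrite addrA.
have pE (s : seq 'I_n) : partial s (fun x => phi (x + t *: e i)) =
    (fun x => partial s phi (x + t *: e i)).
  elim: s => //= j s IH; apply/funext => x.
  have [_ dphi] := sphi s.
  by rewrite IH; have [_ ->] := dE (partial s phi) j x (dphi _ _).
split; last exact: pE.
split.
- move=> s; rewrite pE; have [cs ds] := sphi s; split.
    move=> x; apply: (cvg_comp _ _ (@continuous_translation (t *: e i) x)).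
    exact: cs.
  by move=> j x; have [] := dE (partial s phi) j x (ds _ _).
- exists (n%:R * (r + `|t|)) => x xr; apply: phi0; exact: shift_far xr _.
Qed.

(** The fundamental theorem of calculus on a segment of a coordinate line. *)
Lemma test_line_integral phi i h x : test_function phi -> 0 <= h ->
  \int[leb1]_s (segment h s * partial [:: i] phi (x + (- s) *: e i)) =
  phi x - phi (x + (- h) *: e i).
Proof.
move=> [sphi _]; rewrite le_eqVlt => /predU1P[<-|h0].
  rewrite oppr0 scale0r addr0 subrr.
  rewrite (@ae_eq_Rintegral _ _ _ leb1 _ (cst 0)) ?Rintegral_cst ?mul0r//.
  - apply: measurable_funM; first exact: measurable_segment.
    apply: (measurableT_comp (continuous_measurable_rV (smooth_continuous (smooth_partial i sphi)))).
    apply: measurable_fun_coordP => a b; under eq_fun do rewrite !mxE.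
    apply: measurable_funD => //; apply: measurable_funM => //.
  - exists [set 0]; split => //; first exact: lebesgue_measure_set1.
    move=> s /= hs; apply: contrapT => s0; apply: hs.
    rewrite segment_out ?mul0r//; apply/negP => s00; apply: s0.
    by apply/eqP; rewrite eq_le andbC.
pose dphi (s : R) := partial [:: i] phi (x + (- s) *: e i).
pose F (s : R) := - phi (x + (- s) *: e i).
have cline := @continuous_line x i.
have cdphi : continuous dphi.
  move=> s; apply: continuous_comp; first exact: cline.
  exact: (smooth_continuous (smooth_partial i sphi)).
have cF : continuous F.
  move=> s; apply: continuousN; apply: continuous_comp; first exact: cline.
  exact: (smooth_continuous sphi).
have dF (s : R) : is_derive s 1 F (dphi s).
  have := smooth_is_derive i (x + (- s) *: e i) sphi.
  move=> /is_derive_line H.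
  have H2 : is_derive s 1 (fun r : R => s - r) (- 1).
    have := is_deriveB (is_derive_cst s s 1) (is_derive_id s 1).
    by rewrite sub0r.
  have H3 : is_derive (s - s) 1 (fun t : R => phi (t *: e i + (x + (- s) *: e i)))
      (partial [:: i] phi (x + (- s) *: e i)) by rewrite subrr.
  have H4 := @is_derive1_comp _ _ (fun r : R => s - r) s _ _ H3 H2.
  have H5 := is_deriveN H4.
  rewrite mulrN1 opprK in H5.
  rewrite (_ : F = - ((fun t : R => phi (t *: e i + (x + (- s) *: e i))) \o
      (fun r : R => s - r)))//.
  apply/funext => r; rewrite /F [RHS]/=; congr (- phi _).
  by rewrite addrCA -scalerDl; congr (_ + _ *: _); ring.
have := @continuous_FTC2 R dphi F 0 h h0 (continuous_subspaceT cdphi).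
move=> H; rewrite /Rintegral.
under eq_integral => s _ do rewrite mulrC.
have -> : (\int[leb1]_s (dphi s * segment h s)%:E = \int[leb1]_(s in `[0%R, h]) (dphi s)%:E)%E.
  rewrite [RHS]integral_mkcond; apply: eq_integral => s _.
  rewrite patchE /segment indicE; case: ifP => _; first by rewrite mulr1.
  by rewrite mulr0.
rewrite H /=.
- by rewrite /F oppr0 scale0r addr0 opprK addrC.
- split; [by move=> s _; case: (dF s)| |].
  + by apply: cvg_at_right_filter; exact: cF.
  + by apply: cvg_at_left_filter; exact: cF.
- by move=> s _; rewrite derive1E; case: (dF s).
Qed.

End shifts.

(** * Difference quotients of weakly differentiable functions *)

Section real_integrals_ae.
Context d (T : measurableType d) (R : realType).
Variable mu : {measure set T -> \bar R}.
Implicit Types f g : T -> R.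

Lemma L1_le_ae f g : measurable_fun setT f ->
  {ae mu, forall x, `|f x| <= g x} -> L1 mu g ->
  L1 mu f /\ \int[mu]_x `|f x| <= \int[mu]_x g x.
Proof.
move=> mf fg Lg; have mg := L1_measurable Lg.
have h : (\int[mu]_x `|f x|%:E <= \int[mu]_x `|g x|%:E)%E.
  apply: ae_ge0_le_integral => //.
  - by apply/measurable_EFinP; apply: measurableT_comp.
  - by apply/measurable_EFinP; apply: measurableT_comp.
  - by apply: filterS fg => x /= fx _; rewrite lee_fin (le_trans fx)// ler_norm.
have Lf : L1 mu f.
  apply/integrableP; split; first exact/measurable_EFinP.
  by apply: le_lt_trans h _; have /integrableP[_] := Lg.
split=> //.
have g0 : {ae mu, forall x, `|g x| = g x}.
  by apply: filterS fg => x /= fx; rewrite ger0_norm// (le_trans _ fx).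
rewrite -(ae_eq_Rintegral _ mg g0); last exact: measurableT_comp.
have Ln := L1_norm Lf; have Lgn := L1_norm Lg.
by rewrite -lee_fin -!RintegralE.
Qed.

End real_integrals_ae.

Section difference_quotients.
Context (R : realType) (n : nat).
Implicit Types (u v g phi : 'rV[R]_n -> R) (i : 'I_n) (h s t : R).
Local Notation leb := (lebesgue_rV R n).
Local Notation leb1 := (@lebesgue_measure R).
Local Notation e i := (delta_mx ord0 i : 'rV[R]_n).

Lemma L1_segment h : 0 <= h -> L1 leb1 (segment h).
Proof.
move=> h0; apply/L1_ge0P; first exact: segment_ge0.
  exact: measurable_segment.
by rewrite integral_segment// ltry.
Qed.

Lemma Rintegral_segment h : 0 <= h -> \int[leb1]_s segment h s = h.
Proof. by move=> h0; rewrite /Rintegral integral_segment. Qed.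

Lemma L1_segment_bounded h (w : R -> R) (C : R) : 0 <= h ->
  measurable_fun setT w -> (forall s, `|w s| <= C) ->
  L1 leb1 (fun s => segment h s * w s).
Proof.
move=> h0 mw wC; apply: (@L1_le _ _ _ leb1 _ (fun s => C * segment h s)).
- by apply: measurable_funM => //; exact: measurable_segment.
- move=> s; rewrite normrM mulrC (ger0_norm (segment_ge0 h s)).
  by rewrite ler_wpM2r ?segment_ge0.
- by apply: L1Z; exact: L1_segment.
Qed.

Lemma segment_cauchy_schwarz h (w : R -> R) : 0 < h ->
  L1 leb1 (fun s => segment h s * w s) ->
  L1 leb1 (fun s => segment h s * w s ^+ 2) ->
  (\int[leb1]_s (segment h s * w s)) ^+ 2 <=
  h * \int[leb1]_s (segment h s * w s ^+ 2).
Proof.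
move=> h0 L1w L1w2; set I := \int[leb1]_s _; set J := \int[leb1]_s _.
pose c := I / h.
have : 0 <= \int[leb1]_s (segment h s * (w s - c) ^+ 2).
  by apply: Rintegral_ge0 => s _; rewrite mulr_ge0 ?segment_ge0 ?sqr_ge0.
have Ls := L1_segment (ltW h0).
have LB : L1 leb1 (fun s => segment h s * w s ^+ 2 - (2 * c) * (segment h s * w s)).
  by apply: L1B => //; exact: L1Z.
rewrite (_ : \int[leb1]_s (segment h s * (w s - c) ^+ 2) = J - (2 * c) * I + c ^+ 2 * h).
  move=> H; rewrite -subr_ge0.
  rewrite (_ : h * J - I ^+ 2 = h * (J - (2 * c) * I + c ^+ 2 * h)).
    by rewrite mulr_ge0// ltW.
  by rewrite /c; field; rewrite gt_eqF.
rewrite -[X in c ^+ 2 * X](Rintegral_segment (ltW h0)).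
rewrite -RintegralZl// -RintegralZl//.
rewrite -RintegralB//; last exact: L1Z.
rewrite -RintegralD//; last exact: L1Z.
by apply: eq_Rintegral => s _; ring.
Qed.

(** Fubini on the slab: a function transported along the coordinate lines
    against the derivative of a test function telescopes. *)
Lemma integral_test_increment u phi i h : locally_L1 u -> test_function phi ->
  0 <= h ->
  L1 leb1 (fun s => segment h s *
    \int[leb]_x (u x * partial [:: i] phi (x + (- s) *: e i))) /\
  \int[leb]_x (u x * (phi x - phi (x + (- h) *: e i))) =
  \int[leb1]_s (segment h s *
    \int[leb]_x (u x * partial [:: i] phi (x + (- s) *: e i))).
Proof.
move=> Lu tphi h0; have tdphi := test_partial i tphi.
have [r [C [dC d0]]] := test_bounded tdphi.
have mu_ := locally_L1_measurable Lu; have mdphi := test_measurable tdphi.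
pose f (p : R * 'rV[R]_n) := u p.2 * partial [:: i] phi (p.2 + (- p.1) *: e i).
have mf : measurable_fun setT f.
  apply: measurable_funM; last exact: measurable_shift2N.
  exact: (measurableT_comp mu_).
pose D := [set x : 'rV[R]_n | enorm x <= n%:R * (r + h)].
have LD : L1 leb (fun x => `|u x * (C * \1_D x)|).
  apply: L1_norm; apply: (locally_L1_mul (r := n%:R * (r + h)) (C := `|C|)) => //.
  - apply: measurable_funM => //; apply: measurable_indic.
    exact: measurable_enorm_le.
  - move=> x; rewrite normrM ler_piMr// ger0_norm indicE ?ler0n//.
    by rewrite lern1 leq_b1.
  - move=> x rx; rewrite indicE memNset ?mulr0//= /D/=.
    by apply/negP; rewrite -ltNge.
have Lf : (leb1 \x leb)%E.-integrable setT (EFin \o (fun p => segment h p.1 * f p)).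
  apply: (slab_integrable (M := \int[leb]_x `|u x * (C * \1_D x)|)) => // s sh.
  rewrite -RintegralE//; apply: ge0_le_integral => //.
  - apply/measurable_EFinP; apply: measurableT_comp => //.
    apply: measurable_funM => //; apply: (measurableT_comp mdphi).
    exact: (measurable_add (- s *: e i)).
  - by apply/measurable_EFinP; exact: L1_measurable LD.
  - move=> x _; rewrite lee_fin /f !normrM ler_wpM2l//.
    have [xD|xD] := leP (enorm x) (n%:R * (r + h)).
      by rewrite indicE mem_set//= normr1 mulr1 (le_trans (dC _))// ler_norm.
    rewrite d0 ?normr0 ?mulr_ge0//; apply: shift_far xD _.
    by move/andP: sh => [s0 sh]; rewrite normrN ger0_norm.
have [L1f E1] := Rintegral_Fubini1 Lf; have [_ E2] := Rintegral_Fubini2 Lf.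
have E s : \int[leb]_x (segment h s * f (s, x)) = segment h s *
    \int[leb]_x (u x * partial [:: i] phi (x + (- s) *: e i)).
  rewrite -RintegralZl//; have [tp pE] := test_shift i (- s) tdphi.
  by apply: (locally_L1_test Lu tp).
split.
  by rewrite /= in L1f; move: L1f; under eq_fun do rewrite E.
transitivity (\int[leb]_x \int[leb1]_s (segment h s * f (s, x))).
  apply: eq_Rintegral => x _; rewrite -test_line_integral// -RintegralZl//.
    by apply: eq_Rintegral => s _; rewrite /f/=; ring.
  apply: (L1_segment_bounded (C := C)) => //.
  apply: (measurableT_comp mdphi).
  by apply: measurable_fun_coordP => a b; under eq_fun do rewrite !mxE;
    apply: measurable_funD => //; apply: measurable_funM => //; exact: measurableT_comp.
by rewrite E2 -E1; apply: eq_Rintegral => s _; rewrite E.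
Qed.

(** A test function and its translate have the same integral. *)
Lemma Rintegral_partial_eq0 phi i : test_function phi ->
  \int[leb]_x partial [:: i] phi x = 0.
Proof.
move=> tphi; have tdphi := test_partial i tphi.
have Lc : locally_L1 (fun _ : 'rV[R]_n => 1 : R).
  by apply: continuous_locally_L1 => x; exact: cst_continuous.
have L1phi : L1 leb phi.
  by have := locally_L1_test Lc tphi; under eq_fun do rewrite mul1r.
have [_] := integral_test_increment i Lc tphi ler01.
under eq_Rintegral do rewrite mul1r.
rewrite RintegralB//; last exact: L1_shift.
rewrite (Rintegral_shift i _ (test_measurable tphi)) subrr.
under eq_Rintegral => s _.
  under eq_Rintegral do rewrite mul1r.
  rewrite (Rintegral_shift i (- s) (test_measurable tdphi)) mulrC.
  over.
rewrite RintegralZl//; last exact: L1_segment.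
by rewrite Rintegral_segment// mulr1.
Qed.

Definition line_primitive g i h (x : 'rV[R]_n) : R :=
  \int[leb1]_s (segment h s * g (x + s *: e i)).

Lemma slab_integrable_shift g (psi : 'rV[R]_n -> R) i h (r C : R) : locally_L1 g -> 0 <= h ->
  measurable_fun setT psi -> (forall x, `|psi x| <= C) ->
  (forall x, r < enorm x -> psi x = 0) ->
  (leb1 \x leb)%E.-integrable setT
    (EFin \o (fun p => segment h p.1 * (g (p.2 + p.1 *: e i) * psi p.2))).
Proof.
move=> Lg h0 mpsi psiC psi0; have mg := locally_L1_measurable Lg.
pose D := [set x : 'rV[R]_n | enorm x <= n%:R * (r + h)].
have LD : L1 leb (fun x => `|g x * (C * \1_D x)|).
  apply: L1_norm; apply: (locally_L1_mul (r := n%:R * (r + h)) (C := `|C|)) => //.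
  - apply: measurable_funM => //; apply: measurable_indic.
    exact: measurable_enorm_le.
  - move=> x; rewrite normrM ler_piMr// ger0_norm indicE ?ler0n//.
    by rewrite lern1 leq_b1.
  - move=> x rx; rewrite indicE memNset ?mulr0//= /D/=.
    by apply/negP; rewrite -ltNge.
apply: (slab_integrable (M := \int[leb]_x `|g x * (C * \1_D x)|)) => //.
  apply: measurable_funM; first exact: measurable_shift2.
  exact: (measurableT_comp mpsi).
move=> s /andP[s0 sh]; rewrite -(Rintegral_shift i s (L1_measurable LD)).
rewrite -RintegralE; last exact: (L1_shift i s LD).
apply: ge0_le_integral => //.
- apply/measurable_EFinP; apply: measurableT_comp => //.
  apply: measurable_funM => //; apply: (measurableT_comp mg).
  exact: (measurable_add (_ *: e i)).
- apply/measurable_EFinP; exact: L1_measurable (L1_shift i s LD).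
- move=> x _; rewrite lee_fin /= !normrM ler_wpM2l//.
  have [xD|xD] := leP (enorm (x + s *: e i)) (n%:R * (r + h)).
    by rewrite indicE mem_set//= normr1 mulr1 (le_trans (psiC _))// ler_norm.
  rewrite psi0 ?normr0 ?mulr_ge0//.
  have := @shift_far _ _ i (x + s *: e i) (- s) r h xD.
  rewrite scaleNr addrK; apply.
  by rewrite normrN ger0_norm.
Qed.

Lemma ae_L1_line g i h : locally_L1 g -> 0 <= h ->
  {ae leb, forall x, L1 leb1 (fun s => segment h s * g (x + s *: e i))}.
Proof.
move=> Lg h0.
have H (k : nat) : {ae leb, forall x, enorm x <= k%:R ->
    L1 leb1 (fun s => segment h s * g (x + s *: e i))}.
  have Lf : (leb1 \x leb)%E.-integrable setT
      (EFin \o (fun p => segment h p.1 * (g (p.2 + p.1 *: e i) *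
        \1_([set x : 'rV[R]_n | enorm x <= k%:R]) p.2))).
    apply: (@slab_integrable_shift g _ i h k%:R 1) => //.
    - by apply: measurable_indic; exact: measurable_enorm_le.
    - by move=> x; rewrite indicE ger0_norm// lern1 leq_b1.
    - by move=> x xk; rewrite indicE memNset//=; apply/negP; rewrite -ltNge.
  have := ae_integrable2 Lf; apply: filterS => x /= Lx xk.
  apply: eq_integrable Lx => // s _ /=.
  by rewrite indicE mem_set//= mulr1.
have := ae_foralln H; apply: filterS => x Hx.
by apply: (Hx (Num.truncn (enorm x)).+1); rewrite ltW// truncnS_gt.
Qed.

Lemma locally_L1_line_primitive g i h : locally_L1 g -> 0 <= h ->
  locally_L1 (line_primitive g i h).
Proof.
move=> Lg h0 r.
have mD := @measurable_enorm_le R n r.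
have Lf : (leb1 \x leb)%E.-integrable setT
    (EFin \o (fun p => segment h p.1 * (g (p.2 + p.1 *: e i) *
      \1_([set x : 'rV[R]_n | enorm x <= r]) p.2))).
  apply: (@slab_integrable_shift g _ i h r 1) => //.
  - by move=> x; rewrite indicE ger0_norm// lern1 leq_b1.
  - by move=> x xk; rewrite indicE memNset//=; apply/negP; rewrite -ltNge.
have [L _] := Rintegral_Fubini2 Lf.
have := integrableS measurableT mD (@subsetT _ _) L.
apply: eq_integrable => // x /set_mem/= xr; congr EFin.
rewrite /line_primitive; apply: eq_Rintegral => s _.
by rewrite /= indicE mem_set//= mulr1.
Qed.

Lemma integral_line_primitive g phi i h : locally_L1 g -> test_function phi ->
  0 <= h ->
  \int[leb]_x (line_primitive g i h x * phi x) =
  \int[leb1]_s (segment h s * \int[leb]_x (g (x + s *: e i) * phi x)).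
Proof.
move=> Lg tphi h0; have [r [C [phiC phi0]]] := test_bounded tphi.
have mphi := test_measurable tphi.
have Lf := slab_integrable_shift i Lg h0 mphi phiC phi0.
have [L2 E2] := Rintegral_Fubini2 Lf; have [_ E1] := Rintegral_Fubini1 Lf.
transitivity (\int[leb]_x \int[leb1]_s
    (segment h s * (g (x + s *: e i) * phi x))).
  apply: ae_eq_Rintegral.
  - apply: measurable_funM => //; apply: locally_L1_measurable.
    exact: locally_L1_line_primitive.
  - exact: L1_measurable L2.
  - have := ae_L1_line i Lg h0; apply: filterS => x Lx.
    rewrite /line_primitive -RintegralZr//.
    by apply: eq_Rintegral => s _; rewrite mulrA.
rewrite E2 -E1; apply: eq_Rintegral => s _; rewrite -RintegralZl//.
by apply: locally_L1_test => //; exact: locally_L1_shift.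
Qed.

(** Absolute continuity on coordinate lines: tested with [phi], both sides
    transfer the increment to [phi], where it is the integral of its derivative
    along the segment. *)
Lemma weak_partial_increment u g i h : locally_L1 u -> weak_partial u i g ->
  0 <= h ->
  {ae leb, forall x, u (x + h *: e i) - u x = line_primitive g i h x}.
Proof.
move=> Lu [Lg wg] h0.
pose w x := (u (x + h *: e i) + (-1) * u x) + (-1) * line_primitive g i h x.
suff : ae_zero w.
  by apply: filterS => x /=; rewrite /w !mulN1r => /eqP; rewrite subr_eq0 => /eqP.
have Lush := locally_L1_shift i h Lu.
have LP := locally_L1_line_primitive i Lg h0.
have Lw : locally_L1 w.
  by apply: locally_L1D; [apply: locally_L1D => //|]; exact: locally_L1Z.
apply: fundamental_lemma => // phi tphi.
have A1 := locally_L1_test Lush tphi; have A2 := locally_L1_test Lu tphi.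
have A3 := locally_L1_test LP tphi.
have B1 : \int[leb]_x (u (x + h *: e i) * phi x) =
          \int[leb]_x (u x * phi (x + (- h) *: e i)).
  have [tp _] := test_shift i (- h) tphi.
  have Lv := locally_L1_test Lu tp.
  rewrite -(Rintegral_shift i h (L1_measurable Lv)).
  by apply: eq_Rintegral => x _; rewrite scaleNr addrK.
have B3 : \int[leb]_x (line_primitive g i h x * phi x) =
    - \int[leb]_x (u x * (phi x - phi (x + (- h) *: e i))).
  have [Lt Et] := integral_test_increment i Lu tphi h0.
  rewrite integral_line_primitive// Et -mulN1r -RintegralZl//.
  apply: eq_Rintegral => s _; rewrite mulN1r -mulrN; congr (_ * _).
  have [tp pE] := test_shift i (- s) tphi.
  have := wg _ tp; rewrite pE => ->; rewrite opprK.
  have Lv := locally_L1_test Lg tp.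
  rewrite -(Rintegral_shift i s (L1_measurable Lv)).
  by apply: eq_Rintegral => x _; rewrite scaleNr addrK.
transitivity (\int[leb]_x (u (x + h *: e i) * phi x) - \int[leb]_x (u x * phi x) -
   \int[leb]_x (line_primitive g i h x * phi x)).
  rewrite -RintegralB// -RintegralB//; last exact: L1B.
  by apply: eq_Rintegral => x _; rewrite /w; ring.
rewrite B1 B3 opprK.
have [tp _] := test_shift i (- h) tphi.
have A4 := locally_L1_test Lu tp.
rewrite (_ : \int[leb]_x (u x * (phi x - phi (x + - h *: e i))) =
   \int[leb]_x (u x * phi x) - \int[leb]_x (u x * phi (x + - h *: e i))).
  by ring.
by rewrite -RintegralB//; apply: eq_Rintegral => x _; rewrite mulrBr.
Qed.

(** By Cauchy-Schwarz on the segment and Tonelli. This bound replaces the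
    approximation of [u] by smooth functions. *)
Lemma difference_quotient_le u g i h : locally_L1 u -> weak_partial u i g ->
  L1 leb (fun x => g x ^+ 2) -> 0 < h ->
  L1 leb (fun x => (u (x + h *: e i) - u x) ^+ 2) /\
  \int[leb]_x (u (x + h *: e i) - u x) ^+ 2 <= h ^+ 2 * \int[leb]_x g x ^+ 2.
Proof.
move=> Lu wg Lg2 h0; have [Lg _] := wg; have mg := locally_L1_measurable Lg.
have mu_ := locally_L1_measurable Lu.
pose f (p : R * 'rV[R]_n) := g (p.2 + p.1 *: e i) ^+ 2.
have Lf : (leb1 \x leb)%E.-integrable setT (EFin \o (fun p => segment h p.1 * f p)).
  apply: (slab_integrable (M := \int[leb]_x g x ^+ 2)).
  - exact: ltW.
  - by apply: (@measurable_shift2 _ _ (fun x => g x ^+ 2)); exact: L1_measurable Lg2.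
  - move=> s _; rewrite -(Rintegral_shift i s (L1_measurable Lg2)).
    rewrite -RintegralE; last exact: (L1_shift i s Lg2).
    rewrite le_eqVlt; apply/orP; left; apply/eqP; apply: eq_integral => x _.
    by rewrite /f/= ger0_norm// sqr_ge0.
have [L2 E2] := Rintegral_Fubini2 Lf; have [_ E1] := Rintegral_Fubini1 Lf.
have IQ : \int[leb]_x (h * \int[leb1]_s (segment h s * f (s, x))) =
   h ^+ 2 * \int[leb]_x g x ^+ 2.
  rewrite RintegralZl// E2 -E1 expr2 -mulrA; congr (_ * _).
  transitivity (\int[leb1]_s (segment h s * \int[leb]_x g x ^+ 2)).
    apply: eq_Rintegral => s _; rewrite -(Rintegral_shift i s (L1_measurable Lg2)).
    by rewrite -RintegralZl//; exact: (L1_shift i s Lg2).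
  by rewrite RintegralZr ?Rintegral_segment ?ltW//; exact: L1_segment (ltW h0).
rewrite -IQ.
have mD : measurable_fun setT (fun x : 'rV[R]_n => u (x + h *: e i) - u x).
  by apply: measurable_funB => //; apply: (measurableT_comp mu_); exact: (measurable_add (h *: e i)).
have [] := @L1_le_ae _ _ _ leb (fun x => (u (x + h *: e i) - u x) ^+ 2)
    (fun x => h * \int[leb1]_s (segment h s * f (s, x))).
- exact: measurable_funX.
- have H1 := weak_partial_increment Lu wg (ltW h0).
  have H2 := ae_L1_line i Lg (ltW h0).
  have H3 := ae_L1_line i (L1_locally Lg2) (ltW h0).
  apply: filterS3 H1 H2 H3 => x -> Lx Lx2.
  by rewrite ger0_norm ?sqr_ge0//; exact: segment_cauchy_schwarz.
- exact: L1Z.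
move=> LD ID; split => //; apply: le_trans ID.
rewrite le_eqVlt; apply/orP; left; apply/eqP; apply: eq_Rintegral => x _.
by rewrite ger0_norm// sqr_ge0.
Qed.

End difference_quotients.

(** * Weak gradients of sums and products *)

Section weak_calculus.
Context (R : realType) (n : nat).
Implicit Types (u v g phi p : 'rV[R]_n -> R) (i : 'I_n).
Local Notation leb := (lebesgue_rV R n).

Lemma weak_partial_unique u i g g' : weak_partial u i g -> weak_partial u i g' ->
  {ae leb, forall x, g x = g' x}.
Proof.
move=> [Lg wg] [Lg' wg'].
suff : ae_zero (fun x => g x + (-1) * g' x).
  by apply: filterS => x /=; rewrite mulN1r => /eqP; rewrite subr_eq0 => /eqP.
apply: fundamental_lemma => [|phi tphi].
  by apply: locally_L1D => //; exact: locally_L1Z.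
have A := locally_L1_test Lg tphi; have A' := locally_L1_test Lg' tphi.
transitivity (\int[leb]_x (g x * phi x) - \int[leb]_x (g' x * phi x)).
  by rewrite -RintegralB//; apply: eq_Rintegral => x _; ring.
apply/eqP; rewrite subr_eq0; apply/eqP; apply: oppr_inj.
by rewrite -wg// -wg'.
Qed.

Lemma weak_grad_spec u i : weakly_differentiable u ->
  weak_partial u i (weak_grad u i).
Proof.
move=> [_ /(_ i) wg].
exact: (@xgetPex _ (cst 0) [set g | weak_partial u i g] wg).
Qed.

Lemma weak_grad_unique u i g : weak_partial u i g ->
  {ae leb, forall x, weak_grad u i x = g x}.
Proof.
move=> wg; have ex : exists g, weak_partial u i g by exists g.
apply: weak_partial_unique wg.
exact: (@xgetPex _ (cst 0) [set g | weak_partial u i g] ex).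
Qed.

Lemma weak_partialD u v i g g' (t : R) : locally_L1 u -> locally_L1 v ->
  weak_partial u i g -> weak_partial v i g' ->
  weak_partial (fun x => u x + t * v x) i (fun x => g x + t * g' x).
Proof.
move=> Lu Lv [Lg wg] [Lg' wg']; split=> [|phi tphi].
  by apply: locally_L1D => //; exact: locally_L1Z.
have tdphi := test_partial i tphi.
have A := locally_L1_test Lu tdphi; have A' := locally_L1_test Lv tdphi.
have B := locally_L1_test Lg tphi; have B' := locally_L1_test Lg' tphi.
transitivity (\int[leb]_x (u x * partial [:: i] phi x) +
    t * \int[leb]_x (v x * partial [:: i] phi x)).
  rewrite -RintegralZl// -RintegralD//; last exact: L1Z.
  by apply: eq_Rintegral => x _; ring.
rewrite wg// wg'// mulrN -opprD; congr (- _).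
rewrite -RintegralZl// -RintegralD//; last exact: L1Z.
by apply: eq_Rintegral => x _; ring.
Qed.

Lemma partialM p phi i : smooth p -> smooth phi ->
  partial [:: i] (fun x => p x * phi x) =
  (fun x => p x * partial [:: i] phi x + phi x * partial [:: i] p x).
Proof.
move=> sp sphi; apply/funext => x.
by have [_ <-] := is_derive_mulr (smooth_is_derive i x sp) (smooth_is_derive i x sphi).
Qed.

(** The product of a test function with a smooth function is a test function,
    so the classical Leibniz rule passes to the weak derivative. *)
Lemma weak_partialM u i g p : locally_L1 u -> weak_partial u i g -> smooth p ->
  weak_partial (fun x => p x * u x) i
    (fun x => p x * g x + partial [:: i] p x * u x).
Proof.
move=> Lu [Lg wg] sp; have cp := smooth_continuous sp.
have cdp := smooth_continuous (smooth_partial i sp).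
split=> [|phi tphi].
  by apply: locally_L1D; exact: locally_L1_continuousM.
have [sphi _] := tphi; have tdphi := test_partial i tphi.
have tphip := test_smoothM tphi sp.
have A1 := locally_L1_test Lu (test_smoothM tphi (smooth_partial i sp)).
have A2 := locally_L1_test Lu (test_smoothM tdphi sp).
have A3 := locally_L1_test Lg tphip.
have := wg _ tphip; rewrite (partialM i sphi sp).
move: (partial [:: i] phi) (partial [:: i] p) A1 A2 => dphi dp A1 A2.
have E1 := RintegralD measurableT A1 A2; have E3 := RintegralD measurableT A3 A1.
rewrite (_ : \int[leb]_x (u x * (phi x * dp x + p x * dphi x)) =
  \int[leb]_x (u x * (phi x * dp x) + u x * (dphi x * p x))); last first.
  by apply: eq_Rintegral => x _; ring.
rewrite E1 => E2.
rewrite (_ : \int[leb]_x (p x * u x * dphi x) = \int[leb]_x (u x * (dphi x * p x))); last first.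
  by apply: eq_Rintegral => x _; ring.
rewrite (_ : \int[leb]_x ((p x * g x + dp x * u x) * phi x) =
  \int[leb]_x (g x * (phi x * p x) + u x * (phi x * dp x))); last first.
  by apply: eq_Rintegral => x _; ring.
by rewrite E3; move: E2; lra.
Qed.

Lemma test_weak_partial phi i : test_function phi ->
  weak_partial phi i (partial [:: i] phi).
Proof.
move=> tphi; have [sphi _] := tphi; split=> [|psi tpsi].
  exact/continuous_locally_L1/smooth_continuous/smooth_partial.
have [spsi _] := tpsi; have tdphi := test_partial i tphi.
have tdpsi := test_partial i tpsi.
have t1 := test_smoothM tpsi sphi.
have := Rintegral_partial_eq0 i t1; rewrite (partialM i spsi sphi).
have A1 := locally_L1_test (continuous_locally_L1 (smooth_continuous spsi)) tdphi.
have A2 := locally_L1_test (continuous_locally_L1 (smooth_continuous sphi)) tdpsi.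
move: (partial [:: i] phi) (partial [:: i] psi) A1 A2 => dphi dpsi A1 A2.
rewrite (RintegralD measurableT A1 A2) => E.
rewrite (_ : \int[leb]_x (dphi x * psi x) = \int[leb]_x (psi x * dphi x)).
  by move: E; lra.
by apply: eq_Rintegral => x _; rewrite mulrC.
Qed.

Lemma test_weakly_differentiable phi : test_function phi ->
  weakly_differentiable phi.
Proof.
move=> tphi; split.
  by apply/continuous_locally_L1/smooth_continuous; case: tphi.
by move=> i; exists (partial [:: i] phi); exact: test_weak_partial.
Qed.

Lemma weakly_differentiableD u v (t : R) : weakly_differentiable u ->
  weakly_differentiable v -> weakly_differentiable (fun x => u x + t * v x).
Proof.
move=> wu wv; have [Lu _] := wu; have [Lv _] := wv; split.
  by apply: locally_L1D => //; exact: locally_L1Z.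
move=> i; exists (fun x => weak_grad u i x + t * weak_grad v i x).
by apply: weak_partialD => //; exact: weak_grad_spec.
Qed.

Lemma weakly_differentiableM u p : weakly_differentiable u -> smooth p ->
  weakly_differentiable (fun x => p x * u x).
Proof.
move=> wu sp; have [Lu _] := wu; split.
  by apply: locally_L1_continuousM => //; exact: smooth_continuous.
move=> i; exists (fun x => p x * weak_grad u i x + partial [:: i] p x * u x).
by apply: weak_partialM => //; exact: weak_grad_spec.
Qed.

Lemma weak_grad_measurable u i : weakly_differentiable u ->
  measurable_fun setT (weak_grad u i).
Proof. by move=> /(weak_grad_spec i)[/locally_L1_measurable]. Qed.

Lemma weak_gradD u v (t : R) i : weakly_differentiable u ->
  weakly_differentiable v -> {ae leb, forall x,
  weak_grad (fun x => u x + t * v x) i x = weak_grad u i x + t * weak_grad v i x}.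
Proof.
move=> wu wv; apply: weak_grad_unique; apply: weak_partialD;
  by [case: wu|case: wv|exact: weak_grad_spec].
Qed.

Lemma weak_gradM u p i : weakly_differentiable u -> smooth p -> {ae leb, forall x,
  weak_grad (fun x => p x * u x) i x =
  p x * weak_grad u i x + partial [:: i] p x * u x}.
Proof.
move=> wu sp; apply: weak_grad_unique; apply: weak_partialM => //.
  by case: wu.
exact: weak_grad_spec.
Qed.

Lemma ae_forall_ord (m : nat) (P : 'I_m -> 'rV[R]_n -> Prop) :
  (forall j, {ae leb, forall x, P j x}) -> {ae leb, forall x, forall j, P j x}.
Proof.
move=> H; have H' (k : nat) : {ae leb, forall x, forall i : 'I_m, val i = k -> P i x}.
  have [km|km] := ltnP k m.
    have := H (Ordinal km); apply: filterS => x Px i ik.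
    by rewrite (_ : i = Ordinal km)//; exact: val_inj.
  by apply: aeW => x i ik; move: (ltn_ord i); rewrite ik ltnNge km.
by have := ae_foralln H'; apply: filterS => x Px i; exact: (Px i).
Qed.

End weak_calculus.

(** * Hardy's inequality *)

Section hardy.
Context (R : realType) (n : nat).
Implicit Types (z : 'rV[R]_n -> R) (i : 'I_n) (x : 'rV[R]_n).
Local Notation leb := (lebesgue_rV R n).
Local Notation e i := (delta_mx ord0 i : 'rV[R]_n).

(** The components of the field x / (1 + |x|^2), a smooth substitute for
    x / |x|^2 in the proof of Hardy's inequality. *)
Definition hardy_field i x : R := x ord0 i / (1 + sqn x).

Definition hardy_field_partial i x : R :=
  (1 + sqn x - 2 * x ord0 i ^+ 2) / (1 + sqn x) ^+ 2.

Lemma sqn1_gt0 x : 0 < 1 + sqn x.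
Proof. by rewrite ltr_wpDr// sqn_ge0. Qed.

Lemma sqn1_neq0 x : 1 + sqn x != 0.
Proof. by rewrite gt_eqF// sqn1_gt0. Qed.

Lemma elementary_sqn1_powR (c a : R) : 0 <= c ->
  elementary (fun x : 'rV[R]_n => (1 + c * sqn x) `^ a).
Proof.
move=> c0; apply: (elementary_comp (I := [set t | 0 < t])
    (Theta := fun t => t `^ a)).
- exact: smooth_on_powR.
- apply: elementary_add; first exact: elementary_cst.
  by apply: elementary_mul; [exact: elementary_cst|exact: elementary_sqn].
- by move=> x /=; rewrite ltr_wpDr// mulr_ge0// sqn_ge0.
Qed.

Lemma continuous_sqn1V : continuous (fun x : 'rV[R]_n => (1 + sqn x)^-1).
Proof.
rewrite (_ : (fun x => _) = (fun x : 'rV[R]_n => (1 + 1 * sqn x) `^ (-1))).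
  exact/elementary_continuous/elementary_sqn1_powR.
by apply/funext => x; rewrite mul1r powR_inv1// ltW// sqn1_gt0.
Qed.

Lemma measurable_hardy_field i : measurable_fun setT (hardy_field i).
Proof.
apply: measurable_funM; first exact: measurable_coord.
exact: continuous_measurable_rV continuous_sqn1V.
Qed.

Lemma measurable_hardy_field_partial i : measurable_fun setT (hardy_field_partial i).
Proof.
rewrite /hardy_field_partial; apply: measurable_funM.
  apply: measurable_funB.
    by apply: measurable_funD => //; exact: measurable_sqn.
  by apply: measurable_funM => //; apply: measurable_funX; exact: measurable_coord.
under eq_fun do rewrite -exprVn.
by apply: measurable_funX; exact: continuous_measurable_rV continuous_sqn1V.
Qed.

Lemma sqn_shift i x (t : R) :
  sqn (x + t *: e i) = sqn x + 2 * t * x ord0 i + t ^+ 2.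
Proof.
rewrite /sqn (bigD1 i)//= [in RHS](bigD1 i)//= !mxE !eqxx/= mulr1.
rewrite [X in _ + X = _](eq_bigr (fun j => x ord0 j ^+ 2)); first by ring.
by move=> j ji; rewrite !mxE (negbTE ji) andbF mulr0 addr0.
Qed.

Lemma hardy_field_norm i x : `|hardy_field i x| <= 1.
Proof.
rewrite normrM normfV (gtr0_norm (sqn1_gt0 x)) ler_pdivrMr ?sqn1_gt0// mul1r.
have := coord_sq_le x i; rewrite -real_normK ?num_real//.
set y := `|_|; move=> h; nra.
Qed.

Lemma hardy_field_partial_norm i x : `|hardy_field_partial i x| <= 1.
Proof.
have s1 := sqn1_gt0 x; have s0 := sqn_ge0 x.
rewrite normrM normfV (gtr0_norm (x := (1 + sqn x) ^+ 2)) ?exprn_gt0//.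
rewrite ler_pdivrMr ?exprn_gt0// mul1r ler_norml.
have := coord_sq_le x i; have := sqr_ge0 (x ord0 i).
by move=> h1 h2; apply/andP; split; nra.
Qed.

Lemma hardy_field_increment i x (t : R) :
  hardy_field i (x + t *: e i) - hardy_field i x =
  t * ((1 + sqn x - 2 * x ord0 i ^+ 2 - t * x ord0 i) /
      ((1 + sqn x) * (1 + sqn (x + t *: e i)))).
Proof.
rewrite /hardy_field; have := sqn1_neq0 x; have := sqn1_neq0 (x + t *: e i).
rewrite sqn_shift !mxE !eqxx/= mulr1 => h1 h2; field.
by rewrite h1 h2.
Qed.

Lemma hardy_field_lipschitz i x (t : R) :
  `|hardy_field i (x + t *: e i) - hardy_field i x| <= `|t|.
Proof.
rewrite hardy_field_increment normrM ler_piMr//.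
rewrite normrM normfV [X in _ / X]gtr0_norm; last by rewrite mulr_gt0// sqn1_gt0.
rewrite ler_pdivrMr ?mulr_gt0 ?sqn1_gt0// mul1r sqn_shift.
have := coord_sq_le x i; set s := sqn x; set y := x ord0 i => ys.
have s0 : 0 <= s := sqn_ge0 x.
pose c := 1 + s - y ^+ 2; pose w := y + t.
have c1 : 1 <= c by rewrite /c; lra.
have -> : 1 + s - 2 * y ^+ 2 - t * y = c - y * w by rewrite /c /w; ring.
have -> : (1 + s) * (1 + (s + 2 * t * y + t ^+ 2)) = (c + y ^+ 2) * (c + w ^+ 2).
  by rewrite /c /w; ring.
have y2 := sqr_ge0 y; have w2 := sqr_ge0 w.
have h1 := sqr_ge0 (y - w); have h2 := sqr_ge0 (y + w).
have p1 : 0 <= (c - 1) * c by rewrite mulr_ge0; lra.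
have p2 : 0 <= (c - 1) * y ^+ 2 by rewrite mulr_ge0//; lra.
have p3 : 0 <= (c - 1) * w ^+ 2 by rewrite mulr_ge0//; lra.
have p4 : 0 <= y ^+ 2 * w ^+ 2 by rewrite mulr_ge0.
rewrite ler_norml; apply/andP; split; nra.
Qed.

Lemma L1_mul_bounded (w a : 'rV[R]_n -> R) (C : R) : L1 leb w ->
  measurable_fun setT a -> (forall x, `|a x| <= C) ->
  L1 leb (fun x => w x * a x).
Proof.
move=> Lw ma aC; apply: (@L1_le _ _ _ leb _ (fun x => C * `|w x|)).
- by apply: measurable_funM => //; exact: L1_measurable Lw.
- by move=> x; rewrite normrM mulrC ler_wpM2r.
- by apply: L1Z; exact: L1_norm.
Qed.

Lemma L1_sqn1V (w : 'rV[R]_n -> R) : L1 leb w -> L1 leb (fun x => w x / (1 + sqn x)).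
Proof.
move=> Lw; apply: (L1_mul_bounded Lw (C := 1)).
  exact: continuous_measurable_rV continuous_sqn1V.
move=> x; rewrite ger0_norm ?invr_ge0 ?(ltW (sqn1_gt0 _))//.
by rewrite invf_le1 ?sqn1_gt0// lerDl sqn_ge0.
Qed.

Lemma hardy_field_cvg i x :
  (fun k : nat => (hardy_field i (x + (- k.+1%:R^-1) *: e i) - hardy_field i x) *
     k.+1%:R) @ \oo --> - hardy_field_partial i x.
Proof.
pose G (t : R) : R := - ((1 + sqn x - 2 * x ord0 i ^+ 2 - t * x ord0 i) *
  ((1 + sqn x)^-1 * (1 + (sqn x + 2 * t * x ord0 i + t ^+ 2))^-1)).
rewrite (_ : (fun k => _) = (fun k : nat => G (- k.+1%:R^-1))); last first.
  apply/funext => k; rewrite hardy_field_increment /G sqn_shift invfM.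
  by rewrite mulrAC mulNr mulVf ?mulN1r// pnatr_eq0.
have -> : - hardy_field_partial i x = G 0.
  rewrite /G /hardy_field_partial; congr (- _).
  by rewrite mul0r subr0 mulr0 mul0r expr0n/= !addr0 -invfM -expr2.
have cG : {for 0, continuous G}.
  rewrite /G; apply: continuousN; apply: continuousM.
    apply: continuousB; first exact: cst_continuous.
    by apply: continuousM => //; exact: cst_continuous.
  apply: continuousM; first exact: cst_continuous.
  apply: continuousV.
    by rewrite mulr0 mul0r expr0n/= !addr0 sqn1_neq0.
  apply: continuousD; first exact: cst_continuous.
  apply: continuousD; last by apply: exprn_continuous.
  apply: continuousD; first exact: cst_continuous.
  apply: continuousM; last exact: cst_continuous.
  by apply: continuousM => //; exact: cst_continuous.
have u0 : (fun k : nat => - k.+1%:R^-1 : R) @ \oo --> (0 : R).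
  by rewrite -[X in _ --> X]oppr0; apply: cvgN; exact: cvg_harmonic.
exact: (cvg_comp _ _ u0 cG).
Qed.

(** One coordinate direction: expand the square of [D z / h + b a z], where
    [D z] is the increment of [z] by [h]. Since [2 z D z = D (z ^ 2) - (D z) ^ 2],
    only [z ^ 2] is ever differenced against the smooth field [a], so no chain
    rule for weak derivatives is needed. *)
Lemma hardy_direction z i g (b : R) : 0 <= b -> locally_L1 z ->
  L1 leb (fun x => z x ^+ 2) -> weak_partial z i g ->
  L1 leb (fun x => g x ^+ 2) ->
  b * \int[leb]_x (z x ^+ 2 * hardy_field_partial i x) -
  b ^+ 2 * \int[leb]_x (z x ^+ 2 * hardy_field i x ^+ 2) <=
  \int[leb]_x g x ^+ 2.
Proof.
move=> b0 Lz Lz2 wg Lg2.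
set A := \int[leb]_x (z x ^+ 2 * hardy_field_partial i x).
set B := \int[leb]_x (z x ^+ 2 * hardy_field i x ^+ 2).
set G := \int[leb]_x g x ^+ 2.
have mz := locally_L1_measurable Lz.
have ma := measurable_hardy_field i.
pose h (k : nat) : R := k.+1%:R^-1.
have h0 k : 0 < h k by rewrite invr_gt0.
pose F k x := z x ^+ 2 *
  ((hardy_field i (x + (- h k) *: e i) - hardy_field i x) * k.+1%:R).
have mash t : measurable_fun setT (fun x : 'rV[R]_n => hardy_field i (x + t *: e i)).
  by apply: (measurableT_comp ma); exact: measurable_add.
have mF k : measurable_fun setT (F k).
  apply: measurable_funM; first exact: measurable_funX.
  by apply: measurable_funM => //; apply: measurable_funB.
have FA : (fun k => \int[leb]_x F k x) @ \oo --> - A.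
  rewrite (_ : - A = \int[leb]_x (z x ^+ 2 * - hardy_field_partial i x)); last first.
    rewrite -mulN1r -RintegralZl//; first by apply: eq_Rintegral => x _; ring.
    apply: (L1_mul_bounded (C := 1)) => //; last exact: hardy_field_partial_norm.
    exact: measurable_hardy_field_partial.
  apply: (@Rintegral_dominated _ _ _ leb _ _ (fun x => z x ^+ 2)) => //.
  - apply: measurable_funM; first exact: measurable_funX.
    by apply: measurableT_comp => //; exact: measurable_hardy_field_partial.
  - by move=> x; apply: cvgM; [exact: cvg_cst|exact: hardy_field_cvg].
  - move=> k x; rewrite normrM ger0_norm ?sqr_ge0// ler_piMr ?sqr_ge0//.
    rewrite normrM (ger0_norm (x := k.+1%:R))// -ler_pdivlMr// mul1r.
    by rewrite (le_trans (hardy_field_lipschitz _ _ _))// normrN ger0_norm// ltW.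
have key k : 0 <= (1 + b * h k) * G + b * \int[leb]_x F k x + b ^+ 2 * B.
  have [LD ID] := difference_quotient_le Lz wg Lg2 (h0 k).
  pose D x := z (x + h k *: e i) - z x.
  have Lza : L1 leb (fun x => z x ^+ 2 * hardy_field i x ^+ 2).
    apply: (L1_mul_bounded (C := 1)) => //; first exact: measurable_funX.
    move=> x; rewrite normrX -(expr1n _ 2) lerXn2r ?nnegrE ?ler01//.
    exact: hardy_field_norm.
  have Lz2s : L1 leb (fun x => z (x + h k *: e i) ^+ 2).
    exact: (L1_shift i (h k) Lz2).
  have L3 : L1 leb (fun x => z (x + h k *: e i) ^+ 2 * hardy_field i x).
    by apply: (L1_mul_bounded (C := 1)) => //; exact: hardy_field_norm.
  have L4 : L1 leb (fun x => z x ^+ 2 * hardy_field i x).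
    by apply: (L1_mul_bounded (C := 1)) => //; exact: hardy_field_norm.
  have L5 : L1 leb (fun x => z x ^+ 2 * hardy_field i (x + (- h k) *: e i)).
    by apply: (L1_mul_bounded (C := 1)) => // x; exact: hardy_field_norm.
  have E5 : \int[leb]_x (z (x + h k *: e i) ^+ 2 * hardy_field i x) =
      \int[leb]_x (z x ^+ 2 * hardy_field i (x + (- h k) *: e i)).
    rewrite -(Rintegral_shift i (h k) (L1_measurable L5)).
    by apply: eq_Rintegral => x _; rewrite scaleNr addrK.
  have EF : \int[leb]_x F k x = (\int[leb]_x (z (x + h k *: e i) ^+ 2 * hardy_field i x) -
      \int[leb]_x (z x ^+ 2 * hardy_field i x)) * k.+1%:R.
    rewrite E5 -RintegralB// mulrC -RintegralZl//; last exact: L1B.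
    by apply: eq_Rintegral => x _; rewrite /F; ring.
  rewrite EF.
  apply: (@le_trans _ _ ((1 + b * h k) * (k.+1%:R ^+ 2 * \int[leb]_x D x ^+ 2) +
    b * ((\int[leb]_x (z (x + h k *: e i) ^+ 2 * hardy_field i x) -
      \int[leb]_x (z x ^+ 2 * hardy_field i x)) * k.+1%:R) + b ^+ 2 * B)); last first.
    rewrite !lerD2r ler_wpM2l//; first by rewrite addr_ge0// mulr_ge0// ltW.
    have hk1 : k.+1%:R ^+ 2 * h k ^+ 2 = 1 :> R.
      by rewrite -exprMn mulfV ?expr1n// pnatr_eq0.
    by rewrite (le_trans (ler_wpM2l _ ID)) ?sqr_ge0// mulrA hk1 mul1r.
  pose c1 := (1 + b * h k) * k.+1%:R ^+ 2; pose c2 := b * k.+1%:R.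
  have L6 := L1B L3 L4.
  rewrite (_ : _ + _ + _ = \int[leb]_x (c1 * D x ^+ 2 + c2 *
      (z (x + h k *: e i) ^+ 2 * hardy_field i x - z x ^+ 2 * hardy_field i x) +
      b ^+ 2 * (z x ^+ 2 * hardy_field i x ^+ 2))); last first.
    rewrite RintegralD//; [|by apply: L1D; exact: L1Z|exact: L1Z].
    rewrite RintegralD//; [|exact: L1Z|exact: L1Z].
    rewrite !RintegralZl// RintegralB//; rewrite /c1 /c2 /B; ring.
  apply: Rintegral_ge0 => x _; rewrite /D /c1 /c2.
  have hk : h k * k.+1%:R = 1 by rewrite /h mulVf// pnatr_eq0.
  have := hardy_field_norm i x; rewrite ler_norml => /andP[a1 _].
  set w := z (x + _); set y := z x; set a := hardy_field i x in a1 *.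
  set m := k.+1%:R : R.
  (* the last term compensates that the two squares sit at different points *)
  rewrite (_ : _ + _ + _ = (m * (w - y) + b * y * a) ^+ 2 +
     b * m * (w - y) ^+ 2 * (h k * m + a)); last by ring.
  rewrite hk addr_ge0 ?sqr_ge0// mulr_ge0//; last by move: a1; lra.
  by rewrite mulr_ge0 ?sqr_ge0// mulr_ge0.
have lim : (fun k => (1 + b * h k) * G + b * \int[leb]_x F k x + b ^+ 2 * B) @ \oo -->
    (1 + b * 0) * G + b * (- A) + b ^+ 2 * B.
  apply: cvgD; last exact: cvg_cst.
  apply: cvgD; last by apply: cvgM => //; exact: cvg_cst.
  apply: cvgM; last exact: cvg_cst.
  apply: cvgD; first exact: cvg_cst.
  by apply: cvgM; [exact: cvg_cst|exact: cvg_harmonic].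
have : 0 <= (1 + b * 0) * G + b * (- A) + b ^+ 2 * B.
  rewrite -(cvg_lim _ lim)//; apply: limr_ge; first by apply/cvg_ex; eexists; exact: lim.
  by apply: nearW => k; exact: key.
lra.
Qed.

(** Sum [hardy_direction] over the coordinates with [b = (n - 2) / 2]: the
    divergence of the field dominates [b] times its square by [b / (1 + |x|^2)]. *)
Lemma hardy_inequality z (g : 'I_n -> 'rV[R]_n -> R) : (2 <= n)%N ->
  locally_L1 z -> L1 leb (fun x => z x ^+ 2) ->
  (forall i, weak_partial z i (g i)) -> (forall i, L1 leb (fun x => g i x ^+ 2)) ->
  ((n%:R - 2) / 2) ^+ 2 * \int[leb]_x (z x ^+ 2 / (1 + sqn x)) <=
  \sum_(i < n) \int[leb]_x g i x ^+ 2.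
Proof.
move=> n2 Lz Lz2 wg Lg2; set b : R := (n%:R - 2) / 2.
have b0 : 0 <= b by rewrite divr_ge0// subr_ge0 ler_nat.
have mz := locally_L1_measurable Lz.
have LA i : L1 leb (fun x => z x ^+ 2 * hardy_field_partial i x).
  apply: (L1_mul_bounded (C := 1)) => //; last exact: hardy_field_partial_norm.
  exact: measurable_hardy_field_partial.
have LB i : L1 leb (fun x => z x ^+ 2 * hardy_field i x ^+ 2).
  apply: (L1_mul_bounded (C := 1)) => //.
    by apply: measurable_funX; exact: measurable_hardy_field.
  move=> x; rewrite normrX -(expr1n _ 2) lerXn2r ?nnegrE ?ler01//.
  exact: hardy_field_norm.
have LAB i : L1 leb (fun x => b * (z x ^+ 2 * hardy_field_partial i x) -
    b ^+ 2 * (z x ^+ 2 * hardy_field i x ^+ 2)).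
  by apply: L1B; exact: L1Z.
have LH : L1 leb (fun x => z x ^+ 2 / (1 + sqn x)) by exact: L1_sqn1V.
apply: (@le_trans _ _ (\sum_(i < n) (b * \int[leb]_x (z x ^+ 2 * hardy_field_partial i x) -
  b ^+ 2 * \int[leb]_x (z x ^+ 2 * hardy_field i x ^+ 2)))); last first.
  by apply: ler_sum => i _; exact: hardy_direction.
rewrite (eq_bigr (fun i => \int[leb]_x (b * (z x ^+ 2 * hardy_field_partial i x) -
    b ^+ 2 * (z x ^+ 2 * hardy_field i x ^+ 2)))); last first.
  move=> i _; rewrite (RintegralB measurableT (L1Z b (LA i)) (L1Z (b ^+ 2) (LB i))).
  by rewrite (RintegralZl b measurableT (LA i)) (RintegralZl (b ^+ 2) measurableT (LB i)).
rewrite -Rintegral_sum// -RintegralZl//.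
apply: le_Rintegral => //; [exact: L1Z|exact: L1_sum|move=> x _].
have s1 := sqn1_gt0 x; have s0 := sqn_ge0 x.
rewrite (eq_bigr (fun i => z x ^+ 2 / (1 + sqn x) ^+ 2 *
   (b * (1 + sqn x) - (2 * b + b ^+ 2) * x ord0 i ^+ 2))); last first.
  by move=> i _; rewrite /hardy_field_partial /hardy_field; field; exact: sqn1_neq0.
rewrite -mulr_sumr sumrB sumr_const card_ord -mulr_sumr -/(sqn x).
have E : z x ^+ 2 / (1 + sqn x) = z x ^+ 2 / (1 + sqn x) ^+ 2 * (1 + sqn x).
  by field; exact: sqn1_neq0.
rewrite E mulrCA ler_wpM2l ?divr_ge0 ?sqr_ge0//.
have nE (y : R) : y *+ n = y * (2 * b + 2).
  by rewrite -(mulr_natr y n) /b; field.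
rewrite nE.
set s := sqn x in s0 s1 *; nra.
Qed.

End hardy.

(** * First variation of the penalized functional *)

Section lower_integral.
Context d (T : measurableType d) (R : realType).
Variable mu : {measure set T -> \bar R}.
Local Open Scope ereal_scope.
Import HBNNSimple.

(** The integral of a nonnegative function is a supremum over simple functions,
    hence monotone whether or not the function is measurable. *)
Lemma le_integral_nonmeasurable (F G : T -> \bar R) : (forall x, 0 <= F x) ->
  (forall x, F x <= G x) -> \int[mu]_x F x <= \int[mu]_x G x.
Proof.
move=> F0 FG; rewrite !ge0_integralTE//; last by move=> x; exact: le_trans (FG x).
apply: le_ereal_sup => _ [h hF <-]; exists h => // x.
exact: le_trans (hF x) (FG x).
Qed.

(** The primitive of the penalized nonlinearity, composed with [u], comes
    without a measurability hypothesis; only the dominating function has one. *)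
Lemma le_integralD_nonmeasurable (F : T -> \bar R) (B : T -> R) :
  (forall x, 0 <= F x) -> measurable_fun setT B -> (forall x, 0 <= B x)%R ->
  \int[mu]_x (F x + (B x)%:E) <= \int[mu]_x F x + \int[mu]_x (B x)%:E.
Proof.
move=> F0 mB B0; rewrite [leLHS]ge0_integralTE; last first.
  by move=> x; rewrite adde_ge0// lee_fin.
apply: ub_ereal_sup => _ [h hF <-].
rewrite -integralT_nnsfun.
pose k x := Num.max (h x - B x)%R 0%R.
have mk : measurable_fun setT k.
  by apply: measurable_maxr => //; apply: measurable_funB.
apply: (@le_trans _ _ (\int[mu]_x ((k x)%:E + (B x)%:E))).
  apply: ge0_le_integral => //.
  - by move=> x _; rewrite lee_fin.
  - exact/measurable_EFinP.
  - by apply: emeasurable_funD; exact/measurable_EFinP.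
  - by move=> x _; rewrite -EFinD lee_fin -lerBlDr le_max lexx.
rewrite ge0_integralD//; last 4 first.
- by move=> x _; rewrite lee_fin le_max lexx orbT.
- exact/measurable_EFinP.
- by move=> x _; rewrite lee_fin.
- exact/measurable_EFinP.
apply: leeD => //; apply: le_integral_nonmeasurable => x.
  by rewrite lee_fin le_max lexx orbT.
by rewrite /k EFin_max ge_max F0 andbT EFinB leeBlDr.
Qed.

(** The real-valued integral is 0 when the integral diverges, so a one-sided
    bound on the integrand still gives a one-sided bound on the integral. *)
Lemma Rintegral_increment_le (F0 F1 B : T -> R) : L1 mu B ->
  (forall x, 0 <= B x)%R ->
  (forall x, F0 x = F1 x \/ (0 <= F0 x)%R) ->
  (forall x, F0 x <= F1 x <= F0 x + B x)%R ->
  (Rintegral mu setT F1 <= Rintegral mu setT F0 + Rintegral mu setT B)%R.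
Proof.
move=> LB B0 Fp F01; have mB := L1_measurable LB.
have FnE : (EFin \o F1)^\- = (EFin \o F0)^\-.
  apply/funext => x; rewrite !unlock /=; have [->//|F00] := Fp x.
  have /andP[h _] := F01 x.
  by rewrite !max_r// lee_fin oppr_le0// (le_trans F00).
rewrite /Rintegral [in leLHS]integralE [X in (_ <= fine X + _)%R]integralE.
rewrite -!/(EFin \o _) FnE.
set D := \int[mu]_x (EFin \o F0)^\- x.
set a0 := \int[mu]_x (EFin \o F0)^\+ x; set a1 := \int[mu]_x (EFin \o F1)^\+ x.
have h01 : a0 <= a1.
  apply: le_integral_nonmeasurable => x; first exact: funepos_ge0.
  rewrite !unlock /= ge_max !le_max lexx orbT andbT lee_fin.
  by have /andP[-> _] := F01 x.
have h1 : a1 <= a0 + \int[mu]_x (B x)%:E.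
  apply: le_trans (le_integralD_nonmeasurable _ mB B0); last by move=> x; exact: funepos_ge0.
  apply: le_integral_nonmeasurable => x; first exact: funepos_ge0.
  rewrite !unlock /= ge_max; apply/andP; split.
    have /andP[_ h] := F01 x; apply: (@le_trans _ _ ((F0 x)%:E + (B x)%:E)).
      by rewrite -EFinD lee_fin.
    by rewrite leeD2r// le_max lexx.
  by rewrite adde_ge0// ?lee_fin// le_max lexx orbT.
have D0 : 0 <= D by apply: integral_ge0 => x _; exact: funeneg_ge0.
have a00 : 0 <= a0 by apply: integral_ge0 => x _; exact: funepos_ge0.
have IB := L1_fin_num LB.
have IB0 : (0 <= fine (\int[mu]_x (B x)%:E))%R.
  by apply: fine_ge0; apply: integral_ge0 => x _; rewrite lee_fin.
move: IB IB0 h1; case: (\int[mu]_x (B x)%:E) => [b| |]//= _ b0.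
move: D0 a00 h01; case: D => [D| |]//; last first.
  move=> _ _ _ _; case: a0 => [a0| |]; case: a1 => [a1| |] //=;
  by rewrite add0r.
case: a0 => [a0| |]//; case: a1 => [a1| |]//= _ _.
  by rewrite !lee_fin => _; lra.
by rewrite add0r.
Qed.

End lower_integral.

Section one_sided_derivative.
Context (R : realType).

Lemma is_derive_lower_bound (J : R -> R) (l a b : R) :
  is_derive (0 : R) (1 : R) J l ->
  (forall t, 0 < t -> a * t + b * t ^+ 2 <= J t - J 0) -> a <= l.
Proof.
move=> [dJ <-] Jab.
have cv : (fun h : R => h^-1 *: (J (h *: 1 + 0) - J 0)) @ 0^'+ --> 'D_1 J 0.
  exact: (cvg_dnbhs_at_right dJ).
have ca : (fun h : R => a + b * h) @ 0^'+ --> a.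
  rewrite -[X in _ --> X]addr0 -[X in _ + X](mulr0 b).
  apply: cvgD; first exact: cvg_cst.
  apply: cvgM; first exact: cvg_cst.
  by apply: cvg_at_right_filter; exact: cvg_id.
apply: (ler_cvg_to ca cv); near=> h.
have h0 : 0 < h by [].
rewrite addr0 [h *: 1]mulr1 -[_ *: _]/(_ * _) ler_pdivlMl//.
by apply: le_trans (Jab h h0); rewrite le_eqVlt; apply/orP; left; apply/eqP; ring.
Unshelve. all: by end_near. Qed.

End one_sided_derivative.

Section primitives.
Context (R : realType).
Implicit Types (g : R -> R).

Lemma lebesgue_itv_lty (a b : R) (x y : bool) :
  (@lebesgue_measure R [set` Interval (BSide x a) (BSide y b)] < +oo)%E.
Proof.
by rewrite lebesgue_measure_itv/=; case: ifP => _; rewrite ?ltry// -EFinB ltry.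
Qed.

Lemma primitive_lt0 g s : s < 0 -> primitive g s = 0.
Proof.
move=> s0; rewrite /primitive (_ : `[0, s]%classic = set0).
  by rewrite Rintegral_set0.
apply/seteqP; split=> // t /=; rewrite in_itv/= => /andP[t0 ts].
by move: (le_trans t0 ts); rewrite leNgt s0.
Qed.

Lemma primitive_ge0 g s : (forall t, 0 <= t -> 0 <= g t) -> 0 <= primitive g s.
Proof.
by move=> g0; apply: Rintegral_ge0 => t /=; rewrite in_itv/= => /andP[/g0].
Qed.

Lemma primitive_increment g (a b M : R) : 0 <= a -> a <= b ->
  measurable_fun `[0, b] g -> (forall s, 0 <= s <= b -> 0 <= g s <= M) ->
  primitive g a <= primitive g b <= primitive g a + M * (b - a).
Proof.
move=> a0 ab mg gM; rewrite /primitive.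
have Lg : (@lebesgue_measure R).-integrable `[0, b] (EFin \o g).
  apply: measurable_bounded_integrable => //.
  - exact: lebesgue_itv_lty.
  - exists M; split; first exact: num_real.
    move=> y My s /=; rewrite in_itv/= => /gM /andP[g0 gs].
    by rewrite ger0_norm// (le_trans gs)// ltW.
have := @Rintegral_itvB _ _ (BLeft 0) (BRight b) a Lg.
rewrite !bnd_simp => /(_ a0 ab) E.
have Lab : (@lebesgue_measure R).-integrable `]a, b] (EFin \o g).
  apply: integrableS Lg => //; apply: subset_itvr.
  by rewrite bnd_simp.
have h0 : 0 <= \int[@lebesgue_measure R]_(s in `]a, b]) g s.
  apply: Rintegral_ge0 => s /=; rewrite in_itv/= => /andP[as_ sb].
  have sb' : 0 <= s <= b by rewrite sb andbT (le_trans a0)// ltW.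
  by have /andP[] := gM s sb'.
have h1 : \int[@lebesgue_measure R]_(s in `]a, b]) g s <= M * (b - a).
  have mab : fine (@lebesgue_measure R `]a, b]) = b - a.
    rewrite lebesgue_measure_itv/= lte_fin; case: ltP => //= ba.
    by apply/esym/eqP; rewrite subr_eq0 eq_le ab ba.
  rewrite -mab -Rintegral_cst//; apply: le_Rintegral => //.
    apply: measurable_bounded_integrable => //; first exact: lebesgue_itv_lty.
    exists `|M|; split; first exact: num_real.
    by move=> y My s _; rewrite ltW.
  move=> s /=; rewrite in_itv/= => /andP[as_ sb].
  have sb' : 0 <= s <= b by rewrite sb andbT (le_trans a0)// ltW.
  by have /andP[] := gM s sb'.
by move: h0 h1; rewrite -E; lra.
Qed.

End primitives.

Section first_variation.
Context (R : realType) (N : nat).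
Implicit Types (V K h u p : 'rV[R]_N -> R) (Lam : set 'rV[R]_N).
Local Notation leb := (lebesgue_rV R N).

Lemma penalized_primitive_increment V K (f : R -> R) Lam h (mu eps : R) x (a b : R) :
  {within `[0, +oo[, continuous f} -> (forall s, 0 <= s -> 0 <= f s) ->
  ~ Lam x -> 0 <= K x -> 0 <= eps ^+ 2 * h x + mu * V x -> 0 <= a -> a <= b ->
  penalized_primitive V K f Lam h mu eps x a <=
  penalized_primitive V K f Lam h mu eps x b <=
  penalized_primitive V K f Lam h mu eps x a +
    (eps ^+ 2 * h x + mu * V x) * b * (b - a).
Proof.
move=> cf f0 Lamx K0 c0 a0 ab; set c := _ + _ in c0 *.
have gE s : 0 <= s -> penalized_nonlinearity V K f Lam h mu eps x s =
    Num.min (c * s) (K x * f s).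
  move=> s0; rewrite /penalized_nonlinearity ltNge s0/= indicE memNset//=.
  by rewrite mul0r subr0 mul1r add0r.
apply: primitive_increment => //.
- apply: (eq_measurable_fun (fun s => Num.min (c * s) (K x * f s))).
    by move=> s; rewrite inE/= in_itv/= => /andP[s0 _]; rewrite gE.
  apply: measurable_minr; first by apply: measurable_funM.
  apply: measurable_funM => //.
  have mf : measurable_fun (`[0, +oo[%classic : set R) f.
    exact: subspace_continuous_measurable_fun.
  apply: measurable_funS mf => // s /=; rewrite !in_itv/= => /andP[-> _] //.
- move=> s /andP[s0 sb]; rewrite gE//; apply/andP; split.
    by rewrite le_min !mulr_ge0// f0.
  by apply: (@le_trans _ _ (c * s)); [rewrite ge_min lexx | rewrite ler_wpM2l].
Qed.

Lemma penalized_primitive_ge0 V K (f : R -> R) Lam h (mu eps : R) x (a : R) :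
  (forall s, 0 <= s -> 0 <= f s) -> 0 <= K x ->
  0 <= eps ^+ 2 * h x + mu * V x ->
  0 <= penalized_primitive V K f Lam h mu eps x a.
Proof.
move=> f0 K0 c0; apply: primitive_ge0 => s s0.
rewrite /penalized_nonlinearity ltNge s0/=.
apply: addr_ge0; first by rewrite indicE mulr_ge0// mulr_ge0// f0.
apply: mulr_ge0; first by rewrite indicE subr_ge0 lern1 leq_b1.
by rewrite le_min !mulr_ge0// f0.
Qed.

(** The quadratic part of the functional along a line, in terms of any
    representative [G] of the weak gradient of the direction. *)
Lemma norm_sq_line V eps (t : R) u v (G : 'I_N -> 'rV[R]_N -> R) :
  let a0 x := \sum_(i < N) (eps ^+ 2 * weak_grad u i x ^+ 2) + V x * u x ^+ 2 in
  let a1 x := \sum_(i < N) (eps ^+ 2 * (weak_grad u i x * G i x)) + V x * (u x * v x) in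
  let a2 x := \sum_(i < N) (eps ^+ 2 * G i x ^+ 2) + V x * v x ^+ 2 in
  measurable_fun setT V -> weakly_differentiable u -> weakly_differentiable v ->
  (forall i, {ae leb, forall x, weak_grad v i x = G i x}) ->
  L1 leb a0 -> L1 leb a1 -> L1 leb a2 ->
  norm_sq eps V (fun x => u x + t * v x) =
   (\int[leb]_x a0 x + t * (2 * \int[leb]_x a1 x) + t ^+ 2 * \int[leb]_x a2 x)%:E.
Proof.
move=> a0 a1 a2 mV wu wv gG La0 La1 La2; pose w x := u x + t * v x.
have wgw : {ae leb, forall x, forall i,
    weak_grad w i x = weak_grad u i x + t * G i x}.
  apply: ae_forall_ord => i; have := weak_gradD t i wu wv.
  by have := gG i; apply: filterS2 => x E1 ->; rewrite E1.
have L21 := L1Z 2 La1; have Lt1 := L1Z t L21; have Lt2 := L1Z (t ^+ 2) La2.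
have Lsum := L1D (L1D La0 Lt1) Lt2.
have ww : weakly_differentiable w by exact: weakly_differentiableD.
transitivity (\int[leb]_x (a0 x + t * (2 * a1 x) + t ^+ 2 * a2 x)%:E)%E.
  rewrite /norm_sq; apply: ae_eq_integral => //.
  - apply/measurable_EFinP; apply: measurable_funD.
      apply: measurable_funM => //; apply: measurable_sum => i.
      by apply: measurable_funX; exact: weak_grad_measurable.
    apply: measurable_funM => //; apply: measurable_funX.
    by apply: locally_L1_measurable; case: ww.
  - by apply/measurable_EFinP; exact: L1_measurable Lsum.
  - apply: filterS wgw => x wgx _; congr EFin.
    rewrite /weak_grad_sq (eq_bigr (fun i => (weak_grad u i x + t * G i x) ^+ 2)); last first.
      by move=> i _; rewrite wgx.
    have -> : eps ^+ 2 * \sum_(i < N) (weak_grad u i x + t * G i x) ^+ 2 =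
        \sum_(i < N) (eps ^+ 2 * weak_grad u i x ^+ 2) +
        t * (2 * \sum_(i < N) (eps ^+ 2 * (weak_grad u i x * G i x))) +
        t ^+ 2 * \sum_(i < N) (eps ^+ 2 * G i x ^+ 2).
      by rewrite !mulr_sumr -!big_split/=; apply: eq_bigr => i _; ring.
    by rewrite /a0 /a1 /a2; ring.
rewrite (RintegralE Lsum) (RintegralD measurableT (L1D La0 Lt1) Lt2).
rewrite (RintegralD measurableT La0 Lt1) (RintegralZl _ measurableT La2).
by rewrite (RintegralZl _ measurableT L21) (RintegralZl _ measurableT La1).
Qed.

(** Off [Lam] the penalized nonlinearity is at most [c s], with
    [c = eps ^ 2 h + mu V], and [u] grows from [u x] to [(1 + t p x) u x] where it
    is positive. *)
Lemma penalized_integral_increment V K (f : R -> R) Lam h (mu eps t : R) u p :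
  let c x := eps ^+ 2 * h x + mu * V x in
  let b1 x := c x * (p x * u x ^+ 2) in
  let b2 x := c x * (p x * u x) ^+ 2 in
  let P v x := penalized_primitive V K f Lam h mu eps x (v x) in
  {within `[0, +oo[, continuous f} -> (forall s, 0 <= s -> 0 <= f s) ->
  (forall x, 0 <= p x) ->
  (forall x, p x = 0 \/ [/\ ~ Lam x, 0 <= K x & 0 <= c x]) ->
  L1 leb b1 -> L1 leb b2 -> 0 < t ->
  \int[leb]_x P (fun x => u x + t * (p x * u x)) x <=
  \int[leb]_x P u x + (t * \int[leb]_x b1 x + t ^+ 2 * \int[leb]_x b2 x).
Proof.
move=> c b1 b2 P cf f0 p0 cases Lb1 Lb2 t0.
pose w x := u x + t * (p x * u x); have Lt1 := L1Z t Lb1; have Lt2 := L1Z (t ^+ 2) Lb2.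
rewrite -(RintegralZl t measurableT Lb1) -(RintegralZl (t ^+ 2) measurableT Lb2).
rewrite -(RintegralD measurableT Lt1 Lt2).
have b1p x : 0 <= b1 x.
  rewrite /b1; have [->|[_ _ cx]] := cases x; first by rewrite mul0r mulr0.
  by rewrite mulr_ge0// mulr_ge0// sqr_ge0.
have b2p x : 0 <= b2 x.
  rewrite /b2; have [->|[_ _ cx]] := cases x; first by rewrite mul0r expr0n mulr0.
  by rewrite mulr_ge0// sqr_ge0.
have bp x : 0 <= t * b1 x + t ^+ 2 * b2 x.
  by rewrite addr_ge0// mulr_ge0// ?(ltW t0)// exprn_ge0// ltW.
apply: (@Rintegral_increment_le _ _ _ leb (P u) (P w)) => //.
- exact: L1D.
- move=> x; rewrite /P; have [px|[_ Kx cx]] := cases x.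
    by left; rewrite /w px mul0r mulr0 addr0.
  by right; exact: penalized_primitive_ge0.
- move=> x; rewrite /P; have [px|[nLx Kx cx]] := cases x.
    have -> : w x = u x by rewrite /w px mul0r mulr0 addr0.
    by rewrite lexx lerDl bp.
  have tp0 : 0 < 1 + t * p x by rewrite ltr_wpDr// mulr_ge0// ltW.
  have wE : w x = (1 + t * p x) * u x by rewrite /w; ring.
  have [u0|u0] := ltP (u x) 0.
    have wn : w x < 0 by rewrite wE pmulr_rlt0.
    rewrite /penalized_primitive (primitive_lt0 _ wn) (primitive_lt0 _ u0).
    by rewrite lexx add0r bp.
  have uw : u x <= w x by rewrite /w lerDl !mulr_ge0// ltW.
  have := @penalized_primitive_increment V K f Lam h mu eps x (u x) (w x)
    cf f0 nLx Kx cx u0 uw.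
  rewrite (_ : (eps ^+ 2 * h x + mu * V x) * w x * (w x - u x) =
    t * b1 x + t ^+ 2 * b2 x)//.
  by rewrite /b1 /b2 /w /c; ring.
Qed.

(** Testing the penalized functional at [u] with [p u], where the penalized
    nonlinearity is at most [(eps ^ 2 h + mu V) s] on the support of [p]. The
    quadratic part of the functional has a derivative in the direction [p u];
    the nonlinear part is bounded through its increments for positive [t], so
    that it need not be differentiated under the integral. *)
Lemma first_variation V K (f : R -> R) Lam h (mu eps : R) u p (S : set 'rV[R]_N) (C : R) :
  {within `[0, +oo[, continuous f} -> (forall s, 0 <= s -> 0 <= f s) ->
  measurable_fun setT V -> measurable_fun setT h ->
  weakly_differentiable u -> (forall i, L1 leb (fun x => weak_grad u i x ^+ 2)) ->
  L1 leb (fun x => V x * u x ^+ 2) ->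
  measurable S -> L1 leb (fun x => u x ^+ 2 * \1_S x) ->
  test_function p -> (forall x, 0 <= p x) ->
  (forall x, ~ S x -> p x = 0) ->
  (forall x i, ~ S x -> partial [:: i] p x = 0) ->
  (forall x, S x -> [/\ ~ Lam x, 0 <= K x, 0 <= V x & 0 <= h x <= C]) ->
  0 <= mu ->
  directional_derivative (penalized_functional V K f Lam h mu eps) u
    (fun x => p x * u x) 0 ->
  L1 leb (fun x => p x * V x * u x ^+ 2) /\
  \int[leb]_x (\sum_(i < N) (eps ^+ 2 * (weak_grad u i x *
        (p x * weak_grad u i x + partial [:: i] p x * u x))) +
    ((1 - mu) * V x - eps ^+ 2 * h x) * (p x * u x ^+ 2)) <= 0.
Proof.
move=> cf f0 mV mh wu Lg LV mS LS tp p0 pS dpS Sx mu0 dJ.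
have [sp _] := tp; have [Lu _] := wu; have muu := locally_L1_measurable Lu.
have [r [Cp [pC _]]] := test_bounded tp.
have mp := test_measurable tp.
have mg i : measurable_fun setT (weak_grad u i) by exact: weak_grad_measurable.
pose g i x := weak_grad u i x.
pose G i x := p x * g i x + partial [:: i] p x * u x.
have mdp i : measurable_fun setT (partial [:: i] p).
  by apply: test_measurable; exact: test_partial.
have mG i : measurable_fun setT (G i).
  by apply: measurable_funD; apply: measurable_funM.
have Lmul (a : 'rV[R]_N -> R) (A : R) : measurable_fun setT a ->
    (forall x, `|a x| <= A) -> (forall x, ~ S x -> a x = 0) ->
    L1 leb (fun x => a x * u x ^+ 2).
  move=> ma aA aS; apply: eq_integrable (L1_mul_bounded LS ma aA) => // x _ /=.
  congr EFin; rewrite indicE; case: (boolP (x \in S)) => [_|/negP xS].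
    by rewrite mulr1 mulrC.
  by rewrite aS ?mulr0 ?mul0r// => ?; apply: xS; rewrite inE.
have sq_le (y c : R) : `|y| <= c -> `|y ^+ 2| <= c ^+ 2.
  by move=> yc; rewrite normrX lerXn2r ?nnegrE ?(le_trans _ yc).
have Cp0 : 0 <= Cp by exact: le_trans (pC 0).
have hpC x : `|h x * p x| <= `|C| * Cp.
  have [Sx'|nSx] := pselect (S x); last first.
    by rewrite pS// mulr0 normr0 mulr_ge0.
  have [_ _ _ /andP[h0 hC]] := Sx x Sx'.
  by rewrite normrM ler_pM// ger0_norm// (le_trans hC)// ler_norm.
have mp2 : measurable_fun setT (fun x => p x ^+ 2) by exact: measurable_funX.
have Lpu : L1 leb (fun x => p x * u x ^+ 2) by apply: (Lmul _ Cp).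
have Lpu2 : L1 leb (fun x => (p x * u x) ^+ 2).
  under eq_fun do rewrite exprMn.
  apply: (Lmul _ (Cp ^+ 2)) => // [x|x /pS ->]; last by rewrite expr0n.
  exact: sq_le.
have Lhpu : L1 leb (fun x => h x * (p x * u x ^+ 2)).
  under eq_fun do rewrite mulrA.
  apply: (Lmul _ (`|C| * Cp)) => // [|x /pS ->]; last by rewrite mulr0.
  exact: measurable_funM.
have Lhppu : L1 leb (fun x => h x * (p x * u x) ^+ 2).
  under eq_fun do rewrite exprMn mulrA.
  apply: (Lmul _ (`|C| * Cp * Cp)) => // [|x|x /pS ->]; last by rewrite expr0n mulr0.
    exact: measurable_funM.
  by rewrite expr2 mulrA normrM ler_pM.
have Ldpu i : L1 leb (fun x => partial [:: i] p x ^+ 2 * u x ^+ 2).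
  have [rd [Cd [dpC _]]] := test_bounded (test_partial i tp).
  apply: (Lmul _ (Cd ^+ 2)) => [|x|x /dpS ->]; last by rewrite expr0n.
    exact: measurable_funX.
  exact: sq_le.
have Lpg i : L1 leb (fun x => g i x ^+ 2 * p x ^+ 2).
  by apply: (L1_mul_bounded (C := Cp ^+ 2)) => // x; exact: sq_le.
have LG i : L1 leb (fun x => G i x ^+ 2).
  apply: (@L1_le _ _ _ leb _ (fun x => 2 * (g i x ^+ 2 * p x ^+ 2) +
      2 * (partial [:: i] p x ^+ 2 * u x ^+ 2))).
  - exact: measurable_funX.
  - move=> x; rewrite ger0_norm ?sqr_ge0// /G.
    move: (partial [:: i] p x) (g i x) (u x) (p x) => d_ g_ u_ p_.
    have := sqr_ge0 (p_ * g_ - d_ * u_).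
    rewrite -!exprMn [g_ * p_]mulrC; set A := p_ * g_; set B := d_ * u_; nra.
  - by apply: L1D; exact: L1Z.
have LgG i : L1 leb (fun x => g i x * G i x).
  apply: (@L1_le _ _ _ leb _ (fun x => g i x ^+ 2 + G i x ^+ 2)).
  - exact: measurable_funM.
  - move=> x; rewrite normrM -(real_normK (num_real (g i x))) -(real_normK (num_real (G i x))).
    set A := `|g i x|; set B := `|G i x|.
    have := sqr_ge0 (A - B); have := sqr_ge0 A; have := sqr_ge0 B; nra.
  - by apply: L1D => //; exact: Lg.
have LpV : L1 leb (fun x => p x * V x * u x ^+ 2).
  have := L1_mul_bounded LV mp pC; apply: eq_integrable => // x _ /=.
  by congr EFin; ring.
have LppV : L1 leb (fun x => V x * (p x * u x) ^+ 2).
  have := L1_mul_bounded LV mp2 (fun x => sq_le _ _ (pC x)).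
  by apply: eq_integrable => // x _ /=; congr EFin; ring.
split => //.
pose a0 x := \sum_(i < N) (eps ^+ 2 * g i x ^+ 2) + V x * u x ^+ 2.
pose a1 x := \sum_(i < N) (eps ^+ 2 * (g i x * G i x)) + V x * (u x * (p x * u x)).
pose a2 x := \sum_(i < N) (eps ^+ 2 * G i x ^+ 2) + V x * (p x * u x) ^+ 2.
have La0 : L1 leb a0 by apply: L1D => //; apply: L1_sum => i; exact: L1Z.
have La1 : L1 leb a1.
  apply: L1D; first by apply: L1_sum => i; exact: L1Z.
  by move: LpV; apply: eq_integrable => // x _ /=; congr EFin; ring.
have La2 : L1 leb a2 by apply: L1D => //; apply: L1_sum => i; exact: L1Z.
pose w t x := u x + t * (p x * u x).
have wpu := weakly_differentiableM wu sp.
have normE t : norm_sq eps V (w t) =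
   (\int[leb]_x a0 x + t * (2 * \int[leb]_x a1 x) + t ^+ 2 * \int[leb]_x a2 x)%:E.
  by apply: norm_sq_line => // i; exact: weak_gradM.
pose c x := eps ^+ 2 * h x + mu * V x.
pose b1 x := c x * (p x * u x ^+ 2).
pose b2 x := c x * (p x * u x) ^+ 2.
have Lb1 : L1 leb b1.
  have := L1D (L1Z (eps ^+ 2) Lhpu) (L1Z mu LpV).
  by apply: eq_integrable => // x _ /=; congr EFin; rewrite /b1 /c; ring.
have Lb2 : L1 leb b2.
  have := L1D (L1Z (eps ^+ 2) Lhppu) (L1Z mu LppV).
  by apply: eq_integrable => // x _ /=; congr EFin; rewrite /b2 /c; ring.
pose P t x := penalized_primitive V K f Lam h mu eps x (w t x).
have GE t : 0 < t -> \int[leb]_x P t x <= \int[leb]_x P 0 x +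
    (t * \int[leb]_x b1 x + t ^+ 2 * \int[leb]_x b2 x).
  move=> t0; rewrite (_ : P 0 = fun x => penalized_primitive V K f Lam h mu eps x (u x)).
    apply: penalized_integral_increment => // x.
    have [Sx'|nSx] := pselect (S x); last by left; exact: pS.
    right; have [L0 K0 V0 /andP[h0 _]] := Sx x Sx'; split => //.
    by rewrite addr_ge0// mulr_ge0// sqr_ge0.
  by apply/funext => x; rewrite /P /w mul0r addr0.
have key : \int[leb]_x a1 x - \int[leb]_x b1 x <= 0.
  apply: (@is_derive_lower_bound _ _ _ _
    (2^-1 * \int[leb]_x a2 x - \int[leb]_x b2 x) dJ) => t t0.
  have := GE t t0; rewrite /P /w => GEt.
  have := normE t; have := normE 0; rewrite /w => n0 nt.
  rewrite /penalized_functional n0 nt /=; move: GEt.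
  set X := \int[leb]_x penalized_primitive _ _ _ _ _ _ _ _ _.
  set Y := \int[leb]_x penalized_primitive _ _ _ _ _ _ _ _ _.
  rewrite expr0n/= => GEt; rewrite -subr_ge0; move: GEt; rewrite -subr_ge0.
  move: (\int[leb]_x a0 x) (\int[leb]_x a1 x) (\int[leb]_x a2 x).
  move: (\int[leb]_x b1 x) (\int[leb]_x b2 x) => B1 B2 A0 A1 A2.
  move=> GE0; apply: (le_trans GE0); rewrite le_eqVlt; apply/orP; left; apply/eqP.
  by field.
apply: le_trans key; rewrite -(RintegralB measurableT La1 Lb1).
rewrite le_eqVlt; apply/orP; left; apply/eqP; apply: eq_Rintegral => x _.
by rewrite /a1 /b1 /c /G /g; ring.
Qed.

End first_variation.

(** * Radial weights for the energy estimate *)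

Section weight_profile.
Context (R : realType).
Implicit Types (s t nu rho : R).

Definition flat' t : R := flat t * t ^- 2.

Lemma is_derive_flat1 t : is_derive t 1 (@flat R) (flat' t).
Proof.
have := is_derive_flat 1 t.
have -> : flat_derivative 1 = @flat R.
  by apply/funext => s; rewrite /flat_derivative /flat hornerC mul1r.
move=> h; apply: is_derive_eq h _; rewrite /flat_derivative /flat' /flat.
case: ifP => t0; last by rewrite mul0r.
by rewrite -[1]polyC1 derivC subr0 polyC1 mul1r hornerXn exprVn mulrC.
Qed.

Lemma flat'_ge0 t : 0 <= flat' t.
Proof. by rewrite mulr_ge0 ?flat_ge0// invr_ge0 sqr_ge0. Qed.

(** By [exp y >= (1 + y / 2) ^ 2] at [y = 1 / t]. *)
Lemma flat'_le4 t : flat' t <= 4.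
Proof.
rewrite /flat' /flat; case: ifP => t0; last by rewrite mul0r.
set y := t^-1; have y0 : 0 < y by rewrite invr_gt0.
have h1 : 1 + y / 2 <= expR (y / 2) by exact: expR_ge1Dx.
have h2 : expR y = expR (y / 2) ^+ 2.
  by rewrite expr2 -expRD; congr expR; field.
rewrite -exprVn -/y expRN mulrC ler_pdivrMr ?expR_gt0// h2.
have : 0 < (y / 2) by rewrite divr_gt0.
move: h1; set e := expR _; set w := y / 2; rewrite (_ : y = 2 * w); last first.
  by rewrite /w; field.
nra.
Qed.

Lemma flat_homo s t : s <= t -> flat s <= flat t.
Proof.
move=> st; have [s0|s0] := leP s 0; first by rewrite (flat_eq0 s0) flat_ge0.
rewrite /flat s0 (lt_le_trans s0 st) ler_expR lerN2 lef_pV2// posrE//.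
exact: lt_le_trans st.
Qed.

(** [growth nu] is comparable to [sqrt (1 + s)] for [s <= nu], and it decays
    like [nu / sqrt s] for larger [s]. *)
Definition growth nu s : R := (1 + nu^-1 * s) `^ (-1) * (1 + 1 * s) `^ 2^-1.

Definition growth' nu s : R := growth nu s * ((2 * (1 + s))^-1 - (nu + s)^-1).

(** The profile of the weights: it vanishes up to [rho] and beyond [nu ^ 3]. *)
Definition profile rho nu s : R :=
  flat (s - rho) * (growth nu s * flat (1 - nu ^- 3 * s)).

Definition profile' rho nu s : R :=
  flat' (s - rho) * (growth nu s * flat (1 - nu ^- 3 * s)) +
  flat (s - rho) * (growth' nu s * flat (1 - nu ^- 3 * s)) -
  flat (s - rho) * (growth nu s * (nu ^- 3 * flat' (1 - nu ^- 3 * s))).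

Lemma powR_pred (x a : R) : 0 < x -> x `^ (a - 1) = x `^ a / x.
Proof. by move=> x0; rewrite powRD ?lt0r_neq0 ?implybT// powR_inv1// ltW. Qed.

Lemma is_derive_affine (c s : R) : is_derive s 1 (fun t : R => 1 + c * t) c.
Proof.
by apply: is_derive_eq; rewrite add0r [_ *: _]mulr1 ?scaler0 ?addr0 ?mul1r ?mulr1.
Qed.

Lemma is_derive_growth nu s : 0 < nu -> 0 <= s ->
  is_derive s 1 (growth nu) (growth' nu s).
Proof.
move=> nu0 s0.
have pos (c : R) : 0 <= c -> 0 < 1 + c * s.
  by move=> c0; rewrite ltr_wpDr// mulr_ge0.
have pw (c a : R) : 0 <= c -> is_derive s 1 (fun t : R => (1 + c * t) `^ a)
    (a * ((1 + c * s) `^ a / (1 + c * s)) * c).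
  move=> c0; rewrite -powR_pred; last exact: pos.
  by apply: (@is_derive1_comp _ (fun t : R => t `^ a)) (is_derive_affine c s); apply: is_derive1_powR; exact: pos.
have nui : 0 <= nu^-1 by rewrite invr_ge0 ltW.
apply: is_derive_eq (is_derive_mulr (pw _ (-1) nui) (pw 1 2^-1 ler01)) _.
rewrite /growth' /growth !mul1r.
have h1 : nu + s != 0 by rewrite gt_eqF// ltr_wpDr.
have h2 : 1 + s != 0 by rewrite gt_eqF// ltr_wpDr.
have h3 : nu != 0 by rewrite gt_eqF.
have -> : 1 + nu^-1 * s = (nu + s) / nu by rewrite mulrDl divff// mulrC.
set a := _ `^ (-1); set b := _ `^ _.
by field; rewrite h1 h2 h3.
Qed.

Lemma growth_ge0 nu s : 0 <= growth nu s.
Proof. by rewrite mulr_ge0// powR_ge0. Qed.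

Lemma growth_sq nu s : 0 < nu -> 0 <= s ->
  growth nu s ^+ 2 = (1 + s) * (nu / (nu + s)) ^+ 2.
Proof.
move=> nu0 s0; rewrite /growth mul1r.
have h1 : 0 < nu + s by rewrite ltr_wpDr.
have -> : 1 + nu^-1 * s = (nu + s) / nu by rewrite mulrDl divff ?gt_eqF// mulrC.
rewrite powR_inv1; last by rewrite divr_ge0// ltW.
rewrite invf_div exprMn mulrC; congr (_ * _).
by rewrite powR12_sqrt ?addr_ge0// sqr_sqrtr// addr_ge0.
Qed.

Lemma growth'_sq nu s : 1 <= nu -> 0 <= s ->
  4 * s * growth' nu s ^+ 2 <= growth nu s ^+ 2 / (1 + s).
Proof.
move=> nu1 s0; rewrite /growth' exprMn.
have h0 : 0 < 1 + s by rewrite ltr_wpDr.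
have h1 : 0 < nu + s by rewrite ltr_wpDr// (lt_le_trans ltr01).
have a0 : 0 < (1 + s)^-1 by rewrite invr_gt0.
have b0 : 0 < (nu + s)^-1 by rewrite invr_gt0.
have ba : (nu + s)^-1 <= (1 + s)^-1 by rewrite lef_pV2 ?posrE// lerD2r.
rewrite invfM; move: a0 b0 ba.
have : s * (1 + s)^-1 <= 1 by rewrite ler_pdivrMr// mul1r lerDr.
set a := (1 + s)^-1; set b := (nu + s)^-1; set G := growth nu s ^+ 2.
have G0 : 0 <= G by exact: sqr_ge0.
move=> sa a0 b0 ba.
rewrite mulrCA ler_wpM2l//.
have h : (2^-1 * a - b) ^+ 2 <= (2^-1 * a) ^+ 2 by nra.
apply: (@le_trans _ _ (4 * s * (2^-1 * a) ^+ 2)); first by rewrite ler_wpM2l// mulr_ge0.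
rewrite (_ : _ * _ = (s * a) * a); last by field.
by rewrite ler_piMl// ltW.
Qed.

Lemma is_derive_profile rho nu s : 0 < nu -> 0 <= s ->
  is_derive s 1 (profile rho nu) (profile' rho nu s).
Proof.
move=> nu0 s0.
have d1 : is_derive s 1 (fun t : R => flat (t - rho)) (flat' (s - rho)).
  have aff : is_derive s 1 (fun t : R => t - rho) 1.
    by apply: is_derive_eq; rewrite oppr0 addr0.
  rewrite -[flat' _]mulr1.
  exact: (@is_derive1_comp _ _ (fun t : R => t - rho) _ _ _ (is_derive_flat1 (s - rho)) aff).
have d2 : is_derive s 1 (fun t : R => flat (1 - nu ^- 3 * t))
    (flat' (1 - nu ^- 3 * s) * - nu ^- 3).
  have aff : is_derive s 1 (fun t : R => 1 - nu ^- 3 * t) (- nu ^- 3).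
    by under eq_fun do rewrite -mulNr; exact: is_derive_affine.
  exact: is_derive1_comp (is_derive_flat1 _) aff.
apply: is_derive_eq (is_derive_mulr d1 (is_derive_mulr (is_derive_growth nu0 s0) d2)) _.
by rewrite /profile'; ring.
Qed.

Lemma profile_inner rho nu s : s <= rho -> profile rho nu s = 0 /\ profile' rho nu s = 0.
Proof.
move=> h; have h' : flat (s - rho) = 0 by rewrite flat_eq0// subr_le0.
by rewrite /profile /profile' /flat' h' !mul0r subr0 addr0.
Qed.

Lemma profile_outer rho nu s : 0 < nu -> nu ^+ 3 <= s ->
  profile rho nu s = 0 /\ profile' rho nu s = 0.
Proof.
move=> nu0 h; have h' : flat (1 - nu ^- 3 * s) = 0.
  by rewrite flat_eq0// subr_le0 mulrC ler_pdivlMr ?exprn_gt0// mul1r.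
by rewrite /profile /profile' /flat' h' !mul0r !mulr0 subr0 addr0.
Qed.

(** In the annulus where the weight is not yet large, its derivative is only
    bounded; beyond [nu], the quadratic decay of [growth nu ^ 2] makes the outer
    cutoff harmless. Elsewhere the logarithmic derivative of [growth nu] is at
    most that of [sqrt (1 + s)], for which the factor in front of
    [profile ^ 2 / (1 + s)] is 1. *)
Lemma profile'_sq rho nu s : 0 <= rho -> 1 <= nu -> rho <= s -> s <= nu ^+ 3 ->
  4 * s * profile' rho nu s ^+ 2 <= 7 / 4 * (profile rho nu s ^+ 2 / (1 + s)) +
    384 * (2 * rho + 21) * (2 * rho + 22) * (s <= 2 * rho + 21)%R%:R +
    384 * nu ^- 4.
Proof.
move=> rho0 nu1 rs sn; have s0 : 0 <= s := le_trans rho0 rs.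
have nu0 : 0 < nu := lt_le_trans ltr01 nu1.
have s10 : 0 < 1 + s by rewrite ltr_wpDr.
have hg := growth'_sq nu1 s0; have hG := growth_sq nu0 s0.
have g0 := growth_ge0 nu s.
rewrite /profile' /profile; move: hg hG g0.
set X := flat (s - rho); set X' := flat' (s - rho).
set Y := flat (1 - nu ^- 3 * s); set Y' := flat' (1 - nu ^- 3 * s).
set G := growth nu s; set G' := growth' nu s => hg hG g0.
have X0 : 0 <= X by exact: flat_ge0.
have X1 : X <= 1 by exact: flat_le1.
have Y0 : 0 <= Y by exact: flat_ge0.
have Y1 : Y <= 1 by exact: flat_le1.
have Y'0 : 0 <= Y' by exact: flat'_ge0.
have Y'4 : Y' <= 4 by exact: flat'_le4.
have X'0 : 0 <= X' by exact: flat'_ge0.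
have X'4 : X' <= 4 by exact: flat'_le4.
have sq01 (y : R) : 0 <= y -> y <= 1 -> y ^+ 2 <= 1.
  by move=> y0 y1; rewrite expr_le1.
have sq04 (y : R) : 0 <= y -> y <= 4 -> y ^+ 2 <= 16.
  by move=> y0 y4; nra.
(* the three terms of the product rule; the growth term [a] keeps a factor 3/2,
   and 1/4 is left to absorb the inner cutoff term [b] *)
pose a := X * (G' * Y); pose b := X' * (G * Y); pose c := X * (G * (nu ^- 3 * Y')).
have young : (b + a - c) ^+ 2 <= 3 / 2 * a ^+ 2 + 6 * b ^+ 2 + 6 * c ^+ 2.
  have h1 := sqr_ge0 (a - 2 * (b - c)); have h2 := sqr_ge0 (b + c).
  by move: h1 h2; lra.
have G2 : G ^+ 2 <= 1 + s.
  rewrite hG ler_piMr ?(ltW s10)//; apply: sq01.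
    by rewrite divr_ge0 ?addr_ge0// ltW.
  by rewrite ler_pdivrMr ?ltr_wpDr// mul1r lerDl.
have sG2 : s * G ^+ 2 <= nu ^+ 2.
  rewrite hG expr_div_n mulrA mulrA ler_pdivrMr ?exprn_gt0 ?ltr_wpDr//.
  rewrite mulrC ler_wpM2l ?sqr_ge0//.
  by nra.
have ha : 4 * s * a ^+ 2 <= (X * (G * Y)) ^+ 2 / (1 + s).
  have -> : 4 * s * a ^+ 2 = (X * Y) ^+ 2 * (4 * s * G' ^+ 2) by rewrite /a; ring.
  have -> : (X * (G * Y)) ^+ 2 / (1 + s) = (X * Y) ^+ 2 * (G ^+ 2 / (1 + s)).
    by field; rewrite gt_eqF.
  by rewrite ler_wpM2l// sqr_ge0.
have hc : 24 * s * c ^+ 2 <= 384 * nu ^- 4.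
  have -> : 24 * s * c ^+ 2 = 24 * nu ^- 6 * ((s * G ^+ 2) * (X ^+ 2 * Y' ^+ 2)).
    rewrite /c; field; exact: lt0r_neq0.
  have -> : 384 * nu ^- 4 = 24 * nu ^- 6 * (nu ^+ 2 * 16).
    by field; exact: lt0r_neq0.
  apply: ler_wpM2l; first by rewrite mulr_ge0// invr_ge0 exprn_ge0// ltW.
  apply: (ler_pM (mulr_ge0 s0 (sqr_ge0 G)) (mulr_ge0 (sqr_ge0 X) (sqr_ge0 Y')) sG2).
  by rewrite -[leRHS]mul1r; apply: (ler_pM (sqr_ge0 X) (sqr_ge0 Y')); [exact: sq01 | exact: sq04].
have hb : 24 * s * b ^+ 2 <= 4^-1 * ((X * (G * Y)) ^+ 2 / (1 + s)) +
    384 * (2 * rho + 21) * (2 * rho + 22) * (s <= 2 * rho + 21)%R%:R.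
  have [sr|sr] := leP s (2 * rho + 21).
    rewrite mulr1; apply: (@le_trans _ _ (384 * (2 * rho + 21) * (2 * rho + 22))); last first.
      by rewrite lerDr mulr_ge0// divr_ge0 ?sqr_ge0// ltW.
    have -> : 24 * s * b ^+ 2 = 24 * ((s * G ^+ 2) * (X' ^+ 2 * Y ^+ 2)) by rewrite /b; ring.
    have -> : 384 * (2 * rho + 21) * (2 * rho + 22) =
      24 * (((2 * rho + 21) * (2 * rho + 22)) * (16 * 1)) by ring.
    rewrite ler_wpM2l//.
    apply: (ler_pM (mulr_ge0 s0 (sqr_ge0 G)) (mulr_ge0 (sqr_ge0 X') (sqr_ge0 Y))).
      by apply: (ler_pM s0 (sqr_ge0 G) sr); move: G2 sr; lra.
    by apply: (ler_pM (sqr_ge0 X') (sqr_ge0 Y)); [exact: sq04 | exact: sq01].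
  rewrite mulr0 addr0.
  have y20 : 21 + rho < s - rho by move: sr; lra.
  have yp : 0 < s - rho by move: y20; lra.
  have -> : 24 * s * b ^+ 2 = (X * (G * Y)) ^+ 2 / (1 + s) *
      (24 * (s * (1 + s)) / (s - rho) ^+ 4).
    by rewrite /b /X' /flat' -/X; field; rewrite !gt_eqF.
  rewrite mulrC ler_wpM2r ?divr_ge0 ?sqr_ge0 ?(ltW s10)//.
  rewrite ler_pdivrMr ?exprn_gt0//.
  have : s + 1 <= 2 * (s - rho) by move: y20; lra.
  move: y20 yp; set y := s - rho => y20 yp sy.
  have h1 : s * (1 + s) <= 4 * y ^+ 2 by move: s0; nra.
  have h2 : 384 * y ^+ 2 <= y ^+ 4.
    have -> : y ^+ 4 = y ^+ 2 * y ^+ 2 by rewrite -exprD.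
    by apply: ler_wpM2r; [exact: sqr_ge0 | nra].
  by move: h1 h2; lra.
apply: (@le_trans _ _ (4 * s * (3 / 2 * a ^+ 2 + 6 * b ^+ 2 + 6 * c ^+ 2))).
  by rewrite ler_wpM2l// ?mulr_ge0// /a /b /c -/X.
by move: ha hb hc; lra.
Qed.

(** The lower bound is uniform in [nu], so the limit [nu] to infinity captures
    the whole mass outside of the ball. *)
Lemma profile_lower rho nu s : 2 <= nu -> rho + 1 <= s -> 0 <= s -> s <= nu ->
  (flat 1 * flat 2^-1 / 2) ^+ 2 * (1 + s) <= profile rho nu s ^+ 2.
Proof.
move=> nu2 rs s0 sn; have nu0 : 0 < nu by rewrite (lt_le_trans _ nu2).
have h1 : flat 1 <= flat (s - rho) :> R by apply: flat_homo; move: rs; lra.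
have h2 : flat 2^-1 <= flat (1 - nu ^- 3 * s) :> R.
  apply: flat_homo; rewrite lerBrDl -lerBrDr (_ : 1 - 2^-1 = 2^-1 :> R); last by field.
  by rewrite mulrC ler_pdivrMr ?exprn_gt0//; nra.
have hG := growth_sq nu0 s0.
have -> : profile rho nu s ^+ 2 = flat (s - rho) ^+ 2 * (growth nu s ^+ 2 *
    flat (1 - nu ^- 3 * s) ^+ 2) by rewrite -!exprMn.
rewrite hG !exprMn.
have h3 : 2^-1 <= nu / (nu + s) by rewrite ler_pdivlMr ?ltr_wpDr//; move: sn; lra.
have sq (x y : R) : 0 <= x -> x <= y -> x ^+ 2 <= y ^+ 2.
  by move=> x0 xy; rewrite ler_sqr ?nnegrE// (le_trans x0).
have -> : flat 1 ^+ 2 * flat 2^-1 ^+ 2 * 2^-1 ^+ 2 * (1 + s) =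
  flat 1 ^+ 2 * ((1 + s) * 2^-1 ^+ 2 * flat 2^-1 ^+ 2) by ring.
have f0 (t : R) : 0 <= flat t ^+ 2 by exact: sqr_ge0.
have q0 (y : R) : 0 <= (1 + s) * y ^+ 2 by rewrite mulr_ge0 ?sqr_ge0 ?addr_ge0.
apply: ler_pM => //; first by rewrite mulr_ge0.
  by apply: sq; rewrite ?flat_ge0.
apply: ler_pM => //; last by apply: sq; rewrite ?flat_ge0.
by rewrite ler_wpM2l ?addr_ge0// -exprMn sq ?invr_ge0.
Qed.

End weight_profile.

Section weights.
Context (R : realType) (n : nat).
Implicit Types (x : 'rV[R]_n) (nu rho : R).

Definition weight rho nu x : R := profile rho nu (sqn x).

Lemma smooth_weight rho nu : 0 < nu -> smooth (weight rho nu).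
Proof.
move=> nu0; apply: elementaryP; rewrite /weight /profile /growth.
have efl (c a : R) : elementary (fun x : 'rV[R]_n => flat (a + c * sqn x)).
  apply: (elementary_comp (I := setT) (Theta := @flat R)) => //.
    exact: smooth_on_flat.
  apply: elementary_add; first exact: elementary_cst.
  by apply: elementary_mul; [exact: elementary_cst | exact: elementary_sqn].
apply: elementary_mul.
  under eq_fun do rewrite addrC -[sqn _]mul1r.
  exact: efl.
apply: elementary_mul.
  apply: elementary_mul; first by apply: elementary_sqn1_powR; rewrite invr_ge0 ltW.
  exact: elementary_sqn1_powR.
under eq_fun do rewrite -mulNr.
exact: efl.
Qed.

Lemma is_derive_weight rho nu i x : 0 < nu ->
  is_derive x (delta_mx ord0 i) (weight rho nu)
    (profile' rho nu (sqn x) * (2 * x ord0 i)).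
Proof.
move=> nu0; apply: is_derive_rV_comp; last exact: is_derive_sqn.
by apply: is_derive_profile => //; exact: sqn_ge0.
Qed.

Lemma partial_weight rho nu i x : 0 < nu ->
  partial [:: i] (weight rho nu) x = profile' rho nu (sqn x) * (2 * x ord0 i).
Proof. by move=> nu0; case: (is_derive_weight rho i x nu0). Qed.

Lemma weight_out rho nu x : 0 < nu -> ~~ (rho <= sqn x <= nu ^+ 3) ->
  weight rho nu x = 0 /\ forall i, partial [:: i] (weight rho nu) x = 0.
Proof.
move=> nu0; rewrite negb_and -!ltNge => /orP[h|h].
  have [h0 h1] := profile_inner nu (ltW h).
  by split=> // i; rewrite partial_weight// h1 mul0r.
have [h0 h1] := profile_outer rho nu0 (ltW h).
by split=> // i; rewrite partial_weight// h1 mul0r.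
Qed.

Lemma test_weight rho nu : 0 < nu -> test_function (weight rho nu).
Proof.
move=> nu0; split; first exact: smooth_weight.
exists (Num.sqrt (nu ^+ 3)) => x hx; apply: (weight_out (rho := rho) nu0 _).1.
rewrite negb_and -!ltNge; apply/orP; right.
rewrite -enorm_sq -[ltLHS]sqr_sqrtr ?exprn_ge0 ?ltW//.
by rewrite ltr_sqr// nnegrE ?sqrtr_ge0 ?enorm_ge0.
Qed.

(** Multiplying by a cutoff with this gradient bound loses 7/4 of a Hardy
    term, up to an inner contribution that does not depend on [nu]. *)
Lemma weight_grad_sq rho nu x : 0 <= rho -> 1 <= nu ->
  \sum_(i < n) partial [:: i] (weight rho nu) x ^+ 2 <=
  7 / 4 * (weight rho nu x ^+ 2 / (1 + sqn x)) +
  384 * (2 * rho + 21) * (2 * rho + 22) * (rho <= sqn x <= 2 * rho + 21)%R%:R +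
  384 * nu ^- 4 * (rho <= sqn x <= nu ^+ 3)%R%:R.
Proof.
move=> rho0 nu1; have nu0 : 0 < nu := lt_le_trans ltr01 nu1.
have c0 : 0 <= 384 * (2 * rho + 21) * (2 * rho + 22).
  have h1 : 0 <= 2 * rho + 21 by move: rho0; lra.
  have h2 : 0 <= 2 * rho + 22 by move: rho0; lra.
  exact: mulr_ge0 (mulr_ge0 (ler0n _ _) h1) h2.
have s0 := sqn_ge0 x; have s10 : 0 < 1 + sqn x by rewrite ltr_wpDr.
have r0 (b : bool) : 0 <= 7 / 4 * (weight rho nu x ^+ 2 / (1 + sqn x)) +
    384 * (2 * rho + 21) * (2 * rho + 22) * b%:R.
  apply: addr_ge0; last exact: mulr_ge0 c0 (ler0n _ _).
  have h7 : 0 <= 7 / 4 :> R by lra.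
  exact: mulr_ge0 h7 (divr_ge0 (sqr_ge0 _) (ltW s10)).
have -> : \sum_(i < n) partial [:: i] (weight rho nu) x ^+ 2 =
    4 * sqn x * profile' rho nu (sqn x) ^+ 2.
  rewrite {2}/sqn mulr_sumr mulr_suml; apply: eq_bigr => i _.
  by rewrite partial_weight// !exprMn; ring.
have [h|h] := boolP (rho <= sqn x <= nu ^+ 3); last first.
  move: h; rewrite negb_and -!ltNge => /orP[h|h].
    rewrite (profile_inner nu (ltW h)).2 expr0n/= mulr0 mulr0 addr0.
    exact: r0.
  rewrite (profile_outer rho nu0 (ltW h)).2 expr0n/= mulr0 mulr0 addr0.
  exact: r0.
have /andP[h1 h2] := h.
by rewrite h1 /= mulr1; exact: profile'_sq.
Qed.

Lemma measurable_annulus (a b : R) : measurable [set x : 'rV[R]_n | a <= sqn x <= b].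
Proof.
rewrite (_ : mkset _ = setT `&` (@sqn R n) @^-1` `[a, b]%classic).
  exact: measurable_sqn.
by rewrite setTI; apply/seteqP; split=> x /=; rewrite in_itv.
Qed.

Lemma indic_annulus (a b : R) x :
  \1_[set y : 'rV[R]_n | a <= sqn y <= b] x = (a <= sqn x <= b)%R%:R :> R.
Proof. by rewrite indicE; congr ((nat_of_bool _)%:R); apply: asboolb. Qed.

End weights.

(** * Weighted energy inequalities *)

Section weighted_energy.
Context (R : realType) (N : nat).
Implicit Types (V K h u q : 'rV[R]_N -> R) (Lam : set 'rV[R]_N).
Local Notation leb := (lebesgue_rV R N).

Definition annulus (a b : R) : set 'rV[R]_N := [set x | a <= sqn x <= b].

(** Testing with [q ^ 2 u] and completing the square,
    [grad u . grad (q ^ 2 u) = |grad (q u)| ^ 2 - u ^ 2 |grad q| ^ 2]. *)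
Lemma weighted_energy V K (f : R -> R) Lam h (mu eps : R) u (rho nu C : R) :
  {within `[0, +oo[, continuous f} -> (forall s, 0 <= s -> 0 <= f s) ->
  measurable_fun setT V -> measurable_fun setT h ->
  weakly_differentiable u -> (forall i, L1 leb (fun x => weak_grad u i x ^+ 2)) ->
  L1 leb (fun x => V x * u x ^+ 2) ->
  0 < nu -> L1 leb (fun x => u x ^+ 2 * \1_(annulus rho (nu ^+ 3)) x) ->
  (forall x, rho <= sqn x -> [/\ ~ Lam x, 0 <= K x, 0 <= V x & 0 <= h x <= C]) ->
  0 <= mu -> 0 < eps ->
  directional_derivative (penalized_functional V K f Lam h mu eps) u
    (fun x => weight rho nu x ^+ 2 * u x) 0 ->
  let q := weight rho nu in
  let W x := eps ^- 2 * ((1 - mu) * V x) - h x in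
  [/\ L1 leb (fun x => (q x * u x) ^+ 2),
      forall i, L1 leb (fun x => (q x * weak_grad u i x + partial [:: i] q x * u x) ^+ 2),
      L1 leb (fun x => W x * (q x * u x) ^+ 2),
      L1 leb (fun x => u x ^+ 2 * \sum_(i < N) partial [:: i] q x ^+ 2) &
      \sum_(i < N) \int[leb]_x (q x * weak_grad u i x + partial [:: i] q x * u x) ^+ 2
        + \int[leb]_x (W x * (q x * u x) ^+ 2)
      <= \int[leb]_x (u x ^+ 2 * \sum_(i < N) partial [:: i] q x ^+ 2)].
Proof.
move=> cf f0 mV mh wu Lg LVu nu0 LS HS mu0 eps0 dJ q W.
set S := annulus rho (nu ^+ 3) in LS.
have tq : test_function q by exact: test_weight.
have sq := tq.1.
have mS : measurable S by exact: measurable_annulus.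
have qS x : ~ S x -> q x = 0 /\ forall i, partial [:: i] q x = 0.
  by move=> /negP; exact: weight_out.
have tp : test_function (fun x => q x ^+ 2).
  by rewrite (_ : (fun x => _) = fun x => q x * q x)//; exact: test_smoothM.
have dp x i : partial [:: i] (fun x => q x ^+ 2) x = 2 * q x * partial [:: i] q x.
  rewrite (_ : (fun x => q x ^+ 2) = fun x => q x * q x)//.
  by rewrite partialM//; ring.
have SV x : S x -> [/\ ~ Lam x, 0 <= K x, 0 <= V x & 0 <= h x <= C].
  by move=> /andP[/HS].
have p0 x : ~ S x -> q x ^+ 2 = 0 by move=> /qS[-> _]; rewrite expr0n.
have dp0 x i : ~ S x -> partial [:: i] (fun x => q x ^+ 2) x = 0.
  by move=> /qS[_ h0]; rewrite dp h0 mulr0.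
have [LpV FV] := @first_variation _ _ V K f Lam h mu eps u _ S C cf f0 mV mh wu Lg LVu mS LS
  tp (fun x => sqr_ge0 (q x)) p0 dp0 SV mu0 dJ.
have mq := test_measurable tq.
have mdq i : measurable_fun setT (partial [:: i] q).
  exact: continuous_measurable_rV (smooth_continuous (smooth_partial i sq)).
have mu_ : measurable_fun setT u by case: wu => /locally_L1_measurable.
have mg i := weak_grad_measurable i wu.
have sq_bound (a : 'rV[R]_N -> R) : test_function a -> exists D, forall x, `|a x ^+ 2| <= D.
  move=> ta; have [r [D [aD _]]] := test_bounded ta.
  by exists (D ^+ 2) => x; rewrite normrX ler_sqr ?nnegrE// (le_trans _ (aD x)).
have supp (a : 'rV[R]_N -> R) : (forall x, ~ S x -> a x = 0) ->
    (fun x => u x ^+ 2 * a x ^+ 2) = (fun x => u x ^+ 2 * \1_S x * a x ^+ 2).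
  move=> a0; apply/funext => x.
  have [xS|xS] := pselect (S x); first by rewrite indicE mem_set// mulr1.
  by rewrite a0// expr0n !mulr0.
have Lqu : L1 leb (fun x => (q x * u x) ^+ 2).
  have [D qD] := sq_bound q tq.
  under eq_fun do rewrite exprMn mulrC.
  rewrite supp; last by move=> x /qS[].
  by apply: (L1_mul_bounded LS (C := D)) => //; exact: measurable_funX.
have Ldq i : L1 leb (fun x => u x ^+ 2 * partial [:: i] q x ^+ 2).
  have [D qD] := sq_bound _ (test_partial i tq).
  rewrite supp; last by move=> x /qS[].
  by apply: (L1_mul_bounded LS (C := D)) => //; exact: measurable_funX.
have Lqg i : L1 leb (fun x => weak_grad u i x ^+ 2 * q x ^+ 2).
  have [D qD] := sq_bound q tq.
  by apply: (L1_mul_bounded (Lg i) (C := D)) => //; exact: measurable_funX.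
have LG i : L1 leb (fun x => (q x * weak_grad u i x + partial [:: i] q x * u x) ^+ 2).
  apply: (@L1_le _ _ _ leb _ (fun x => 2 * (weak_grad u i x ^+ 2 * q x ^+ 2) +
      2 * (u x ^+ 2 * partial [:: i] q x ^+ 2))).
  - by apply: measurable_funX; apply: measurable_funD; exact: measurable_funM.
  - move=> x; rewrite ger0_norm ?sqr_ge0// -subr_ge0.
    apply: (le_trans (sqr_ge0 (q x * weak_grad u i x - partial [:: i] q x * u x))).
    rewrite le_eqVlt; apply/orP; left; apply/eqP; ring.
  - by apply: L1D; exact: L1Z.
have Lhu : L1 leb (fun x => h x * (q x * u x) ^+ 2).
  apply: (@L1_le _ _ _ leb _ (fun x => C * (q x * u x) ^+ 2)).
  - apply: measurable_funM => //; apply: measurable_funX; exact: measurable_funM.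
  - move=> x; have [xS|xS] := pselect (S x).
      have [_ _ _ /andP[h0 hC]] := SV x xS.
      by rewrite ger0_norm; [exact: ler_wpM2r (sqr_ge0 _) _ _ hC | exact: mulr_ge0 h0 (sqr_ge0 _)].
    by rewrite (qS x xS).1 mul0r expr0n/= !mulr0 normr0.
  - exact: L1Z.
have LW : L1 leb (fun x => W x * (q x * u x) ^+ 2).
  have := L1B (L1Z (eps ^- 2 * (1 - mu)) LpV) Lhu.
  rewrite (_ : (fun x => _ - _) = (fun x => W x * (q x * u x) ^+ 2))//.
  by apply/funext => x; rewrite /W; ring.
have Lds : L1 leb (fun x => u x ^+ 2 * \sum_(i < N) partial [:: i] q x ^+ 2).
  by under eq_fun do rewrite mulr_sumr; exact: L1_sum.
split => //.
rewrite -Rintegral_sum// -RintegralD//; last exact: L1_sum.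
rewrite -subr_ge0 -RintegralB//; last by apply: L1D => //; exact: L1_sum.
move: FV; rewrite -oppr_ge0 => FV.
have : 0 <= eps ^- 2 * - \int[leb]_x (\sum_(i < N) (eps ^+ 2 * (weak_grad u i x *
        (q x ^+ 2 * weak_grad u i x + partial [:: i] (fun x => q x ^+ 2) x * u x))) +
    ((1 - mu) * V x - eps ^+ 2 * h x) * (q x ^+ 2 * u x ^+ 2)).
  by rewrite mulr_ge0// invr_ge0 sqr_ge0.
move=> FV0; apply: (le_trans FV0); rewrite le_eqVlt; apply/orP; left; apply/eqP.
have eqF : (fun x => \sum_(i < N) (eps ^+ 2 * (weak_grad u i x *
        (q x ^+ 2 * weak_grad u i x + partial [:: i] (fun x => q x ^+ 2) x * u x))) +
    ((1 - mu) * V x - eps ^+ 2 * h x) * (q x ^+ 2 * u x ^+ 2)) =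
  (fun x => eps ^+ 2 * ((\sum_(i < N) (q x * weak_grad u i x + partial [:: i] q x * u x) ^+ 2 +
    W x * (q x * u x) ^+ 2) - u x ^+ 2 * \sum_(i < N) partial [:: i] q x ^+ 2)).
  apply/funext => x; rewrite [in RHS]mulrBr [in RHS]mulrDr !mulr_sumr addrAC -sumrB; congr (_ + _).
    by apply: eq_bigr => i _; rewrite dp; ring.
  by rewrite /W; field; rewrite gt_eqF.
rewrite eqF RintegralZl//; last by apply: L1B => //; apply: L1D => //; exact: L1_sum.
rewrite mulrN mulKf ?expf_neq0 ?gt_eqF// RintegralB//; last by apply: L1D => //; exact: L1_sum.
rewrite RintegralB// ?opprB//.
by apply: L1D => //; exact: L1_sum.
Qed.

(** In dimension at least 5 Hardy's constant is at least 9/4; with 1/4 spent on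
    the penalty potential, 2 remains, which exceeds the factor 7/4 lost to the
    weight. *)
Lemma weighted_energy_hardy u q (W : 'rV[R]_N -> R) rho nu : (5 <= N)%N ->
  weakly_differentiable u -> 0 < nu -> q = weight rho nu ->
  L1 leb (fun x => (q x * u x) ^+ 2) ->
  (forall i, L1 leb (fun x => (q x * weak_grad u i x + partial [:: i] q x * u x) ^+ 2)) ->
  L1 leb (fun x => W x * (q x * u x) ^+ 2) ->
  (forall x, rho <= sqn x -> - (4 * (1 + sqn x))^-1 <= W x) ->
  2 * \int[leb]_x ((q x * u x) ^+ 2 / (1 + sqn x)) <=
  \sum_(i < N) \int[leb]_x (q x * weak_grad u i x + partial [:: i] q x * u x) ^+ 2
        + \int[leb]_x (W x * (q x * u x) ^+ 2).
Proof.
move=> N5 wu nu0 qE Lz LG LW HW.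
have [Lu _] := wu.
have tq : test_function q by rewrite qE; exact: test_weight.
have sq := tq.1.
have Lz1 : L1 leb (fun x => (q x * u x) ^+ 2 / (1 + sqn x)) by exact: L1_sqn1V.
have hardy := @hardy_inequality _ _ (fun x => q x * u x)
  (fun i x => q x * weak_grad u i x + partial [:: i] q x * u x)
  (ltn_trans (isT : 1 < 4)%N N5)
  (locally_L1_continuousM Lu (smooth_continuous sq)) Lz
  (fun i => weak_partialM Lu (weak_grad_spec i wu) sq) LG.
have hW : - (4^-1 * \int[leb]_x ((q x * u x) ^+ 2 / (1 + sqn x))) <=
    \int[leb]_x (W x * (q x * u x) ^+ 2).
  rewrite -RintegralZl// -mulN1r -RintegralZl//; last exact: L1Z.
  apply: le_Rintegral => //; first by apply: L1Z; exact: L1Z.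
  move=> x _; have [xr|xr] := boolP (rho <= sqn x <= nu ^+ 3).
    rewrite (_ : -1 * _ = - (4 * (1 + sqn x))^-1 * (q x * u x) ^+ 2); last first.
      by field; exact: sqn1_neq0.
    by rewrite ler_wpM2r ?sqr_ge0// HW//; case/andP: xr.
  by rewrite qE (weight_out nu0 xr).1 mul0r expr0n/= !(mul0r, mulr0).
have I0 : 0 <= \int[leb]_x ((q x * u x) ^+ 2 / (1 + sqn x)).
  by apply: Rintegral_ge0 => x _; rewrite divr_ge0 ?sqr_ge0 ?(ltW (sqn1_gt0 _)).
have c94 : 9 / 4 <= ((N%:R - 2) / 2) ^+ 2 :> R.
  have : 5 <= N%:R :> R by rewrite ler_nat.
  by nra.
have := ler_wpM2r I0 c94; move: hardy hW; lra.
Qed.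

(** Here the zero-order term alone is coercive, as is the case for small [eps] if
    [V] decays at most like [|x| ^ -2]. *)
Lemma weighted_energy_potential u q (W : 'rV[R]_N -> R) rho nu :
  0 < nu -> q = weight rho nu ->
  L1 leb (fun x => (q x * u x) ^+ 2) ->
  L1 leb (fun x => W x * (q x * u x) ^+ 2) ->
  (forall x, rho <= sqn x -> 2 / (1 + sqn x) <= W x) ->
  2 * \int[leb]_x ((q x * u x) ^+ 2 / (1 + sqn x)) <=
  \sum_(i < N) \int[leb]_x (q x * weak_grad u i x + partial [:: i] q x * u x) ^+ 2
        + \int[leb]_x (W x * (q x * u x) ^+ 2).
Proof.
move=> nu0 qE Lz LW HW.
have Lz1 : L1 leb (fun x => (q x * u x) ^+ 2 / (1 + sqn x)) by exact: L1_sqn1V.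
apply: ler_wpDl.
  by apply: sumr_ge0 => i _; apply: Rintegral_ge0 => x _; exact: sqr_ge0.
rewrite -RintegralZl//; apply: le_Rintegral => //; first exact: L1Z.
move=> x _; have [xr|xr] := boolP (rho <= sqn x <= nu ^+ 3).
  rewrite mulrCA mulrC; apply: ler_wpM2r; rewrite ?sqr_ge0// HW//.
  by case/andP: xr.
by rewrite qE (weight_out nu0 xr).1 mul0r expr0n/= !(mul0r, mulr0).
Qed.

Lemma L1_exhaustion (F : 'rV[R]_N -> R) (a D : R) : measurable_fun setT F ->
  (forall x, 0 <= F x) ->
  (forall k : nat, L1 leb (fun x => F x * \1_(annulus a k.+2%:R) x) /\
    \int[leb]_x (F x * \1_(annulus a k.+2%:R) x) <= D) ->
  L1 leb (fun x => F x * \1_[set x | a <= sqn x] x).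
Proof.
move=> mF F0 HF.
have mI (A : set 'rV[R]_N) : measurable A -> measurable_fun setT (fun x => F x * \1_A x).
  by move=> mA; apply: measurable_funM => //; exact: measurable_indic.
have I0 (A : set 'rV[R]_N) x : 0 <= F x * \1_A x by rewrite mulr_ge0// indicE.
have mA : measurable [set x : 'rV[R]_N | a <= sqn x].
  rewrite (_ : mkset _ = setT `&` (@sqn R N) @^-1` `[a, +oo[%classic).
    exact: measurable_sqn.
  by rewrite setTI; apply/seteqP; split=> x /=; rewrite in_itv/= andbT.
have mann (k : nat) : measurable (annulus a k.+2%:R : set 'rV[R]_N) by exact: measurable_annulus.
have ndI x (k l : nat) : (k <= l)%N ->
    F x * \1_(annulus a k.+2%:R) x <= F x * \1_(annulus a l.+2%:R) x.
  move=> kl; rewrite ler_wpM2l// !indicE ler_nat.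
  case: (boolP (x \in annulus a k.+2%:R)) => // /set_mem /andP[xa xk].
  rewrite mem_set//; apply/andP; split=> //.
  by rewrite (le_trans xk)// ler_nat.
apply/L1_ge0P => //; first exact: mI.
have limE x : limn ((fun k : nat => (F x * \1_(annulus a k.+2%:R) x)%:E)) =
    (F x * \1_[set x | a <= sqn x] x)%:E.
  apply: cvg_lim => //; apply: cvg_near_cst.
  have [xa|xa] := boolP (a <= sqn x); last first.
    apply: nearW => k; rewrite !indicE !memNset//=; first by apply/negP.
    by rewrite /annulus/= (negbTE xa).
  near=> k; rewrite !indicE !mem_set//=.
  rewrite /annulus/= xa/=.
  apply: (@le_trans _ _ k%:R); last by rewrite ler_nat leqW// leqW.
  by near: k; exact: nbhs_infty_ger.
apply: (@le_lt_trans _ _ D%:E); last exact: ltry.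
under eq_integral do rewrite -limE.
rewrite monotone_convergence//.
- apply: lime_le.
    apply: ereal_nondecreasing_is_cvgn => k l kl; apply: ge0_le_integral => //.
    + by move=> x _; rewrite lee_fin.
    + by apply/measurable_EFinP; exact: mI.
    + by apply/measurable_EFinP; exact: mI.
    + by move=> x _; rewrite lee_fin ndI.
  by apply: nearW => k; have [Lk hk] := HF k; rewrite RintegralE// lee_fin.
- by move=> k; apply/measurable_EFinP; exact: mI.
- by move=> k x _; rewrite lee_fin.
- by move=> x _ k l kl; rewrite lee_fin ndI.
Unshelve. all: by end_near. Qed.

(** Letting the outer cutoff go to infinity: its error is [nu ^ -4] times
    the mass of [u ^ 2] in a ball, which grows at most like [nu ^ 3]. *)
Lemma L1_tail u rho (B : R) : 0 <= rho -> measurable_fun setT u ->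
  (forall m : R, 1 <= m -> L1 leb (fun x => u x ^+ 2 * \1_(annulus rho m) x) /\
    \int[leb]_x (u x ^+ 2 * \1_(annulus rho m) x) <= B * m) ->
  (forall nu : R, 1 <= nu ->
    [/\ L1 leb (fun x => (weight rho nu x * u x) ^+ 2),
     L1 leb (fun x => u x ^+ 2 * \sum_(i < N) partial [:: i] (weight rho nu) x ^+ 2) &
    2 * \int[leb]_x ((weight rho nu x * u x) ^+ 2 / (1 + sqn x)) <=
    \int[leb]_x (u x ^+ 2 * \sum_(i < N) partial [:: i] (weight rho nu) x ^+ 2)]) ->
  L1 leb (fun x => u x ^+ 2 * \1_[set x | rho + 1 <= sqn x] x).
Proof.
move=> rho0 mU HB HE.
set C1 : R := 384 * (2 * rho + 21) * (2 * rho + 22).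
pose S1 := 2 * rho + 21.
have S11 : 1 <= S1 by rewrite /S1; move: rho0; lra.
have [L1S1 _] := HB _ S11.
pose D := 4 * (C1 * \int[leb]_x (u x ^+ 2 * \1_(annulus rho S1) x) + 384 * B).
have B0 : 0 <= B.
  have [_] := HB 1 (lexx _); rewrite mulr1; apply: le_trans.
  by apply: Rintegral_ge0 => x _; rewrite mulr_ge0 ?sqr_ge0// indicE.
have HD (nu : R) : 1 <= nu ->
    \int[leb]_x ((weight rho nu x * u x) ^+ 2 / (1 + sqn x)) <= D.
  move=> nu1; have nu0 : 0 < nu := lt_le_trans ltr01 nu1.
  have [Lz Ld Hz] := HE nu nu1.
  have nu31 : 1 <= nu ^+ 3 by rewrite exprn_ege1.
  have [Lm Hm] := HB _ nu31.
  have Lz1 := L1_sqn1V Lz.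
  have up : \int[leb]_x (u x ^+ 2 * \sum_(i < N) partial [:: i] (weight rho nu) x ^+ 2) <=
      7 / 4 * (\int[leb]_x ((weight rho nu x * u x) ^+ 2 / (1 + sqn x))) +
      C1 * (\int[leb]_x (u x ^+ 2 * \1_(annulus rho S1) x)) +
      384 * nu ^- 4 * (\int[leb]_x (u x ^+ 2 * \1_(annulus rho (nu ^+ 3)) x)).
    rewrite -!RintegralZl// -!RintegralD//; last first.
    - exact: L1Z.
    - exact: L1Z.
    - exact: L1Z.
    - by apply: L1D; exact: L1Z.
    apply: le_Rintegral => //; first by apply: L1D; [apply: L1D; exact: L1Z|exact: L1Z].
    move=> x _; rewrite !indic_annulus.
    have := ler_wpM2l (sqr_ge0 (u x)) (weight_grad_sq x rho0 nu1).
    move=> h; apply: (le_trans h); rewrite le_eqVlt; apply/orP; left; apply/eqP.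
    by rewrite /C1 /S1; field; rewrite sqn1_neq0 lt0r_neq0.
  have h2 : 384 * nu ^- 4 * (\int[leb]_x (u x ^+ 2 * \1_(annulus rho (nu ^+ 3)) x)) <= 384 * B.
    rewrite -mulrA ler_wpM2l// mulrC ler_pdivrMr ?exprn_gt0//.
    by apply: (le_trans Hm); rewrite ler_wpM2l// ler_weXn2l.
  by rewrite /D; move: Hz up h2; lra.
pose c : R := (flat 1 * flat 2^-1 / 2) ^+ 2.
have c0 : 0 < c.
  by rewrite exprn_gt0// divr_gt0// mulr_gt0 ?flat_gt0// ltr01.
apply: (@L1_exhaustion _ _ (c^-1 * D)) => [|x|k]; first exact: measurable_funX.
  exact: sqr_ge0.
have k2 : 2 <= k.+2%:R :> R by rewrite ler_nat.
have k1 : 1 <= k.+2%:R :> R by rewrite ler1n.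
have [Lz _ _] := HE _ k1.
have Lz1 := L1_sqn1V Lz.
have le x : u x ^+ 2 * \1_(annulus (rho + 1) k.+2%:R) x <=
    c^-1 * ((weight rho k.+2%:R x * u x) ^+ 2 / (1 + sqn x)).
  rewrite indic_annulus.
  have [/andP[xr xk]|xr] := boolP (rho + 1 <= sqn x <= k.+2%:R); last first.
    rewrite mulr0; apply: mulr_ge0; first by rewrite invr_ge0 ltW.
    exact: divr_ge0 (sqr_ge0 _) (ltW (sqn1_gt0 _)).
  rewrite mulr1 [leRHS]mulrA ler_pdivlMr ?sqn1_gt0//.
  rewrite ler_pdivlMl//.
  have := profile_lower k2 xr (sqn_ge0 x) xk; rewrite -/c => h.
  rewrite exprMn mulrCA [leLHS]mulrC; apply: ler_wpM2r; first exact: sqr_ge0.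
  exact: h.
have mk : measurable_fun setT (fun x => u x ^+ 2 * \1_(annulus (rho + 1) k.+2%:R) x).
  apply: measurable_funM; first exact: measurable_funX.
  by apply: measurable_indic; exact: measurable_annulus.
have p0 x : 0 <= u x ^+ 2 * \1_(annulus (rho + 1) k.+2%:R) x.
  by rewrite mulr_ge0 ?sqr_ge0// indicE.
have Lk : L1 leb (fun x => u x ^+ 2 * \1_(annulus (rho + 1) k.+2%:R) x).
  apply: (@L1_le _ _ _ leb _ _ mk _ (L1Z c^-1 Lz1)) => x.
  by rewrite ger0_norm.
split=> //; apply: (@le_trans _ _ (\int[leb]_x (c^-1 * ((weight rho k.+2%:R x * u x) ^+ 2 / (1 + sqn x))))).
  by apply: le_Rintegral => //; exact: L1Z.
by rewrite RintegralZl// ler_wpM2l ?invr_ge0 ?(ltW c0)// HD.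
Qed.

End weighted_energy.

(** * Integrability of the square *)

Section square_integrability.
Context d (T : measurableType d) (R : realType).
Variable mu : {measure set T -> \bar R}.
Implicit Types w : T -> R.

Lemma LfunP_L1 (p : R) w : 0 < p ->
  w \in Lfun mu p%:E <-> measurable_fun setT w /\ L1 mu (fun x => `|w x| `^ p).
Proof.
move=> p0.
have mp : measurable_fun setT w -> measurable_fun setT (fun x => `|w x| `^ p).
  move=> mw; apply: (measurableT_comp (measurable_powR p)).
  exact: measurableT_comp.
have E : ('N[mu]_p%:E[EFin \o w] `^ p = \int[mu]_x (`|w x| `^ p)%:E)%E.
  by rewrite poweR_Lnorm ?gt_eqF.
split=> [wL|[mw Lw]].
  have mw : measurable_fun setT w by exact: (set_mem (sub_Lfun_mfun wL)).
  split=> //; apply/L1_ge0P => [x||]; [exact: powR_ge0|exact: mp|].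
  by rewrite -E poweR_lty//; exact: (set_mem (sub_Lfun_finLfun wL)).
apply/andP; split; rewrite inE//=.
rewrite /finite_norm unlock /=.
apply: poweR_lty; have := mp mw.
by move=> /L1_ge0P -/(_ mu (fun x => powR_ge0 _ _))[/(_ Lw)].
Qed.

Lemma Lfun2P w :
  w \in Lfun mu 2%:E <-> measurable_fun setT w /\ L1 mu (fun x => w x ^+ 2).
Proof.
rewrite LfunP_L1 ?ltr0n//; rewrite (_ : (fun x => _) = (fun x => w x ^+ 2))//.
by apply/funext => x; rewrite powR_mulrn// real_normK// num_real.
Qed.

End square_integrability.

Section growth.
Context (R : realType) (N : nat).
Implicit Types (u : 'rV[R]_N -> R) (V : 'rV[R]_N -> R).
Local Notation leb := (lebesgue_rV R N).

Lemma sqr_indic_ge0 u (A : set 'rV[R]_N) x : 0 <= u x ^+ 2 * \1_A x.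
Proof. by rewrite mulr_ge0 ?sqr_ge0// indicE. Qed.

(** Square integrability away from a ball extends to the ball, since [u]
    differs from a translate of [u] by at most a square integrable function. *)
Lemma L1_inner u (a : R) (i : 'I_N) : 0 <= a -> weakly_differentiable u ->
  L1 leb (fun x => weak_grad u i x ^+ 2) ->
  L1 leb (fun x => u x ^+ 2 * \1_[set x | a <= sqn x] x) ->
  L1 leb (fun x => u x ^+ 2).
Proof.
move=> a0 wu Lg Lu; have [Lu1 _] := wu.
have mU := locally_L1_measurable Lu1.
(* a shift by more than the diameter moves the ball off itself *)
pose h := 2 * Num.sqrt a + 1.
have r0 : 0 <= Num.sqrt a by exact: sqrtr_ge0.
have h0 : 0 < h by rewrite /h; lra.
have [Ld _] := difference_quotient_le Lu1 (weak_grad_spec i wu) Lg h0.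
have Lt := L1_shift i h Lu.
apply: (@L1_le _ _ _ leb _ (fun x => u x ^+ 2 * \1_[set x | a <= sqn x] x +
   (2 * (u (x + h *: delta_mx ord0 i) ^+ 2 *
      \1_[set x | a <= sqn x] (x + h *: delta_mx ord0 i)) +
    2 * (u (x + h *: delta_mx ord0 i) - u x) ^+ 2))).
- exact: measurable_funX.
- move=> x; rewrite ger0_norm ?sqr_ge0//.
  have [ax|xa] := leP a (sqn x).
    rewrite [X in _ <= _ * X + _]indicE mem_set// mulr1 lerDl.
    apply: addr_ge0; last exact: mulr_ge0 (sqr_ge0 _).
    exact: mulr_ge0 (sqr_indic_ge0 _ _ _).
  rewrite [X in _ <= _ * X + _]indicE memNset/=; last by apply/negP; rewrite -ltNge.
  rewrite mulr0 add0r indicE mem_set/=.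
    rewrite mulr1 -subr_ge0.
    apply: (le_trans (sqr_ge0 (u x - 2 * (u x - u (x + h *: delta_mx ord0 i))))).
    by rewrite le_eqVlt; apply/orP; left; apply/eqP; ring.
  rewrite (le_trans _ (coord_sq_le _ i))// !mxE !eqxx/= mulr1.
  have xi : `|x ord0 i| <= Num.sqrt a.
    by rewrite (le_trans (coord_le_enorm x i))// ler_wsqrtr// ltW.
  move: xi; rewrite ler_norml => /andP[x1 x2].
  rewrite -(sqr_sqrtr a0) ler_sqr ?nnegrE// /h; lra.
- by apply: L1D => //; apply: L1D; exact: L1Z.
Qed.

(** With [r = sqrt m] and [P = 2 N / (N - 2)], Young's inequality gives
    [u ^ 2 <= m (r ^- N + |u| ^ P)], and the ball of radius [r] has measure at
    most [(2 r) ^ N]. *)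
Lemma annulus_mass_sobolev u (a m : R) : (2 < N)%N -> 0 < m ->
  u \in Lfun leb ((2 * N%:R) / (N%:R - 2))%:E ->
  L1 leb (fun x => u x ^+ 2 * \1_(annulus a m) x) /\
  \int[leb]_x (u x ^+ 2 * \1_(annulus a m) x) <=
    (2 ^+ N + \int[leb]_x (`|u x| `^ ((2 * N%:R) / (N%:R - 2)))) * m.
Proof.
move=> N2 m0; set P := _ / _ => uL.
have N20 : 0 < N%:R - 2 :> R by rewrite subr_gt0 (ltr_nat _ 2 N).
have P2 : 2 <= P by rewrite /P ler_pdivlMr//; lra.
have /(LfunP_L1 _ _ (lt_le_trans (ltr0n R 2) P2))[mU LP] := uL.
have mI : measurable_fun setT (fun x => u x ^+ 2 * \1_(annulus a m) x).
  apply: measurable_funM; first exact: measurable_funX.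
  by apply: measurable_indic; exact: measurable_annulus.
pose r := Num.sqrt m; have r0 : 0 < r by rewrite sqrtr_gt0.
have rm : r ^+ 2 = m by rewrite sqr_sqrtr// ltW.
have young (y : R) : 0 <= y -> y ^+ 2 <= m * (r ^- N + y `^ P).
  move=> y0; pose b := r `^ ((N%:R - 2) / 2).
  have b0 : 0 < b by exact: powR_gt0.
  have b2 : b ^+ 2 = r ^+ N / m.
    rewrite -rm -powR_mulrn ?(ltW b0)// /b -powRrM divfK ?pnatr_eq0//.
    rewrite powRD ?gt_eqF ?implybT// powR_mulrn ?(ltW r0)//.
    by rewrite powRN powR_mulrn ?(ltW r0).
  have bP : b `^ P = r ^+ N.
    rewrite /b -powRrM (_ : _ * P = N%:R) ?powR_mulrn ?(ltW r0)//.
    by rewrite /P; field; rewrite gt_eqF.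
  (* scale so that the inequality becomes [t ^ 2 <= 1 + t ^ P] *)
  have t1 : (b * y) ^+ 2 <= 1 + (b * y) `^ P.
    have t0 : 0 <= b * y by rewrite mulr_ge0// ltW.
    have [t1|t1] := leP (b * y) 1.
      by rewrite ler_wpDr ?powR_ge0// expr_le1.
    rewrite ler_wpDl// -powR_mulrn//.
    by rewrite ler_powR// ltW.
  rewrite exprMn b2 powRM ?(ltW b0)// bP in t1.
  rewrite -(ler_pM2l (x := r ^+ N / m)) ?divr_gt0 ?exprn_gt0//.
  apply: (le_trans t1); rewrite le_eqVlt; apply/orP; left; apply/eqP.
  by field; rewrite !gt_eqF ?exprn_gt0.
have mB : measurable [set x : 'rV[R]_N | enorm x <= r] by exact: measurable_enorm_le.
have LB : L1 leb (\1_[set x | enorm x <= r]).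
  apply/L1_ge0P => [x||]; [by rewrite indicE|exact: measurable_indic|].
  by rewrite integral_indic// setIT lebesgue_rV_enorm_lty.
pose g x := m * r ^- N * \1_[set x : 'rV[R]_N | enorm x <= r] x + m * `|u x| `^ P.
have Lg : L1 leb g by apply: L1D; exact: L1Z.
have le x : u x ^+ 2 * \1_(annulus a m) x <= g x.
  rewrite indic_annulus /g; have [/andP[_ xm]|_] := boolP (a <= sqn x <= m); last first.
    rewrite mulr0; apply: addr_ge0; last exact: mulr_ge0 (ltW m0) (powR_ge0 _ _).
    apply: mulr_ge0; last by rewrite indicE.
    by rewrite divr_ge0 ?exprn_ge0 ?(ltW m0)// ltW.
  rewrite mulr1 indicE mem_set/=; last by rewrite le_enorm_sqn ?rm// ltW.
  by rewrite mulr1 -mulrDr -(real_normK (num_real (u x))) young.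
have LI : L1 leb (fun x => u x ^+ 2 * \1_(annulus a m) x).
  apply: (@L1_le _ _ _ leb _ g) => // x; by rewrite ger0_norm// sqr_indic_ge0.
split=> //; apply: (le_trans (le_Rintegral measurableT LI Lg (fun x _ => le x))).
rewrite /g RintegralD//; [|exact: L1Z|exact: L1Z].
rewrite !RintegralZl// mulrDl lerD//; last by rewrite mulrC.
rewrite -mulrA mulrC ler_wpM2r ?(ltW m0)//.
have -> : \int[leb]_x \1_[set x | enorm x <= r] x = fine (leb [set x | enorm x <= r]).
  by rewrite /Rintegral integral_indic// setIT.
rewrite ler_pdivrMl ?exprn_gt0// -exprMn mulrC -lee_fin fineK.
  by apply: lebesgue_rV_enorm_le; exact: ltW.
by rewrite ge0_fin_numE// lebesgue_rV_enorm_lty.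
Qed.

(** Here [u ^ 2 <= (m / c) V u ^ 2] on the annulus. *)
Lemma annulus_mass_potential u V (a c m : R) : 0 < c -> 0 < a -> 0 < m ->
  measurable_fun setT u ->
  (forall x, a <= sqn x -> c / sqn x <= V x) ->
  L1 leb (fun x => V x * u x ^+ 2) ->
  L1 leb (fun x => u x ^+ 2 * \1_(annulus a m) x) /\
  \int[leb]_x (u x ^+ 2 * \1_(annulus a m) x) <=
    (c^-1 * \int[leb]_x `|V x * u x ^+ 2|) * m.
Proof.
move=> c0 a0 m0 mU HV LV.
have mI : measurable_fun setT (fun x => u x ^+ 2 * \1_(annulus a m) x).
  apply: measurable_funM; first exact: measurable_funX.
  by apply: measurable_indic; exact: measurable_annulus.
have cm0 : 0 <= c^-1 * m by rewrite mulr_ge0 ?invr_ge0 ?ltW.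
have le x : u x ^+ 2 * \1_(annulus a m) x <= c^-1 * m * `|V x * u x ^+ 2|.
  rewrite indic_annulus; have [/andP[ax xm]|_] := boolP (a <= sqn x <= m); last first.
    by rewrite mulr0 mulr_ge0.
  rewrite mulr1 normrM [`|u x ^+ 2|]ger0_norm ?sqr_ge0// mulrA ler_peMl ?sqr_ge0//.
  have s0 : 0 < sqn x by rewrite (lt_le_trans a0).
  rewrite -mulrA ler_pdivlMl// mulr1.
  have := HV x ax; rewrite ler_pdivrMr// => h.
  apply: (le_trans h); rewrite mulrC.
  by apply: ler_pM => //; [exact: ltW | exact: le_trans (ltW (divr_gt0 c0 s0)) (HV x ax) | exact: ler_norm].
have LI : L1 leb (fun x => u x ^+ 2 * \1_(annulus a m) x).
  apply: (@L1_le _ _ _ leb _ _ mI _ (L1Z _ (L1_norm LV))) => x.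
  by rewrite ger0_norm ?sqr_indic_ge0// le.
split=> //; rewrite mulrAC -RintegralZl//; last exact: L1_norm.
by apply: le_Rintegral => //; apply: L1Z; exact: L1_norm.
Qed.

End growth.

(** * The energy space *)

Section energy_space.
Context (R : realType) (N : nat).
Implicit Types (u w p : 'rV[R]_N -> R) (V : 'rV[R]_N -> R).
Local Notation leb := (lebesgue_rV R N).

(** The absolute value makes the density nonnegative everywhere. *)
Definition energy_density eps V w x : R :=
  eps ^+ 2 * weak_grad_sq w x + `|V x| * w x ^+ 2.

Lemma normrM_sqr (a b : R) : `|a * b ^+ 2| = `|a| * b ^+ 2.
Proof. by rewrite normrM [`|b ^+ 2|]ger0_norm// sqr_ge0. Qed.

Lemma weak_grad_sq_ge0 w x : 0 <= weak_grad_sq w x.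
Proof. by apply: sumr_ge0 => i _; exact: sqr_ge0. Qed.

Lemma energy_density_ge0 eps V w x : 0 <= energy_density eps V w x.
Proof. by rewrite addr_ge0// mulr_ge0 ?sqr_ge0 ?weak_grad_sq_ge0. Qed.

Lemma ae_neq0 : (0 < N)%N -> {ae leb, forall x, x != 0}.
Proof.
move=> N0; exists [set 0]; split.
- apply: closed_measurable_rV; apply: accessible_closed_set1.
  by apply: hausdorff_accessible; exact: norm_hausdorff.
- exact: lebesgue_rV_set1.
- by move=> x /= /negP; rewrite negbK => /eqP.
Qed.

Variable V : 'rV[R]_N -> R.
Hypothesis N0 : (0 < N)%N.
Hypothesis mV : measurable_fun setT V.
Hypothesis V0 : forall x, x != 0 -> 0 <= V x.

Lemma measurable_energy_density eps w : weakly_differentiable w ->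
  measurable_fun setT (energy_density eps V w).
Proof.
move=> ww; apply: measurable_funD; apply: measurable_funM => //.
- apply: measurable_sum => i; apply: measurable_funX.
  exact: weak_grad_measurable.
- exact: measurableT_comp.
- by apply: measurable_funX; case: ww => /locally_L1_measurable.
Qed.

(** The potential may be negative at the origin, but this is a null set. *)
Lemma norm_sqE eps w : weakly_differentiable w ->
  (norm_sq eps V w = \int[leb]_x (energy_density eps V w x)%:E)%E.
Proof.
move=> ww; have mw : measurable_fun setT w by case: ww => /locally_L1_measurable.
apply: ae_eq_integral => //.
- apply/measurable_EFinP; apply: measurable_funD; apply: measurable_funM => //.
    by apply: measurable_sum => i; apply: measurable_funX; exact: weak_grad_measurable.
  exact: measurable_funX.
- by apply/measurable_EFinP; exact: measurable_energy_density.
- apply: filterS (ae_neq0 N0) => x x0 _ /=.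
  by rewrite /energy_density ger0_norm// V0.
Qed.

Lemma norm_sq_ge0 eps w : weakly_differentiable w -> (0 <= norm_sq eps V w)%E.
Proof.
move=> ww; rewrite norm_sqE//; apply: integral_ge0 => x _.
by rewrite lee_fin energy_density_ge0.
Qed.

Lemma norm_sq_lty eps w : 0 < eps -> weakly_differentiable w ->
  (norm_sq eps V w < +oo)%E <->
  (forall i, L1 leb (fun x => weak_grad w i x ^+ 2)) /\ L1 leb (fun x => V x * w x ^+ 2).
Proof.
move=> eps0 ww; have mw : measurable_fun setT w by case: ww => /locally_L1_measurable.
have me := measurable_energy_density eps ww.
rewrite norm_sqE//; have <- := @L1_ge0P _ _ _ leb _ (energy_density_ge0 eps V w) me.
split=> [Le|[Lg LV]].
  split=> [i|].
    apply: (@L1_le _ _ _ leb _ (fun x => eps ^- 2 * energy_density eps V w x)).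
    - by apply: measurable_funX; exact: weak_grad_measurable.
    - move=> x; rewrite ger0_norm ?sqr_ge0// ler_pdivlMl ?exprn_gt0//.
      apply: ler_wpDr; first by rewrite mulr_ge0 ?sqr_ge0.
      rewrite ler_wpM2l ?sqr_ge0// /weak_grad_sq (bigD1 i)//= lerDl.
      by apply: sumr_ge0 => j _; exact: sqr_ge0.
    - exact: L1Z.
  apply: (@L1_le _ _ _ leb _ (energy_density eps V w)) => //.
    by apply: measurable_funM => //; exact: measurable_funX.
  move=> x; rewrite normrM_sqr lerDr mulr_ge0 ?sqr_ge0//.
  exact: weak_grad_sq_ge0.
apply: (L1D (L1Z (eps ^+ 2) (L1_sum (index_enum 'I_N) Lg))).
by under eq_fun do rewrite -normrM_sqr; exact: L1_norm.
Qed.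

(** In dimension 2 this holds because [u] is at finite distance from a test
    function of finite energy. *)
Lemma weighted_H1_finite eps u : 0 < eps -> weighted_H1 eps V u ->
  [/\ weakly_differentiable u, forall i, L1 leb (fun x => weak_grad u i x ^+ 2) &
    L1 leb (fun x => V x * u x ^+ 2)].
Proof.
move=> eps0; rewrite /weighted_H1; case: ifP => N2.
  move=> [[wu _ Lg] LV]; split => // [i|]; first by have [] := (Lfun2P _ _).1 (Lg i).
  have mw : measurable_fun setT u by case: wu => /locally_L1_measurable.
  have mVu : measurable_fun setT (fun x => V x * u x ^+ 2).
    by apply: measurable_funM => //; exact: measurable_funX.
  have L : L1 leb (fun x => `|V x * u x ^+ 2|).
    apply/L1_ge0P => //; first exact: measurableT_comp.
    apply: le_lt_trans LV; rewrite le_eqVlt; apply/orP; left; apply/eqP.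
    apply: ae_eq_integral => //.
    - by apply/measurable_EFinP; exact: measurableT_comp.
    - exact/measurable_EFinP.
    - apply: filterS (ae_neq0 N0) => x x0 _ /=.
      by rewrite ger0_norm// mulr_ge0 ?sqr_ge0// V0.
  by apply: (@L1_le _ _ _ leb _ _ mVu _ L).
move=> [wu [phi [phiP cvphi]]].
have : \forall j \near \oo, (norm_sq eps V (fun x => (u x - phi j x)%R) < +oo)%E.
  by move/fine_cvgP: cvphi => [+ _]; apply: filterS => j; rewrite fin_numElt => /andP[].
move=> [j _ /(_ j (leqnn j))/= hj].
have [tphi /= phioo] := phiP j.
have wphi := test_weakly_differentiable tphi.
have ww : weakly_differentiable (fun x => u x - phi j x).
  have := weakly_differentiableD (-1) wu wphi.
  by under eq_fun do rewrite mulN1r.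
have [Lgw LVw] := (norm_sq_lty eps0 ww).1 hj.
have [Lgp LVp] := (norm_sq_lty eps0 wphi).1 phioo.
have uE : u = fun x => (u x - phi j x) + 1 * phi j x.
  by apply/funext => x; rewrite mul1r subrK.
have mg i := weak_grad_measurable i wu.
have mw : measurable_fun setT u by case: wu => /locally_L1_measurable.
have sq2 (a b : R) : (a + b) ^+ 2 <= 2 * a ^+ 2 + 2 * b ^+ 2.
  by have := sqr_ge0 (a - b); lra.
split=> // [i|].
  apply: (@L1_le_ae _ _ _ leb _ (fun x => 2 * weak_grad (fun x => u x - phi j x) i x ^+ 2 +
     2 * weak_grad (phi j) i x ^+ 2) _ _ _).1.
  - exact: measurable_funX.
  - have := weak_gradD 1 i ww wphi; rewrite -uE; apply: filterS => x ->.
    by rewrite mul1r ger0_norm ?sqr_ge0.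
  - by apply: L1D; exact: L1Z.
apply: (@L1_le _ _ _ leb _ (fun x => 2 * `|V x * (u x - phi j x) ^+ 2| +
     2 * `|V x * phi j x ^+ 2|)).
- by apply: measurable_funM => //; exact: measurable_funX.
- move=> x; rewrite !normrM_sqr.
  have := ler_wpM2l (normr_ge0 (V x)) (sq2 (u x - phi j x) (phi j x)).
  by rewrite subrK; lra.
- by apply: L1D; apply: L1Z; exact: L1_norm.
Qed.

Variables (p : 'rV[R]_N -> R) (S : set 'rV[R]_N).
Hypothesis tp : test_function p.
Hypothesis pS : forall x, ~ S x -> p x = 0 /\ forall i, partial [:: i] p x = 0.

Lemma test_bounds : exists2 D : R, 0 < D &
  forall x, p x ^+ 2 <= D /\ forall i, partial [:: i] p x ^+ 2 <= D * \1_S x.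
Proof.
have sq_bound (a : 'rV[R]_N -> R) : test_function a -> exists2 D, 0 <= D & forall x, a x ^+ 2 <= D.
  move=> ta; have [r [D [aD _]]] := test_bounded ta.
  exists (D ^+ 2) => [|x]; first exact: sqr_ge0.
  by rewrite -(real_normK (num_real (a x))) ler_sqr ?nnegrE// (le_trans _ (aD x)).
have [D0 D00 HD0] := sq_bound p tp.
have [D HD] : {D : 'I_N -> R & forall i, 0 <= D i /\ forall x, partial [:: i] p x ^+ 2 <= D i}.
  apply: (@boolp.choice _ _ (fun i D => 0 <= D /\ forall x, partial [:: i] p x ^+ 2 <= D)) => i.
  by have [E E0 HE] := sq_bound _ (test_partial i tp); exists E.
have DD i : D i <= \sum_(j < N) D j.
  by rewrite (bigD1 i)//= lerDl sumr_ge0// => j _; have [] := HD j.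
have sD : 0 <= \sum_(j < N) D j by apply: sumr_ge0 => j _; have [] := HD j.
exists (1 + D0 + \sum_(j < N) D j) => [|x]; first by rewrite ltr_wpDr// ltr_wpDr.
split=> [|i]; first by have := HD0 x; move: sD; lra.
have [xS|xS] := pselect (S x).
  rewrite indicE mem_set// mulr1; have [_ /(_ x)] := HD i.
  by have := DD i; move: D00; lra.
by rewrite (pS xS).2 expr0n indicE memNset// mulr0.
Qed.

(** The Leibniz rule, with one constant for the bounds on [p] and its gradient. *)
Lemma weak_grad_mul_sq : exists2 D : R, 0 < D & forall w, weakly_differentiable w ->
  {ae leb, forall x, forall i, weak_grad (fun x => p x * w x) i x ^+ 2 <=
     D * weak_grad w i x ^+ 2 + D * (w x ^+ 2 * \1_S x)} /\ forall x, (p x * w x) ^+ 2 <= D * w x ^+ 2.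
Proof.
have [D D0 HD] := test_bounds; exists (2 * D) => [|w ww]; first by rewrite mulr_gt0.
split.
  apply: ae_forall_ord => i; apply: filterS (weak_gradM i ww tp.1) => x ->.
  have [h1 /(_ i) h2] := HD x.
  have := sqr_ge0 (p x * weak_grad w i x - partial [:: i] p x * w x).
  have := ler_wpM2r (sqr_ge0 (weak_grad w i x)) h1.
  have := ler_wpM2r (sqr_ge0 (w x)) h2.
  by lra.
move=> x; have [h1 _] := HD x.
rewrite exprMn (le_trans (ler_wpM2r (sqr_ge0 _) h1))// ler_wpM2r ?sqr_ge0//.
by move: D0; lra.
Qed.

Lemma weakly_differentiable_mul w : weakly_differentiable w ->
  weakly_differentiable (fun x => p x * w x).
Proof. by move=> ww; apply: weakly_differentiableM => //; case: tp. Qed.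

(** Multiplication by [p] is bounded in the energy norm as soon as [V] is
    bounded from below on the support of [p]. *)
Lemma norm_sq_mul eps (c : R) : 0 < eps -> 0 < c -> (forall x, S x -> c <= V x) ->
  exists2 D : R, 0 < D & forall w, weakly_differentiable w ->
    (norm_sq eps V (fun x => (p x * w x)%R) <= D%:E * norm_sq eps V w)%E.
Proof.
move=> eps0 c0 Vc; have [D D0 HD] := weak_grad_mul_sq.
have [D' D'0 DD'] : exists2 D', 0 < D' & D <= D' /\ eps ^+ 2 * N%:R * D / c + D <= D'.
  have c1 : 0 <= eps ^+ 2 * N%:R * D / c.
    by rewrite divr_ge0 ?mulr_ge0 ?sqr_ge0// ltW.
  by exists (eps ^+ 2 * N%:R * D / c + D); [rewrite ltr_wpDl | rewrite lerDr].
exists D' => // w ww; have wpw := weakly_differentiable_mul ww.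
have [hw|hw] := ltP (norm_sq eps V w) +oo%E; last first.
  by move: hw; rewrite leye_eq => /eqP ->; rewrite gt0_muley ?lte_fin// leey.
have [H1 H2] := HD w ww.
have mew := measurable_energy_density eps ww.
have mepw := measurable_energy_density eps wpw.
rewrite !norm_sqE// in hw *.
have Lw := (L1_ge0P _ (energy_density_ge0 eps V w) mew).2 hw.
have [Lpw le] : L1 leb (energy_density eps V (fun x => p x * w x)) /\
    \int[leb]_x `|energy_density eps V (fun x => p x * w x) x| <=
    \int[leb]_x (D' * energy_density eps V w x).
  apply: L1_le_ae => //; last exact: L1Z.
  apply: filterS H1 => x H1.
  rewrite ger0_norm ?energy_density_ge0// /energy_density.
  have e0 : 0 <= eps ^+ 2 by exact: sqr_ge0.
  have g1 : weak_grad_sq (fun x => p x * w x) x <=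
      D * weak_grad_sq w x + N%:R * (D * (w x ^+ 2 * \1_S x)).
    rewrite /weak_grad_sq; apply: le_trans (ler_sum _ (fun i _ => H1 i)) _.
    by rewrite big_split/= -mulr_sumr sumr_const card_ord mulr_natl.
  have g2 : c * (w x ^+ 2 * \1_S x) <= `|V x| * w x ^+ 2.
    have [xS|xS] := pselect (S x).
      rewrite indicE mem_set// mulr1 ler_wpM2r ?sqr_ge0//.
      exact: le_trans (Vc x xS) (ler_norm _).
    by rewrite indicE memNset// !mulr0 mulr_ge0 ?sqr_ge0.
  have g3 : `|V x| * (p x * w x) ^+ 2 <= D * (`|V x| * w x ^+ 2).
    by rewrite [leRHS]mulrCA ler_wpM2l.
  have G0 := weak_grad_sq_ge0 w x.
  have W0 : 0 <= `|V x| * w x ^+ 2 by rewrite mulr_ge0 ?sqr_ge0.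
  move: G0 W0 g1 g2 g3 DD'.
  set G := weak_grad_sq w x; set G' := weak_grad_sq _ x.
  set A := `|V x| * w x ^+ 2; set A' := `|V x| * _; set Z := w x ^+ 2 * _.
  move=> G0 W0 g1 g2 g3 [DD1 DD2].
  have h1 : eps ^+ 2 * G' <= eps ^+ 2 * (D * G) + eps ^+ 2 * N%:R * D * Z.
    by have := ler_wpM2l e0 g1; rewrite mulrDr !mulrA.
  have h2 : eps ^+ 2 * (D * G) <= D' * (eps ^+ 2 * G).
    by rewrite [leLHS]mulrCA; apply: ler_wpM2r => //; exact: mulr_ge0.
  have h3 : eps ^+ 2 * N%:R * D * Z <= eps ^+ 2 * N%:R * D / c * A.
    rewrite -[leRHS]mulrA; apply: ler_wpM2l; last by rewrite ler_pdivlMl.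
    by rewrite !mulr_ge0// ltW.
  have h4 := ler_wpM2r W0 DD2.
  by move: h1 h2 h3 h4 g3; lra.
rewrite RintegralE// RintegralE// -EFinM lee_fin -RintegralZl//.
by apply: le_trans le; apply: le_Rintegral => //; [exact: L1_norm | move=> x _; exact: ler_norm].
Qed.

(** Multiplying by a test function supported away from the singularity of [V]
    preserves the energy space. In dimension 2 the approximating test
    functions are multiplied too, which uses a lower bound for [V]. *)
Lemma weighted_H1_mul eps u (c : R) : 0 < eps -> weighted_H1 eps V u ->
  L1 leb (fun x => u x ^+ 2 * \1_S x) ->
  (2 < N)%N \/ 0 < c /\ (forall x, S x -> c <= V x) ->
  weighted_H1 eps V (fun x => p x * u x).
Proof.
move=> eps0 Hu LS HV; have [wu Lg LV] := weighted_H1_finite eps0 Hu.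
have wpu := weakly_differentiable_mul wu.
have mU : measurable_fun setT u by case: wu => /locally_L1_measurable.
have mp := test_measurable tp.
move: Hu HV; rewrite /weighted_H1; case: ifP => N2.
  move=> [[_ uL _] _] _; have N20 : 0 < N%:R - 2 :> R by rewrite subr_gt0 (ltr_nat _ 2 N).
  have [D D0 HD] := weak_grad_mul_sq; have [H1 H2] := HD u wu.
  have P0 : 0 < (2 * N%:R) / (N%:R - 2) :> R.
    by rewrite divr_gt0// mulr_gt0// ltr0n.
  split; first split=> //.
  - move: uL => /(LfunP_L1 _ _ P0)[_ LP]; apply/(LfunP_L1 _ _ P0); split.
      exact: measurable_funM.
    have [r [C [pC _]]] := test_bounded tp.
    apply: (@L1_le _ _ _ leb _ (fun x => C `^ ((2 * N%:R) / (N%:R - 2)) *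
        `|u x| `^ ((2 * N%:R) / (N%:R - 2)))); last exact: L1Z.
      apply: (measurableT_comp (measurable_powR _)).
      by apply: measurableT_comp => //; exact: measurable_funM.
    move=> x; rewrite ger0_norm ?powR_ge0// normrM powRM//.
    by rewrite ler_wpM2r ?powR_ge0// ge0_ler_powR// ?ltW// nnegrE (le_trans _ (pC x)).
  - move=> i; apply/Lfun2P; split; first exact: weak_grad_measurable.
    apply: (@L1_le_ae _ _ _ leb _ (fun x => D * weak_grad u i x ^+ 2 + D * (u x ^+ 2 * \1_S x)) _ _ _).1.
    + by apply: measurable_funX; exact: weak_grad_measurable.
    + by apply: filterS H1 => x /(_ i); rewrite ger0_norm ?sqr_ge0.
    + by apply: L1D; exact: L1Z.
  - have L : L1 leb (fun x => V x * (p x * u x) ^+ 2).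
      apply: (@L1_le _ _ _ leb _ (fun x => D * `|V x * u x ^+ 2|)).
      + by apply: measurable_funM => //; apply: measurable_funX; exact: measurable_funM.
      + move=> x; rewrite !normrM_sqr [leRHS]mulrCA.
        by rewrite ler_wpM2l.
      + by apply: L1Z; exact: L1_norm.
    by rewrite RintegralE// ltry.
move=> [_ [phi [phiP cvphi]]] [//|[c0 Vc]]; split=> //.
have [D D0 HD] := norm_sq_mul eps0 c0 Vc.
have wphi j := test_weakly_differentiable (phiP j).1.
exists (fun j x => p x * phi j x); split=> [j|].
  split; first by apply: test_smoothM => //; case: (phiP j).1.
  apply: le_lt_trans (HD _ (wphi j)) _.
  have h := (phiP j).2; have h0 := norm_sq_ge0 eps (wphi j).
  by rewrite lte_mul_pinfty// lee_fin ltW.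
have ww j : weakly_differentiable (fun x => u x - phi j x).
  by have := weakly_differentiableD (-1) wu (wphi j); under eq_fun do rewrite mulN1r.
have E j : (fun x => p x * u x - p x * phi j x) = (fun x => p x * (u x - phi j x)).
  by apply/funext => x; rewrite mulrBr.
under eq_fun do rewrite E.
have cv0 : ((fun j => D%:E * norm_sq eps V (fun x => (u x - phi j x)%R)) @ \oo --> 0)%E.
  by rewrite -[X in _ --> X](mule0 D%:E); apply: cvgeZl.
apply: (squeeze_cvge _ (@cvg_cst _ _ _ _ _) cv0).
apply: nearW => j; rewrite HD// andbT; apply: norm_sq_ge0.
exact: weakly_differentiable_mul.
Qed.

End energy_space.

(** * Square integrability of least-energy solutions *)

Section conclusion.
Context (R : realType) (N : nat).
Implicit Types (u V K : 'rV[R]_N -> R) (H : 'M[R]_N) (Lam : set 'rV[R]_N).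
Local Notation leb := (lebesgue_rV R N).

Lemma limf_einf_gt0 (F : 'rV[R]_N -> R) :
  (0 < limf_einf (fun x => (F x)%:E) (@rV_infty R N))%E ->
  exists c r : R, 0 < c /\ forall x, r < enorm x -> c <= F x.
Proof.
rewrite limf_einfE => /ereal_sup_gt[_ [A [r Ar] <-]].
move Ee : (ereal_inf _) => e; have lb x : A x -> (e <= (F x)%:E)%E.
  by move=> Ax; rewrite -Ee; apply: ereal_inf_lbound; exists x.
case: e Ee lb => [c||//] _ lb; first by rewrite lte_fin => c0;
  exists c, r; split=> // x /Ar/lb; rewrite lee_fin.
by move=> _; exists 1, r; split=> // x /Ar/lb; rewrite leye_eq.
Qed.

Section penalty.
Variables (kappa beta : R).
Hypotheses (kappa0 : 0 <= kappa) (beta0 : 0 < beta).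
Implicit Types x : 'rV[R]_N.

Lemma penalty_ge0 x : 0 <= penalty_potential kappa beta x.
Proof.
have h : 0 <= kappa / enorm x ^+ 2 by rewrite divr_ge0// sqr_ge0.
by rewrite /penalty_potential; case: ifP => _; rewrite mulr_ge0// powR_ge0.
Qed.

Lemma powRN_le1 (y a : R) : 1 <= y -> 0 <= a -> y `^ (- a) <= 1.
Proof.
move=> y1 a0; rewrite -[leRHS](powRr0 y); apply: ler_powR => //.
by rewrite oppr_le0.
Qed.

Lemma penalty_le x : penalty_potential kappa beta x <= kappa / sqn x.
Proof.
have h : 0 <= kappa / enorm x ^+ 2 by rewrite divr_ge0// sqr_ge0.
rewrite -enorm_sq /penalty_potential; have b0 := ltW beta0.
by case: ifP => _; rewrite ler_piMr// powRN_le1 ?divr_ge0 ?addr_ge0//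
  (lerDl, lerDr) sqr_ge0.
Qed.

(** The logarithm makes the penalty potential small compared with [|x| ^ -2]. *)
Lemma penalty_small (delta : R) : (2 < N)%N -> 0 < delta ->
  exists2 r : R, 1 <= r &
    forall x, r <= enorm x -> penalty_potential kappa beta x <= delta / sqn x.
Proof.
move=> N2 delta0; exists (expR (kappa / delta)) => [|x rx].
  by rewrite -expR0 ler_expR divr_ge0// ltW.
have x0 : 0 < enorm x by rewrite (lt_le_trans _ rx)// expR_gt0.
have lx : kappa / delta <= ln (enorm x).
  by rewrite -(expRK (kappa / delta)) ler_ln// posrE expR_gt0.
rewrite /penalty_potential N2 -enorm_sq mulrAC ler_wpM2r ?invr_ge0 ?sqr_ge0//.
set L := ln (enorm x) in lx *; have l0 : 0 <= L by rewrite (le_trans _ lx)// divr_ge0// ltW.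
have L1 : 1 <= L ^+ 2 + 1 by rewrite lerDr sqr_ge0.
have a12 : - ((1 + beta) / 2) <= - 2^-1.
  by rewrite lerN2 ler_pdivlMr// mulVf ?pnatr_eq0// lerDl ltW.
apply: (@le_trans _ _ (kappa * (L ^+ 2 + 1) `^ (- 2^-1))).
  by rewrite ler_wpM2l// ler_powR.
rewrite powRN powR12_sqrt ?addr_ge0 ?sqr_ge0//.
have s0 : 0 < Num.sqrt (L ^+ 2 + 1) by rewrite sqrtr_gt0 (lt_le_trans ltr01).
rewrite ler_pdivrMr// -ler_pdivrMl// mulrC (le_trans lx)//.
by rewrite -[leLHS]ger0_norm// -sqrtr_sqr ler_wsqrtr// lerDl.
Qed.

Lemma measurable_penalty : measurable_fun setT (@penalty_potential R N kappa beta).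
Proof.
have mL : measurable_fun setT (fun x : 'rV[R]_N => ln (enorm x) ^+ 2).
  apply: measurable_funX; apply: measurableT_comp; [exact: measurable_ln|exact: measurable_enorm].
have me : measurable_fun setT (fun x : 'rV[R]_N => kappa * enorm x ^- 2).
  apply: measurable_funM => //.
  under eq_fun do rewrite -powR_invn ?enorm_ge0//.
  exact: (measurableT_comp (measurable_powR _) (@measurable_enorm R N)).
rewrite /penalty_potential; case: (2 < N)%N; apply: measurable_funM => //;
  apply: (measurableT_comp (measurable_powR _)); exact: measurable_funD.
Qed.

End penalty.

Lemma sqn_isometry (Q : 'M[R]_N) (x : 'rV[R]_N) : Q *m Q^T = 1%:M -> sqn (x *m Q) = sqn x.
Proof.
move=> QQ; have E (y : 'rV[R]_N) : sqn y = (y *m y^T) ord0 ord0.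
  by rewrite mxE; apply: eq_bigr => i _; rewrite mxE expr2.
by rewrite !E trmx_mul mulmxA -(mulmxA x) QQ mulmx1.
Qed.

(** The weighted energy estimate applies as soon as the quadratic form
    [|grad z| ^ 2 + W z ^ 2] controls twice the Hardy weight outside of a ball. *)
Lemma least_energy_Lfun2 H V K (f : R -> R) Lam h (mu eps : R) u (rho C B : R) :
  (2 <= N)%N -> {within `[0, +oo[, continuous f} -> (forall s, 0 <= s -> 0 <= f s) ->
  measurable_fun setT V -> measurable_fun setT h -> (forall x, x != 0 -> 0 <= V x) ->
  0 <= mu -> 0 < eps -> 0 <= rho ->
  positive_least_energy_solution H V K f Lam h mu eps u ->
  (forall x, rho <= sqn x -> [/\ ~ Lam x, 0 <= K x, 0 <= V x & 0 <= h x <= C]) ->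
  (forall m : R, 1 <= m -> L1 leb (fun x => u x ^+ 2 * \1_(annulus rho m) x) /\
    \int[leb]_x (u x ^+ 2 * \1_(annulus rho m) x) <= B * m) ->
  (2 < N)%N \/ (forall m : R, 1 <= m -> exists2 c : R, 0 < c &
    forall x, rho <= sqn x <= m -> c <= V x) ->
  (5 <= N)%N /\ (forall x, rho <= sqn x ->
      - (4 * (1 + sqn x))^-1 <= eps ^- 2 * ((1 - mu) * V x) - h x) \/
  (forall x, rho <= sqn x ->
      2 / (1 + sqn x) <= eps ^- 2 * ((1 - mu) * V x) - h x) ->
  u \in Lfun leb 2%:E.
Proof.
move=> N2 cf f0 mV mh V0 mu0 eps0 rho0 [[Hu symu] crit _ _] HS mass HV HW.
have N0 : (0 < N)%N := ltnW N2.
have [wu Lg LVu] := weighted_H1_finite N0 mV V0 eps0 Hu.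
have mU : measurable_fun setT u by case: wu => /locally_L1_measurable.
have i0 : 'I_N := Ordinal N0.
apply/Lfun2P; split=> //.
apply: (L1_inner (a := rho + 1) (i := i0)) => //; first by rewrite addr_ge0.
apply: (L1_tail rho0 mU mass) => nu nu1.
have nu0 : 0 < nu := lt_le_trans ltr01 nu1.
have nu31 : 1 <= nu ^+ 3 by rewrite exprn_ege1.
have [LS _] := mass _ nu31.
have tq := @test_weight _ N rho nu nu0.
have tp : test_function (fun x : 'rV[R]_N => weight rho nu x ^+ 2).
  rewrite (_ : (fun x => _) = fun x : 'rV[R]_N => weight rho nu x * weight rho nu x)//.
  by apply: test_smoothM => //; case: tq.
have pS x : ~ annulus rho (nu ^+ 3) x -> weight rho nu x ^+ 2 = 0 /\
    forall i, partial [:: i] (fun x : 'rV[R]_N => weight rho nu x ^+ 2) x = 0.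
  move=> /negP nS; have [w0 dw0] := weight_out nu0 nS.
  rewrite w0 expr0n; split=> // i.
  rewrite (_ : (fun x => _) = fun x : 'rV[R]_N => weight rho nu x * weight rho nu x)//.
  by rewrite partialM ?w0 ?mul0r ?addr0//; case: tq.
have HVc : (2 < N)%N \/ exists2 c : R, 0 < c & forall x, annulus rho (nu ^+ 3) x -> c <= V x.
  by case: HV => [|HV]; [left|right; exact: HV].
have Hpu : weighted_H1 eps V (fun x => weight rho nu x ^+ 2 * u x).
  case: HVc => [N3|[c c0 Vc]].
    exact: (@weighted_H1_mul _ _ V N0 mV V0 _ _ tp pS eps u 1 eps0 Hu LS (or_introl N3)).
  by apply: (@weighted_H1_mul _ _ V N0 mV V0 _ _ tp pS eps u c eps0 Hu LS); right.
have dJ := crit (fun x => weight rho nu x ^+ 2 * u x).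
have {}dJ : directional_derivative (penalized_functional V K f Lam h mu eps) u
    (fun x => weight rho nu x ^+ 2 * u x) 0.
  apply: dJ; split=> // Q HQ; apply: filterS (symu Q HQ) => x ->.
  by rewrite /weight sqn_isometry//; case: HQ.
have [Lz LG LW Ld E] := weighted_energy cf f0 mV mh wu Lg LVu nu0 LS HS mu0 eps0 dJ.
split=> //; apply: le_trans E; case: HW => [[N5 HW]|HW].
  exact: (weighted_energy_hardy N5 wu nu0 erefl Lz LG LW HW).
exact: (weighted_energy_potential nu0 erefl Lz LW HW).
Qed.

End conclusion.

Theorem corollary5p7 (R : realType) (N k : nat) (H : 'M[R]_N)
    (V K : 'rV[R]_N -> R) (f : R -> R) (p q theta : R) (Lam : set 'rV[R]_N)
    (mu beta kappa : R) :
  (2 <= N)%N -> (1 <= k <= N - 1)%N ->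
  \rank H = (N - k - 1)%N ->
  potentials H V K ->
  nonlinearity (N - k) p q theta f ->
  growth_infty V K q ->
  growth_origin V K ->
  concentration_region k H V K f Lam ->
  0 < mu < 1 -> 0 < beta -> admissible_kappa V kappa ->
  (5 <= N)%N \/
    (0 < limf_einf (fun x => (enorm x ^+ 2 * V x)%:E) (@rV_infty R N))%E ->
  \forall eps \near (0 : R)^'+, forall u : 'rV[R]_N -> R,
    positive_least_energy_solution H V K f Lam
      (penalty_potential kappa beta) mu eps u ->
    u \in Lfun (lebesgue_rV R N) 2%:E.
Proof.
move=> N2 _ _ [cV cK V0 K0 _ _ _] [cf f0 _ _ _ _ _ _ _ _] _ _ region /andP[mu0 mu1] beta0 kap HN.
have kappa0 : 0 <= kappa.
  move: kap; rewrite /admissible_kappa; case: ifP => _; first by move=> /andP[/ltW].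
  by move=> [? [_ _ /andP[/ltW]]].
have mV := measurable_fun_punctured cV.
have mh := @measurable_penalty R N kappa beta.
have [rL rL0 HL] := bounded_enorm (region_bounded region).
have mu1' : 0 <= 1 - mu by rewrite subr_ge0 ltW.
(* far from the origin and from [Lam], all signs are as required *)
have far r x : 1 <= r -> rL + 1 <= r -> r ^+ 2 <= sqn x ->
    [/\ ~ Lam x, 0 <= K x, 0 <= V x, 0 <= penalty_potential kappa beta x <= kappa &
      1 <= sqn x].
  move=> r1 rr rx; have r0 : 0 <= r := le_trans ler01 r1.
  have s1 : 1 <= sqn x by apply: le_trans rx; rewrite exprn_ege1.
  have s0 : 0 < sqn x := lt_le_trans ltr01 s1.
  have x0 : x != 0.
    by apply: contraTneq s0 => ->; rewrite /sqn big1 ?ltxx// => i _; rewrite mxE expr0n.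
  have ex : r <= enorm x by rewrite -ler_sqr ?nnegrE ?enorm_ge0// enorm_sq.
  split=> //; [|exact: K0|exact: V0|].
    by move=> /HL; rewrite leNgt (lt_le_trans _ ex)// (lt_le_trans _ rr)// ltrDl.
  rewrite penalty_ge0//= (le_trans (penalty_le kappa0 beta0 x))//.
  by rewrite ler_piMr// invf_le1.
case: HN => [N5|HV].
  near=> eps => u Hu.
  have eps0 : 0 < eps by [].
  have N3 : (2 < N)%N := ltn_trans (isT : 2 < 4)%N N5.
  have d0 : 0 < 8^-1 :> R by rewrite invr_gt0.
  have [r1 r11 Hr1] := penalty_small kappa0 beta0 N3 d0.
  pose r := r1 + rL + 1; pose rho := r ^+ 2.
  have r1' : 1 <= r by rewrite /r; move: r11 rL0; lra.
  have rr : rL + 1 <= r by rewrite /r; move: r11; lra.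
  have [[Hsym _] _ _ _] := Hu; have uL : sobolev_D12 u.
    by move: Hsym; rewrite /weighted_H1 N3 => -[].
  have [_ uP _] := uL.
  apply: (least_energy_Lfun2 (rho := rho) (C := kappa)
    (B := 2 ^+ N + \int[lebesgue_rV R N]_x (`|u x| `^ ((2 * N%:R) / (N%:R - 2))))
    N2 cf f0 mV mh V0 (ltW mu0) eps0 (sqr_ge0 r) Hu).
  - by move=> x /(far r x r1' rr)[].
  - by move=> m m1; apply: annulus_mass_sobolev => //; exact: lt_le_trans m1.
  - by left.
  - left; split=> // x rx; have [_ _ Vx _ s1] := far r x r1' rr rx.
    have ex : r1 <= enorm x.
      rewrite -ler_sqr ?nnegrE ?enorm_ge0 ?(le_trans ler01 r11)// enorm_sq.
      apply: le_trans rx; rewrite ler_sqr ?nnegrE ?(le_trans ler01)// /r.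
      by move: rL0; lra.
    have s0 : 0 < sqn x := lt_le_trans ltr01 s1.
    apply: (@le_trans _ _ (- penalty_potential kappa beta x)).
      rewrite lerN2 (le_trans (Hr1 x ex))// -invfM lef_pV2 ?posrE ?mulr_gt0 ?addr_gt0//.
      by move: s1; lra.
    by rewrite -[leLHS]add0r lerD2r mulr_ge0 ?invr_ge0 ?sqr_ge0// mulr_ge0.
have [c [r2 [c0 Hc]]] := limf_einf_gt0 HV.
pose r := `|r2| + rL + 2; pose rho := r ^+ 2.
have r1' : 1 <= r by rewrite /r; have := normr_ge0 r2; move: rL0; lra.
have rr : rL + 1 <= r by rewrite /r; have := normr_ge0 r2; lra.
have VC x : rho <= sqn x -> c / sqn x <= V x.
  move=> rx; have [_ _ _ _ s1] := far r x r1' rr rx.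
  rewrite ler_pdivrMr ?(lt_le_trans ltr01 s1)// mulrC -enorm_sq Hc//.
  apply: (@lt_le_trans _ _ r).
    by rewrite /r; have := ler_norm r2; move: rL0; lra.
  by rewrite -ler_sqr ?nnegrE ?enorm_ge0 ?(le_trans ler01)// enorm_sq.
(* [eps] is so small that [(1 - mu) V / eps ^ 2] absorbs the penalty potential *)
near=> eps => u Hu.
have eps0 : 0 < eps by [].
have eps1 : eps <= 1 by near: eps; exact: nbhs_right_le.
have epsc : eps <= (1 - mu) * c / (2 + kappa).
  near: eps; apply: nbhs_right_le; rewrite divr_gt0 ?mulr_gt0 ?subr_gt0//.
  by rewrite ltr_wpDr.
have N0 : (0 < N)%N := ltnW N2.
have [[Hsym _] _ _ _] := Hu.
have [wu _ LVu] := weighted_H1_finite N0 mV V0 eps0 Hsym.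
have mU : measurable_fun setT u by case: wu => /locally_L1_measurable.
have rho0 : 0 < rho by rewrite exprn_gt0// (lt_le_trans ltr01).
apply: (least_energy_Lfun2 (rho := rho) (C := kappa)
  (B := c^-1 * \int[lebesgue_rV R N]_x `|V x * u x ^+ 2|)
  N2 cf f0 mV mh V0 (ltW mu0) eps0 (sqr_ge0 r) Hu).
- by move=> x /(far r x r1' rr)[].
- by move=> m m1; apply: annulus_mass_potential => //; exact: lt_le_trans m1.
- right => m m1; have m0 := lt_le_trans ltr01 m1.
  exists (c / m) => [|x /andP[rx xm]]; first exact: divr_gt0.
  apply: le_trans (VC x rx); rewrite ler_wpM2l ?(ltW c0)// lef_pV2 ?posrE//.
  exact: lt_le_trans rx.
- right => x rx; have [_ _ _ _ s1] := far r x r1' rr rx.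
  have s0 : 0 < sqn x := lt_le_trans ltr01 s1.
  have h1 := penalty_le kappa0 beta0 x.
  have h2 : (2 + kappa) / sqn x <= eps ^- 2 * ((1 - mu) * V x).
    rewrite ler_pdivlMl ?exprn_gt0//.
    apply: (@le_trans _ _ ((1 - mu) * (c / sqn x))); last by rewrite ler_wpM2l// VC.
    rewrite !mulrA ler_wpM2r ?invr_ge0 ?(ltW s0)//.
    have : eps * (2 + kappa) <= (1 - mu) * c by rewrite -ler_pdivlMr// ltr_wpDr.
    by apply: le_trans; rewrite ler_wpM2r ?addr_ge0// expr2 ler_piMr// ltW.
  have h3 : 2 / (1 + sqn x) <= 2 / sqn x.
    by rewrite ler_wpM2l// lef_pV2 ?posrE// ?lerDr// ltr_wpDr// ltW.
  by move: h1 h2 h3; rewrite mulrDl; lra.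
Unshelve. all: by end_near. Qed.
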